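(* Let $\lambda$ be a Cherednik diagram of degree $n$. For some coefficients $a_w\in\mathbb C(q)$, we have the equality in $\mathcal H_n$ $$E_\lambda=a\,T_{w_\lambda}+\sum_{\ell(w)<\ell(w_\lambda)}a_w\,T_w,\qquad\text{where}\qquad a=\prod_{m\ge1}f_m^{\,p_m}.$$
   Context: **Hecke algebra.** $q$ is a formal parameter. $\mathcal H_n$ is the associative $\mathbb C(q)$-algebra with generators $T_1,\ldots,T_{n-1}$ and relations $T_kT_{k+1}T_k=T_{k+1}T_kT_{k+1}$ for $1\le k\le n-2$; $T_kT_l=T_lT_k$ for $|k-l|>1$; $(T_k-q)(T_k+1)=0$. $s_k=(k,k+1)\in\mathcal S_n$; $\ell$ is the length function; $T_w=T_{k_1}\cdots T_{k_m}$ for any reduced decomposition $w=s_{k_1}\cdots s_{k_m}$; $w_0$ is the longest element. **Cherednik diagrams.** A diagram $\lambda=(\lambda_1,\ldots,\lambda_r)$ with rows $\lambda_i=[a_i,b_i]$ (integers $a_i\le b_i$) is the set of boxes $\{(i,j)\in\mathbb Z^2\mid 1\le i\le r,\ a_i\le j\le b_i\}$; its degree is $n=\sum_i(b_i-a_i+1)$. It is a Cherednik diagram if for each $i=1,\ldots,r-1$ either $b_{i+1}\le b_i$, or $b_{i+1}=b_i+1$ and $a_{i+1}\le a_i+1$. The row filling $\Lambda$ is obtained by filling the boxes with $1,\ldots,n$, row by row from left to right and then from top (row $1$) to bottom (row $r$). The content of the box $(i,j)$ is $j-i$, and $c_k$ is the content of the box filled with $k$ in $\Lambda$. Rows $\lambda_i,\lambda_j$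 are parallel if $a_i-i=a_j-j$ and $b_i-i=b_j-j$. **The element $E_\lambda$.** Put $\langle x\rangle=(1-q)/(1-x)$ and $\varphi_k(x_1,\ldots,x_n)=T_k+\langle x_{k+1}/x_k\rangle$. For $w\in\mathcal S_n$ and an $\mathcal H_n$-valued rational function $\psi$ put ${}^w\psi(x_1,\ldots,x_n)=\psi(x_{w(1)},\ldots,x_{w(n)})$. For a reduced decomposition $w_0=s_{k_1}\cdots s_{k_m}$ put $\varphi_0=\varphi_{k_1}({}^{s_{k_1}}\varphi_{k_2})\cdots({}^{s_{k_1}\cdots s_{k_{m-1}}}\varphi_{k_m})$, which is independent of the choice of the decomposition. $\delta_\lambda(x_1,\ldots,x_n)$ is the product of $1-x_l/x_k$ over all $k<l$ occurring in $\Lambda$ in the leftmost boxes of two parallel rows of $\lambda$ ($\delta_\lambda=1$ if there are none). $\mathcal F_\lambda\subset\mathbb C(q)^{\times n}$ is the affine subspace of points with $x_kq^{c_l}=q^{c_k}x_l$ whenever $k,l$ are in the same row of $\Lambda$. The restriction of $\delta_\lambda\varphi_0$ to $\mathcal F_\lambda$ is regular at $(q^{c_1},\ldots,q^{c_n})$, and $E_\lambda\in\mathcal H_n$ is its value there. **Special order.** $\mathcal P=\{(i,j)\mid1\le i<j\le n\}$. On $\mathcal P$: $(i,j)<_1(k,l)$ iff $i<k$, or $i=k$ and $j<l$; $(i,j)<_2(k,l)$ iff $j<l$, or $j=l$ and $i<k$. For $1\le k\le l\le r$ let $\mathcal P_{kl}$ be the set of $(i,j)\in\mathcal P$ with $i,j$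 in rows $k,l$ of $\Lambda$ respectively. The special order on $\mathcal P$ restricts on $\mathcal P_{kl}$ to $<_1$ if $b_k-k=b_l-l$ and to $<_2$ otherwise, and the blocks are ordered by $\mathcal P_{11}<\mathcal P_{12}<\mathcal P_{22}<\ldots<\mathcal P_{1r}<\mathcal P_{2r}<\ldots<\mathcal P_{rr}$. **The element $w_\lambda$.** For $(i,j)\in\mathcal P_{kl}$ put $t_{ij}=s_{j-i}$ if rows $k,l$ of $\lambda$ are not parallel; $t_{ij}=1$ if rows $k,l$ are parallel but $k<l$; $t_{ij}=s_{j-i+h}$ if $k=l$, where $h$ is the quantity of numbers in $\Lambda$ occurring in those rows which precede row $k$ and are parallel to it. Then $w_\lambda=\prod_{(i,j)\in\mathcal P}t_{ij}\in\mathcal S_n$, the product being ordered by the special order. **Constants.** $f_m=(-1)^m q^{m(m-1)/2}(q^m-1)$; $p_m$ is the number of pairs of distinct parallel rows of $\lambda$ of length $m$. *)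

(* Defs.v *)
From HB Require Import structures.
From mathcomp Require Import all_boot all_order all_algebra all_fingroup.
From mathcomp Require Import generic_quotient ring_quotient.
From mathcomp Require Import finmap boolp classical_sets reals complex.
From mathcomp.multinomials Require Import monalg.
From mathcomp.multinomials Require Import mpoly.
Set Implicit Arguments.
Unset Strict Implicit.
Unset Printing Implicit Defensive.
Import Order.TTheory GRing.Theory Num.Theory.
Local Open Scope ring_scope.
Local Open Scope quotient_scope.

(* The field C(q), with C = R[i] for R the real numbers, and its generator. *)
Definition Cq (R : realType) : fieldType := {fraction {poly complex R}}.
Definition qvar (R : realType) : Cq R := tofrac 'X.

(* ** Symmetric group.
   Indices are shifted to start at 0: the numbers 1, ..., n are the elements
   0, ..., n-1 of 'I_n, and k : 'I_n.-1 stands for the index k+1 of s_{k+1}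
   and T_{k+1}. *)
Section SymmetricGroup.
Variable n : nat.

Definition ord_lo (k : 'I_n.-1) : 'I_n :=
  Ordinal (leq_trans (ltn_ord k) (leq_pred n)).

Lemma ord_hi_subproof (k : 'I_n.-1) : (k.+1 < n)%N.
Proof. by case: k => k /=; case: n. Qed.

Definition ord_hi (k : 'I_n.-1) : 'I_n := Ordinal (ord_hi_subproof k).

Definition simple (k : 'I_n.-1) : 'S_n := tperm (ord_lo k) (ord_hi k).

(* Product u_1 u_2 ... u_m for the composition (uv)(i) = u(v(i)); the product
   of MathComp permutations composes in the opposite order. *)
Definition sprod (us : seq 'S_n) : 'S_n := (\prod_(u <- rev us) u)%g.

Definition word_perm (ks : seq 'I_n.-1) : 'S_n := sprod [seq simple k | k <- ks].

Lemma word_perm_cat ks ls :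
  word_perm (ks ++ ls) = (word_perm ls * word_perm ks)%g.
Proof. by rewrite /word_perm /sprod map_cat rev_cat big_cat. Qed.

Lemma word_perm_tperm (x y : 'I_n) : exists ks, word_perm ks = tperm x y.
Proof.
have main d : forall x y : 'I_n, nat_of_ord y = (x + d)%N ->
    exists ks, word_perm ks = tperm x y.
  elim: d => [|d IHd] {}x {}y xy.
    exists [::]; have -> : y = x by apply: val_inj; rewrite /= xy addn0.
    by rewrite tperm1 /word_perm /sprod big_nil.
  have kP : (x + d < n.-1)%N by rewrite ltn_predRL -addnS -xy.
  pose k := Ordinal kP.
  have sk : word_perm [:: k] = tperm (ord_lo k) (ord_hi k).
    by rewrite /word_perm /sprod big_seq1.
  have hiy : ord_hi k = y by apply: val_inj; rewrite /= xy addnS.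
  case: d => [|d] in IHd xy kP k sk hiy *.
    have lox : ord_lo k = x by apply: val_inj; rewrite /= addn0.
    by exists [:: k]; rewrite sk hiy lox.
  have [ks ksP] := IHd x (ord_lo k) erefl.
  exists ([:: k] ++ (ks ++ [:: k])).
  rewrite !word_perm_cat sk hiy ksP.
  have -> : (tperm (ord_lo k) y * tperm x (ord_lo k) * tperm (ord_lo k) y =
             tperm x (ord_lo k) ^ tperm (ord_lo k) y)%g.
    by rewrite conjgE tpermV mulgA.
  rewrite tpermJ tpermL tpermD //.
    by rewrite -val_eqE /= neq_ltn addnS ltnS leq_addr orbT.
  by rewrite -val_eqE /= xy neq_ltn addnS ltnS leq_addr orbT.
case/orP: (leq_total x y) => [xy|yx].
  by apply: (main (y - x)%N); rewrite subnKC.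
by rewrite tpermC; apply: (main (x - y)%N); rewrite subnKC.
Qed.

Lemma word_permP (w : 'S_n) : exists ks, word_perm ks = w.
Proof.
have [ts -> _] := prod_tpermP w.
elim: ts => [|t ts [ks IH]].
  by exists [::]; rewrite /word_perm /sprod !big_nil.
have [ls lsP] := word_perm_tperm t.1 t.2.
by exists (ks ++ ls); rewrite word_perm_cat big_cons lsP IH.
Qed.

Lemma length_subproof (w : 'S_n) :
  exists m, `[< exists2 ks, word_perm ks = w & size ks = m >].
Proof.
by have [ks ksw] := word_permP w; exists (size ks); apply/asboolP; exists ks.
Qed.

Definition length (w : 'S_n) : nat := ex_minn (length_subproof w).

Definition reduced (w : 'S_n) (ks : seq 'I_n.-1) : bool :=
  (word_perm ks == w) && (size ks == length w).

Lemma reduced_exists (w : 'S_n) : exists ks, reduced w ks.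
Proof.
rewrite /reduced /length; case: ex_minnP => m /asboolP[ks ksw <-] _.
by exists ks; rewrite ksw !eqxx.
Qed.

Definition reduced_word (w : 'S_n) : seq 'I_n.-1 :=
  xchoose (reduced_exists w).

Definition longest : 'S_n := [arg max_(w > (1%g : 'S_n)) length w]%N.

End SymmetricGroup.

(* ** Hecke algebra: the free algebra on n-1 generators modulo the two-sided
   ideal generated by the defining relations. *)

Inductive two_sided_ideal (A : nzRingType) (S : A -> Prop) : A -> Prop :=
| tsi_zero : two_sided_ideal S 0
| tsi_add u a r b : two_sided_ideal S u -> S r ->
    two_sided_ideal S (u + a * r * b).

Section QuotientAlgebra.
Variables (K : fieldType) (A : algType K) (S : A -> Prop).

Definition ideal : {pred A} := fun f => `[< two_sided_ideal S f >].

Lemma tsiD u v :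
  two_sided_ideal S u -> two_sided_ideal S v -> two_sided_ideal S (u + v).
Proof.
move=> Su; elim=> [|v' a r b _ IH Sr]; first by rewrite addr0.
by rewrite addrA; apply: tsi_add.
Qed.

Lemma tsiM c d u : two_sided_ideal S u -> two_sided_ideal S (c * u * d).
Proof.
elim=> [|v a r b _ IH Sr]; first by rewrite mulr0 mul0r; apply: tsi_zero.
rewrite mulrDr mulrDl !mulrA -(mulrA _ b d).
exact: tsi_add.
Qed.

Lemma ideal_zmod_closed : zmod_closed ideal.
Proof.
split=> [|u v /asboolP Iu /asboolP Iv]; first exact/asboolP/tsi_zero.
apply/asboolP; apply: tsiD => //.
by rewrite -mulN1r -[_ * v]mulr1; apply: tsiM.
Qed.
HB.instance Definition _ := GRing.isZmodClosed.Build A ideal ideal_zmod_closed.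

Lemma ideal_mul c d u : u \in ideal -> c * u * d \in ideal.
Proof. by move=> /asboolP Iu; apply/asboolP/tsiM. Qed.

Definition quot_alg := Quotient.quot ideal.
HB.instance Definition _ := GRing.Zmodule.on quot_alg.

Definition to_quot (f : A) : quot_alg := \pi_quot_alg f.

Lemma to_quot_repr (x : quot_alg) : to_quot (repr x) = x.
Proof. exact: reprK. Qed.

Lemma to_quotP (f g : A) : reflect (to_quot f = to_quot g) (f - g \in ideal).
Proof. by rewrite Quotient.idealrBE; apply: eqP. Qed.

Lemma to_quotB : zmod_morphism to_quot.
Proof. by move=> f g; rewrite /to_quot !piE. Qed.
HB.instance Definition _ := GRing.isZmodMorphism.Build A quot_alg to_quot to_quotB.

Definition quot_one : quot_alg := to_quot 1.
Definition quot_mul (x y : quot_alg) : quot_alg := to_quot (repr x * repr y).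
Definition quot_scale (c : K) (x : quot_alg) : quot_alg := to_quot (c *: repr x).

Lemma to_quotM f g : to_quot (f * g) = quot_mul (to_quot f) (to_quot g).
Proof.
apply/to_quotP; set f' := repr _; set g' := repr _.
have If : f - f' \in ideal by apply/to_quotP; rewrite to_quot_repr.
have Ig : g - g' \in ideal by apply/to_quotP; rewrite to_quot_repr.
have -> : f * g - f' * g' = 1 * (f - f') * g + f' * (g - g') * 1.
  by rewrite mul1r mulr1 mulrBl mulrBr addrA subrK.
by apply: rpredD; apply: ideal_mul.
Qed.

Lemma to_quotZ c f : to_quot (c *: f) = quot_scale c (to_quot f).
Proof.
apply/to_quotP; set f' := repr _.
have If : f - f' \in ideal by apply/to_quotP; rewrite to_quot_repr.
by rewrite -scalerBr -[f - f']mul1r scalerAl -[_ * _]mulr1 ideal_mul.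
Qed.

Lemma quot_mulA : associative quot_mul.
Proof.
move=> x y z; rewrite -[x]to_quot_repr -[y]to_quot_repr -[z]to_quot_repr.
by rewrite -!to_quotM mulrA.
Qed.

Lemma quot_mul1l : left_id quot_one quot_mul.
Proof. by move=> x; rewrite -[x]to_quot_repr -to_quotM mul1r. Qed.

Lemma quot_mul1r : right_id quot_one quot_mul.
Proof. by move=> x; rewrite -[x]to_quot_repr -to_quotM mulr1. Qed.

Lemma quot_mulDl : left_distributive quot_mul +%R.
Proof.
move=> x y z; rewrite -[x]to_quot_repr -[y]to_quot_repr -[z]to_quot_repr.
by rewrite -raddfD -!to_quotM mulrDl raddfD.
Qed.

Lemma quot_mulDr : right_distributive quot_mul +%R.
Proof.
move=> x y z; rewrite -[x]to_quot_repr -[y]to_quot_repr -[z]to_quot_repr.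
by rewrite -raddfD -!to_quotM mulrDr raddfD.
Qed.

Lemma quot_1_neq0 (chi : {rmorphism A -> K}) :
  (forall r, S r -> chi r = 0) -> quot_one != 0.
Proof.
move=> chiS; apply/eqP; rewrite -(raddf0 to_quot) => /to_quotP/asboolP.
rewrite subr0 => I1; have : chi 1 = 0.
  elim: I1 => [|u a r b _ IH Sr]; first exact: rmorph0.
  by rewrite rmorphD !rmorphM (chiS _ Sr) mulr0 mul0r addr0.
by rewrite rmorph1 => /eqP; rewrite oner_eq0.
Qed.

Lemma quot_scaleA a b x :
  quot_scale a (quot_scale b x) = quot_scale (a * b) x.
Proof. by rewrite -[x]to_quot_repr -!to_quotZ scalerA. Qed.

Lemma quot_scale1 : left_id 1 quot_scale.
Proof. by move=> x; rewrite -[x]to_quot_repr -to_quotZ scale1r. Qed.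

Lemma quot_scaleDr : right_distributive quot_scale +%R.
Proof.
move=> a x y; rewrite -[x]to_quot_repr -[y]to_quot_repr.
by rewrite -raddfD -!to_quotZ scalerDr raddfD.
Qed.

Lemma quot_scaleDl x : {morph quot_scale^~ x : a b / a + b}.
Proof.
by move=> a b; rewrite /= -[x]to_quot_repr -!to_quotZ scalerDl raddfD.
Qed.

Lemma quot_scaleAl a x y :
  quot_scale a (quot_mul x y) = quot_mul (quot_scale a x) y.
Proof.
rewrite -[x]to_quot_repr -[y]to_quot_repr.
by rewrite -!(to_quotM, to_quotZ) scalerAl.
Qed.

Lemma quot_scaleAr a x y :
  quot_scale a (quot_mul x y) = quot_mul x (quot_scale a y).
Proof.
rewrite -[x]to_quot_repr -[y]to_quot_repr.
by rewrite -!(to_quotM, to_quotZ) scalerAr.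
Qed.

End QuotientAlgebra.

Lemma malgZAr (M : monomType) (K : comNzRingType) c (f g : malg M K) :
  c *: (f * g) = f * (c *: g).
Proof.
apply/malgP=> k; rewrite monalg.mcoeffZ monalg.mcoeffMl mulr_sumr.
rewrite (monalg.mcoeffMlw _ (fsubset_refl _) (monalg.msuppZ_le c g)).
apply: eq_bigr => k1 _; rewrite mulr_sumr; apply: eq_bigr => k2 _.
by rewrite monalg.mcoeffZ mulrnAr mulrCA.
Qed.

Section FreeAlgebra.
Variables (K : fieldType) (I : choiceType).

(* K[M] for M the free monoid on I *)
Definition free_alg := malg {fmonom I} K.
HB.instance Definition _ := GRing.Lalgebra.on free_alg.
HB.instance Definition _ :=
  GRing.Lalgebra_isAlgebra.Build K free_alg (@malgZAr _ _).

Definition free_gen (i : I) : free_alg := mkmalgU (fmu i) 1.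

Variable c : K.

Definition fmonom_char (m : {fmonom I}) : K := c ^+ size m.

Lemma fmonom_char_mmorphism : mmorphism fmonom_char.
Proof.
split=> [m1 m2|]; first by rewrite /fmonom_char fmM size_cat exprD.
by rewrite /fmonom_char fm1.
Qed.
HB.instance Definition _ :=
  monalg.isMultiplicative.Build {fmonom I} K fmonom_char fmonom_char_mmorphism.

Definition free_char : {rmorphism free_alg -> K} :=
  monalg.mmap idfun fmonom_char.

Lemma free_char_gen i : free_char (free_gen i) = c.
Proof. by rewrite /= monalg.mmapU mul1r /fmonom_char fmU expr1. Qed.

Lemma free_charA a : free_char a%:A = a.
Proof. by rewrite /= monalg.mmapZ monalg.mmap1 mulr1. Qed.

End FreeAlgebra.

Section HeckeAlgebra.
Variables (K : fieldType) (q : K).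

Inductive hecke_rel (n : nat) (A : algType K) (g : 'I_n.-1 -> A) : A -> Prop :=
| hecke_braid (k l : 'I_n.-1) : l = k.+1 :> nat ->
    hecke_rel g (g k * g l * g k - g l * g k * g l)
| hecke_comm (k l : 'I_n.-1) : (k.+1 < l)%N || (l.+1 < k)%N ->
    hecke_rel g (g k * g l - g l * g k)
| hecke_quad (k : 'I_n.-1) :
    hecke_rel g ((g k - q%:A) * (g k + 1)).

(* T_k |-> q is a character, so that the algebra is not trivial. *)
Lemma hecke_rel_char n (A : algType K) (g : 'I_n.-1 -> A)
    (chi : {rmorphism A -> K}) r :
  (forall k, chi (g k) = q) -> (forall a, chi a%:A = a) ->
  hecke_rel g r -> chi r = 0.
Proof.
move=> chig chiA; case=> [k l _|k l _|k].
- by rewrite rmorphB !rmorphM !chig subrr.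
- by rewrite rmorphB !rmorphM !chig subrr.
- by rewrite rmorphM rmorphB chig chiA subrr mul0r.
Qed.

Variable n : nat.

Definition hecke_ideal_gen := hecke_rel (@free_gen K 'I_n.-1).

Definition hecke := quot_alg hecke_ideal_gen.
HB.instance Definition _ := GRing.Zmodule.on hecke.

Lemma hecke_1_neq0 : quot_one hecke_ideal_gen != 0.
Proof.
apply: (@quot_1_neq0 _ _ _ (free_char _ q)) => r; apply: hecke_rel_char.
  exact: free_char_gen.
exact: free_charA.
Qed.

HB.instance Definition _ := GRing.Zmodule_isNzRing.Build hecke
  (@quot_mulA _ _ hecke_ideal_gen) (@quot_mul1l _ _ _) (@quot_mul1r _ _ _)
  (@quot_mulDl _ _ _) (@quot_mulDr _ _ _) hecke_1_neq0.
HB.instance Definition _ := GRing.Zmodule_isLmodule.Build K hecke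
  (@quot_scaleA _ _ hecke_ideal_gen) (@quot_scale1 _ _ _)
  (@quot_scaleDr _ _ _) (@quot_scaleDl _ _ _).
HB.instance Definition _ :=
  GRing.Lmodule_isLalgebra.Build K hecke (@quot_scaleAl _ _ hecke_ideal_gen).
HB.instance Definition _ :=
  GRing.Lalgebra_isAlgebra.Build K hecke (@quot_scaleAr _ _ hecke_ideal_gen).

Definition Tgen (k : 'I_n.-1) : hecke := to_quot hecke_ideal_gen (free_gen K k).

End HeckeAlgebra.

(* ** T_w and the function phi_0, for an algebra H with elements T_k; these are
   meant for H = hecke q n and T = Tgen q.
   An H-valued rational function is represented by the function it defines on
   points x : 'I_n -> K at which none of its denominators vanishes. *)
Section Phi.
Variables (K : fieldType) (q : K) (n : nat) (H : algType K).
Variable T : 'I_n.-1 -> H.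
Notation point := ('I_n -> K).

Definition Tword (ks : seq 'I_n.-1) : H := \prod_(k <- ks) T k.

Definition Tw (w : 'S_n) : H := Tword (reduced_word w).

Definition angle (x : K) : K := (1 - q) / (1 - x).

Definition phi (k : 'I_n.-1) (x : point) : H :=
  T k + (angle (x (ord_hi k) / x (ord_lo k)))%:A.

Definition act (w : 'S_n) (psi : point -> H) : point -> H :=
  fun x => psi (fun i => x (w i)).

Definition phi_word (ks : seq 'I_n.-1) (x : point) : H :=
  \prod_(j < size ks)
     act (word_perm (take j ks)) (phi (tnth (in_tuple ks) j)) x.

Definition phi0 : point -> H := phi_word (reduced_word (longest n)).

(* The denominators of phi_0 are x_k and 1 - x_l / x_k, for k <> l. *)
Definition generic (x : point) : Prop :=
  injective x /\ (forall i, x i != 0).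

(* An H-valued polynomial sum_u u.1 * u.2 and its value at x *)
Definition hpoly_eval (P : seq (mpoly.mpoly n K * H)) (x : point) :
    H :=
  \sum_(u <- P) u.1.@[x] *: u.2.

(* f is a rational function on the affine subspace F, defined at least at the
   points of F satisfying dom; it coincides with a fraction P / D whose
   denominator does not vanish at p, and E = P(p) / D(p). *)
Definition regular_with_value (F dom : point -> Prop) (f : point -> H)
    (p : point) (E : H) : Prop :=
  exists (P : seq (mpoly.mpoly n K * H)) (D : mpoly.mpoly n K),
    [/\ D.@[p] != 0,
        forall x, F x -> dom x -> D.@[x] *: f x = hpoly_eval P x
      & D.@[p] *: E = hpoly_eval P p].

End Phi.

(* ** Diagrams.  A diagram is the sequence of the pairs (a_i, b_i); rows are
   numbered from 1 to [size la]. *)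
Section Diagram.
Variable la : seq (int * int).

Definition row_a (i : nat) : int := (nth (0, 0) la i.-1).1.
Definition row_b (i : nat) : int := (nth (0, 0) la i.-1).2.
Definition row_len (i : nat) : nat := `|(row_b i - row_a i + 1)%R|%N.

Definition diagram : Prop :=
  forall i, (1 <= i <= size la)%N -> row_a i <= row_b i.

Definition degree : nat := (\sum_(1 <= i < (size la).+1) row_len i)%N.

Definition cherednik : Prop :=
  diagram /\
  forall i, (1 <= i < size la)%N ->
    row_b i.+1 <= row_b i \/
    (row_b i.+1 = row_b i + 1 /\ row_a i.+1 <= row_a i + 1).

(* The boxes (i, j) in the order of the row filling *)
Definition boxes : seq (nat * int) :=
  [seq (i, row_a i + j%:Z) | i <- iota 1 (size la), j <- iota 0 (row_len i)].

(* The number k+1 of the row filling lies in the box [box k]. *)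
Definition box (k : nat) : nat * int := nth (0%N, 0) boxes k.
Definition row_of (k : nat) : nat := (box k).1.
Definition content (k : nat) : int := (box k).2 - (row_of k)%:Z.
Definition leftmost (k : nat) : bool := (box k).2 == row_a (row_of k).

Definition parallel (i j : nat) : bool :=
  (row_a i - i%:Z == row_a j - j%:Z) && (row_b i - i%:Z == row_b j - j%:Z).

Definition parallel_pairs (m : nat) : nat :=
  (\sum_(1 <= j < (size la).+1) \sum_(1 <= i < j)
     (parallel i j && (row_len i == m)))%N.

End Diagram.

Section Elements.
Variables (K : fieldType) (q : K) (n : nat) (la : seq (int * int)).
Variables (H : algType K) (T : 'I_n.-1 -> H).
Notation point := ('I_n -> K).

Definition delta (x : point) : K :=
  \prod_(k : 'I_n) \prod_(l : 'I_n |
      [&& (k < l)%N, leftmost la k, leftmost la l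
        & parallel la (row_of la k) (row_of la l)]) (1 - x l / x k).

Definition F_space (x : point) : Prop :=
  forall k l : 'I_n, row_of la k = row_of la l ->
    x k * q ^ content la l = q ^ content la k * x l.

Definition content_point : point := fun k => q ^ content la k.

(* Such an E is unique over K = C(q): the points of F_space at which generic
   holds are dense in it. *)
Definition E_elt : H :=
  xget 0 [set E | regular_with_value F_space (@generic K n)
                    (fun x => delta x *: phi0 q T x) content_point E]%classic.

Definition pairs : seq ('I_n * 'I_n) :=
  [seq p : 'I_n * 'I_n <- enum {: 'I_n * 'I_n} | (p.1 < p.2)%N].

Definition lt1 (p p' : 'I_n * 'I_n) : bool :=
  (p.1 < p'.1)%N || ((p.1 == p'.1) && (p.2 < p'.2)%N).
Definition lt2 (p p' : 'I_n * 'I_n) : bool :=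
  (p.2 < p'.2)%N || ((p.2 == p'.2) && (p.1 < p'.1)%N).

Definition special_lt (p p' : 'I_n * 'I_n) : bool :=
  let k := row_of la p.1 in let l := row_of la p.2 in
  let k' := row_of la p'.1 in let l' := row_of la p'.2 in
  if (k == k') && (l == l') then
    if row_b la k - k%:Z == row_b la l - l%:Z then lt1 p p' else lt2 p p'
  else (l < l')%N || ((l == l') && (k < k')%N).

Definition special_le (p p' : 'I_n * 'I_n) : bool :=
  (p == p') || special_lt p p'.

(* s_m for 1 <= m < n; here the index is not shifted. *)
Definition simple_nat (m : nat) : 'S_n :=
  if insub m.-1 is Some k then simple (k : 'I_n.-1) else 1%g.

(* The quantity of numbers in the rows before row k which are parallel to k *)
Definition shift (k : nat) : nat :=
  (\sum_(1 <= i < k | parallel la i k) row_len la i)%N.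

Definition t_elt (p : 'I_n * 'I_n) : 'S_n :=
  let k := row_of la p.1 in let l := row_of la p.2 in
  if k == l then simple_nat (p.2 - p.1 + shift k)
  else if parallel la k l then 1%g
  else simple_nat (p.2 - p.1).

Definition w_elt : 'S_n := sprod [seq t_elt p | p <- sort special_le pairs].

Definition f_const (m : nat) : K :=
  (-1) ^+ m * q ^+ (m * (m - 1))./2 * (q ^+ m - 1).

(* No row is longer than the degree n, hence the bound on m. *)
Definition a_const : K :=
  \prod_(1 <= m < n.+1) f_const m ^+ parallel_pairs la m.

End Elements.

(* Main.v *)
Require Import Defs.
From mathcomp Require Import all_boot all_order all_algebra all_fingroup reals.
From mathcomp Require Import zify ring.
From mathcomp.multinomials Require Import mpoly.
Set Implicit Arguments.
Unset Strict Implicit.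
Unset Printing Implicit Defensive.
Import Order.TTheory GRing.Theory Num.Theory.

(** The product phi_0 may be taken along any reduced word of w_0: reduced words
    of a permutation are connected by braid relations (reduced_word_ind), under
    which the product is invariant by the Yang-Baxter equation (yang_baxter,
    phi_rec_reduced).  The word used here treats the rows one after another: it
    first reverses row l in itself, then moves it across rows 1, ..., l-1.  Then
    the product Y of the factors met so far satisfies Y T_b = q Y whenever the
    positions b and b+1 carry two neighbours of one row in reversed order, since
    the last factor of Y can be chosen to be T_b + <q> = T_b + 1
    (phi_line_absorb).

    When a number crosses a whole row, or a row crosses a number, the factors
    have coefficients <r>, <r/q>, <r/q^2>, ... and run over a word g of distinct
    letters.  Next to Y, the identity <r> (q + <r/q>) = <r/q> turns their product
    into T_g + c S, where S is the sum of T_u over the proper prefixes u of g and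
    c is the coefficient of the last factor (chain_rcons).  So only the last
    coefficient can have a pole, and the leading term is still T_g.  By the
    condition on the diagram, the contents at the ends of the rows never increase,
    and neither do those at the starts of rows with the same end (row_ends).  So if
    the numbers of row l cross row k one by one when row k ends with a greater
    content, and the numbers of row k cross row l one by one when the two ends
    agree, then the last coefficient has no pole at the point of contents unless
    the two rows are parallel (cross_block).

    For parallel rows of length m, only the first of the m products of the second
    kind has a pole, which a factor of delta cancels.  At the point of contents
    the m products together multiply Y by the scalar f_m (parallel_residue):
    after i of them, Y has been multiplied by a multiple of the symmetrizer of m
    consecutive positions, and each further product moves these positions by one,
    until they fill those of the first row, where Y absorbs the symmetrizer.  So a
    pair of parallel rows contributes f_m, but no letter, to the leading term of
    E (evaluates_parallel, evaluates_all).  All values at the point are determined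
    because the generic points are dense in the affine subspace (F_dense).

    It remains to identify the word that is left after removing the crossings of
    parallel rows.  In the product defining w_lambda, the pairs (i,j) may be
    sorted by j and then by i, because pairs that are thereby exchanged have
    commuting factors (sprod_reorder, pair_word_comm).  The letters for a given j
    are then consecutive and descending (pair_word_column), so that the word
    inserts one number after another among smaller ones, hence is reduced
    (reduced_normal_word).  The word left from w_0 has the same effect on
    one-line notations and the same size (run_diagram_word, size_diagram_word),
    so it is another reduced word of w_lambda (reduced_diagram_word). *)

(** * Length and reduced words in the symmetric group *)

Section Inversions.
Local Open Scope group_scope.
Variable n : nat.
Implicit Types (w : 'S_n) (k l : 'I_n.-1) (ks ls : seq 'I_n.-1).

Definition inversions w : {set 'I_n * 'I_n} :=
  [set p : 'I_n * 'I_n | (p.1 < p.2)%N && (w p.2 < w p.1)%N].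

Definition ascent w k : bool := (w (ord_lo k) < w (ord_hi k))%N.

Lemma simple_lt k (i j : 'I_n) : (i < j)%N -> (i, j) != (ord_lo k, ord_hi k) ->
  (simple k i < simple k j)%N.
Proof.
rewrite xpair_eqE -!val_eqE /= /simple => ij nkk.
case: tpermP => [ie|ie|/eqP/negbTE ie /eqP/negbTE ie'];
  case: tpermP => [je|je|/eqP/negbTE je /eqP/negbTE je'];
  move: ij nkk; rewrite ?ie ?je; rewrite -?val_eqE /= in ie je *; lia.
Qed.

Lemma simpleK k : involutive (simple k).
Proof. exact: tpermK. Qed.

Lemma simple_mulK k w : simple k * (simple k * w) = w.
Proof. by rewrite mulgA /simple tperm2 mul1g. Qed.

Lemma simple_lo k : simple k (ord_lo k) = ord_hi k.
Proof. exact: tpermL. Qed.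

Lemma simple_hi k : simple k (ord_hi k) = ord_lo k.
Proof. exact: tpermR. Qed.

Lemma ascent_simple w k : ascent (simple k * w) k = ~~ ascent w k.
Proof.
rewrite /ascent !permM simple_lo simple_hi -leqNgt ltn_neqAle.
rewrite andb_idl // => _; apply/eqP => /val_inj/perm_inj/(congr1 val) /=; lia.
Qed.

(** The transposition of k and k+1 permutes the pairs of positions, and reverses
    the order of no pair other than (k, k+1). *)
Lemma inversions_simple w k : ascent w k ->
  #|inversions (simple k * w)| = #|inversions w|.+1.
Proof.
move=> wk; pose f (p : 'I_n * 'I_n) := (simple k p.1, simple k p.2).
have fK : involutive f by case=> i j; rewrite /f /= !simpleK.
have -> : #|inversions (simple k * w)| = #|f @^-1: inversions (simple k * w)|.
  by rewrite card_preimset //; apply: inv_inj.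
have -> : f @^-1: inversions (simple k * w) = (ord_hi k, ord_lo k) |: inversions w.
  apply/setP=> -[i j]; rewrite !inE /= !permM !simpleK.
  case: eqP => [[-> ->]|/eqP nhl] /=.
    by rewrite simple_lo simple_hi /= leqnn.
  case: (ltngtP i j) => [ij|ji|/val_inj->]; rewrite ?ltnn //=.
    case: (eqVneq (i, j) (ord_lo k, ord_hi k)) => [[-> ->]|nlh].
      by rewrite simple_lo simple_hi /= ltnNge leqnSn /= ltnNge ltnW.
    by rewrite simple_lt.
  have nji : (j, i) != (ord_lo k, ord_hi k).
    by move: nhl; rewrite !xpair_eqE andbC.
  by rewrite ltnNge (ltnW (simple_lt ji nji)).
by rewrite cardsU1 inE /= ltnNge leqnSn.
Qed.

Lemma inversions_descent w k : ~~ ascent w k ->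
  #|inversions w| = #|inversions (simple k * w)|.+1.
Proof.
rewrite -ascent_simple => /inversions_simple.
by rewrite simple_mulK.
Qed.

Lemma word_perm_rcons ks k : word_perm (rcons ks k) = simple k * word_perm ks.
Proof. by rewrite -cats1 word_perm_cat /word_perm /sprod big_seq1. Qed.

Lemma word_perm_nil : word_perm ([::] : seq 'I_n.-1) = 1.
Proof. by rewrite /word_perm /sprod big_nil. Qed.

Lemma inversions1 : #|inversions 1| = 0%N.
Proof.
apply/eqP; rewrite cards_eq0; apply/eqP/setP=> -[i j].
by rewrite !inE !perm1 /=; case: ltngtP.
Qed.

Lemma inversions_word ks : (#|inversions (word_perm ks)| <= size ks)%N.
Proof.
elim/last_ind: ks => [|ks k IH]; first by rewrite word_perm_nil inversions1.
rewrite word_perm_rcons size_rcons; case: (boolP (ascent (word_perm ks) k)) => [a|d].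
  by rewrite inversions_simple.
by move: IH; rewrite (inversions_descent d); lia.
Qed.

Lemma no_descent w : (forall k, ascent w k) -> w = 1.
Proof.
move=> wA.
have mono d (i j : 'I_n) : nat_of_ord j = (i + d.+1)%N -> (w i < w j)%N.
  elim: d j => [|d IH] j ij.
    have kP : (i < n.-1)%N by have := ltn_ord j; lia.
    have := wA (Ordinal kP); rewrite /ascent.
    have -> : ord_lo (Ordinal kP) = i by exact: val_inj.
    by have -> : ord_hi (Ordinal kP) = j by apply: val_inj; rewrite /= ij addn1.
  have kP : (i + d.+1 < n.-1)%N by have := ltn_ord j; lia.
  have := wA (Ordinal kP); rewrite /ascent.
  have -> : ord_hi (Ordinal kP) = j by apply: val_inj; rewrite /= ij !addnS.
  by move=> h; apply: ltn_trans (IH (ord_lo (Ordinal kP)) erefl) h.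
have ge d (i : 'I_n) : nat_of_ord i = d -> (d <= w i)%N.
  elim: d i => // d IH i id.
  have iP : (d < n)%N by have := ltn_ord i; lia.
  have := IH (Ordinal iP) erefl.
  by have := mono 0%N (Ordinal iP) i; rewrite id /= addn1 => /(_ erefl); lia.
have le d (i : 'I_n) : (i + d).+1 = n -> (w i + d < n)%N.
  elim: d i => [|d IH] i id; first by rewrite addn0 ltn_ord.
  have iP : (i.+1 < n)%N by lia.
  have := IH (Ordinal iP); have := mono 0%N i (Ordinal iP).
  by rewrite /= addn1 => /(_ erefl) a /(_ ltac:(lia)); lia.
apply/permP=> i; rewrite perm1; apply: val_inj => /=.
have := ge _ i erefl; have := le (n - i).-1 i; have := ltn_ord i; lia.
Qed.

Lemma descent_exists w : w != 1 -> exists k, ~~ ascent w k.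
Proof.
move=> w1; apply/existsP; rewrite -negb_forall; apply: contra w1 => /forallP h.
exact/eqP/no_descent.
Qed.

Lemma inversions_word_exists w :
  exists2 ks, word_perm ks = w & size ks = #|inversions w|.
Proof.
move: {2}_.+1 (ltnSn #|inversions w|) => N; elim: N w => // N IH w wN.
case: (eqVneq w 1) => [->|/descent_exists[k kd]].
  by exists [::]; rewrite ?word_perm_nil // inversions1.
have := inversions_descent kd => e; have [|ks ksw ksz] := IH (simple k * w).
  by move: wN; rewrite e.
by exists (rcons ks k); rewrite ?word_perm_rcons ?ksw ?simple_mulK // size_rcons ksz e.
Qed.

Lemma length_inversions w : length w = #|inversions w|.
Proof.
rewrite /length; case: ex_minnP => m /boolp.asboolP[ks ksw ksm] mmin.
apply/eqP; rewrite eqn_leq -{2}ksm -ksw inversions_word andbT.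
apply: mmin; apply/boolp.asboolP; have [ls lsw lsz] := inversions_word_exists w.
by exists ls; rewrite ?ksw // lsz.
Qed.

Lemma length_ascent w k : ascent w k -> length (simple k * w) = (length w).+1.
Proof. by rewrite !length_inversions; apply: inversions_simple. Qed.

Lemma length_descent w k : ~~ ascent w k -> length w = (length (simple k * w)).+1.
Proof. by rewrite !length_inversions; apply: inversions_descent. Qed.

Lemma length_word ks : (length (word_perm ks) <= size ks)%N.
Proof. by rewrite length_inversions inversions_word. Qed.

Lemma length1 : length (1 : 'S_n) = 0%N.
Proof. by rewrite length_inversions inversions1. Qed.

Lemma reduced_nil : reduced 1 ([::] : seq 'I_n.-1).
Proof. by rewrite /reduced word_perm_nil length1 !eqxx. Qed.

Lemma reduced_rcons w ks k : reduced (simple k * w) (rcons ks k) =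
  ascent w k && reduced w ks.
Proof.
rewrite /reduced word_perm_rcons size_rcons (inj_eq (mulgI _)).
case: (boolP (ascent w k)) => [a|d] /=; first by rewrite length_ascent.
apply/negbTE/nandP; case: eqP => [ksw|_]; [right | by left].
move: d; rewrite -ksw => /length_descent; have := length_word ks; lia.
Qed.

Lemma simple_fix k (x : 'I_n) : x != ord_lo k -> x != ord_hi k -> simple k x = x.
Proof. by move=> x1 x2; rewrite /simple tpermD // eq_sym. Qed.

Lemma simple_braid k l : l = k.+1 :> nat ->
  simple l * (simple k * simple l) = simple k * (simple l * simple k).
Proof.
move=> lk; have hilo : ord_hi k = ord_lo l by apply: val_inj; rewrite /= lk.
have -> : simple l * (simple k * simple l) = simple k ^ simple l.
  by rewrite conjgE tpermV mulgA.
have -> : simple k * (simple l * simple k) = simple l ^ simple k.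
  by rewrite conjgE tpermV mulgA.
rewrite !tpermJ hilo simple_lo -hilo simple_hi.
by rewrite !simple_fix // -val_eqE /= lk; lia.
Qed.

Lemma simple_comm k l : (k.+1 < l)%N -> simple l * simple k = simple k * simple l.
Proof.
move=> kl; suff : simple k ^ simple l = simple k.
  by move/(congr1 (fun z => simple l * z)); rewrite -conjgC.
by rewrite {1}/simple tpermJ !simple_fix // -val_eqE /=; lia.
Qed.

(** Matsumoto's theorem.  If two reduced words of w have distinct last letters k
    and l, both are descents of w, so that w also has reduced words ending in
    the two sides of the braid relation between k and l; these are compared with
    the given words by induction. *)
Lemma reduced_word_ind (A : Type) (f : seq 'I_n.-1 -> A) :
  (forall us k l vs, l = k.+1 :> nat ->
     f (us ++ [:: k; l; k] ++ vs) = f (us ++ [:: l; k; l] ++ vs)) ->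
  (forall us k l vs, (k.+1 < l)%N ->
     f (us ++ [:: k; l] ++ vs) = f (us ++ [:: l; k] ++ vs)) ->
  forall w ks ls, reduced w ks -> reduced w ls -> f ks = f ls.
Proof.
move=> fbraid fcomm.
suff main N w ks ls vs : (size ks <= N)%N -> reduced w ks -> reduced w ls ->
    f (ks ++ vs) = f (ls ++ vs).
  by move=> w ks ls ksw lsw; rewrite -[ks]cats0 -[ls]cats0; apply: (main (size ks) w).
elim: N w ks ls vs => [|N IH] w ks ls vs ksN.
  rewrite /reduced => /andP[_ /eqP ks0] /andP[_ /eqP ls0].
  have /nilP-> : nilp ks by rewrite /nilp; lia.
  by have /nilP-> : nilp ls by rewrite /nilp; lia.
case/lastP: ks ksN => [|ks k] ksN.
  rewrite /reduced => /andP[_ /eqP ks0] /andP[_ /eqP ls0].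
  by have /nilP-> : nilp ls by move: ks0 ls0; rewrite /nilp /=; lia.
case/lastP: ls => [|ls l].
  rewrite /reduced size_rcons => /andP[_ /eqP ks0] /andP[_ /eqP ls0].
  by move: ls0; rewrite -ks0.
rewrite size_rcons ltnS in ksN.
have wl (m : 'I_n.-1) ms : reduced w (rcons ms m) ->
    ascent (simple m * w) m /\ reduced (simple m * w) ms.
  by rewrite -{1}(simple_mulK m w) reduced_rcons => /andP.
move=> /wl[kw ksw] /wl[lw lsw]; rewrite !cat_rcons.
have szks : size ks = length (simple k * w) by case/andP: ksw => _ /eqP.
have szls : size ls = length (simple l * w) by case/andP: lsw => _ /eqP.
have szkl : size ls = size ks.
  have := length_ascent kw; have := length_ascent lw.
  by rewrite !simple_mulK; lia.
suff main (k' l' : 'I_n.-1) ks' ls' : (k' < l')%N -> (size ks' <= N)%N ->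
    (size ls' <= N)%N ->
    ascent (simple k' * w) k' -> reduced (simple k' * w) ks' ->
    ascent (simple l' * w) l' -> reduced (simple l' * w) ls' ->
    f (ks' ++ k' :: vs) = f (ls' ++ l' :: vs).
  case: (ltngtP k l) => [kl|lk|/val_inj kl].
  - by apply: main => //; rewrite szkl.
  - by symmetry; apply: main => //; rewrite szkl.
  - by subst l; apply: IH lsw.
move: ks' ls' k' l' {k l ks ls ksN ksw lsw kw lw szks szls szkl wl} => ks ls k l.
move=> kl ksN lsN kw ksw lw lsw; move: (kl); rewrite leq_eqVlt => /orP[/eqP lk|k1l].
  have hilo : ord_hi k = ord_lo l by apply: val_inj; rewrite /= lk.
  have k_hi : simple k (ord_hi l) = ord_hi l.
    by apply: simple_fix; rewrite -val_eqE /=; lia.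
  have l_lo : simple l (ord_lo k) = ord_lo k.
    by apply: simple_fix; rewrite -val_eqE /=; lia.
  have braid : simple l * (simple k * (simple l * w)) =
               simple k * (simple l * (simple k * w)).
    by have := simple_braid (esym lk); rewrite !mulgA => ->.
  pose u := simple k * (simple l * (simple k * w)).
  have ksu : simple k * w = simple l * (simple k * u) by rewrite /u !simple_mulK.
  have lsu : simple l * w = simple k * (simple l * u).
    by rewrite /u -braid !simple_mulK.
  have abc : (w (ord_hi l) < w (ord_lo l) < w (ord_lo k))%N.
    by move: kw lw; rewrite /ascent !permM !simple_lo !simple_hi hilo => -> ->.
  have [us usu] := reduced_exists u.
  have k_lo : simple k (ord_lo k) = ord_lo l by rewrite simple_lo.
  have k_mid : simple k (ord_lo l) = ord_lo k by rewrite -hilo simple_hi.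
  pose vals := (k_lo, k_mid, k_hi, l_lo, simple_lo l, simple_hi l).
  case/andP: abc => cb ba; have ca := ltn_trans cb ba.
  have kus : reduced (simple k * w) (rcons (rcons us k) l).
    by rewrite ksu !reduced_rcons usu /ascent /u !permM hilo !vals cb ca.
  have lus : reduced (simple l * w) (rcons (rcons us l) k).
    by rewrite lsu !reduced_rcons usu /ascent /u !permM hilo !vals ba ca.
  rewrite (IH _ ks (rcons (rcons us k) l) (k :: vs) ksN ksw kus).
  rewrite (IH _ ls (rcons (rcons us l) k) (l :: vs) lsN lsw lus).
  by rewrite !cat_rcons; apply: fbraid.
have k_lo : simple k (ord_lo l) = ord_lo l by apply: simple_fix; rewrite -val_eqE /=; lia.
have k_hi : simple k (ord_hi l) = ord_hi l by apply: simple_fix; rewrite -val_eqE /=; lia.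
have l_lo : simple l (ord_lo k) = ord_lo k by apply: simple_fix; rewrite -val_eqE /=; lia.
have l_hi : simple l (ord_hi k) = ord_hi k by apply: simple_fix; rewrite -val_eqE /=; lia.
have comm : simple l * (simple k * w) = simple k * (simple l * w).
  by rewrite !mulgA simple_comm.
have [us usu] := reduced_exists (simple l * (simple k * w)).
have ksu : reduced (simple k * w) (rcons us l).
  rewrite -(simple_mulK l (simple k * w)) reduced_rcons usu andbT.
  by move: lw; rewrite /ascent !permM !(simple_lo, simple_hi) k_lo k_hi.
have lsu : reduced (simple l * w) (rcons us k).
  rewrite -(simple_mulK k (simple l * w)) -comm reduced_rcons usu andbT comm.
  by move: kw; rewrite /ascent !permM !(simple_lo, simple_hi) l_lo l_hi.
rewrite (IH _ ks (rcons us l) (k :: vs) ksN ksw ksu).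
rewrite (IH _ ls (rcons us k) (l :: vs) lsN lsw lsu) !cat_rcons.
exact/esym/(fcomm us k l vs).
Qed.

Lemma longestE (i : 'I_n) : longest n i = rev_ord i.
Proof.
have desc k : ~~ ascent (longest n) k.
  apply/negP => a; have := length_ascent a.
  by rewrite /longest; case: arg_maxnP => // w _ /(_ (simple k * w) isT); lia.
pose r := perm (@rev_ord_inj n).
suff : longest n * r = 1.
  by move/permP/(_ i); rewrite !permE /= permE => /(canRL (@rev_ordK n)).
apply: no_descent => k; move: (desc k); rewrite /ascent !permM !permE /=.
have := ltn_ord (longest n (ord_lo k)); have := ltn_ord (longest n (ord_hi k)).
have : longest n (ord_lo k) != longest n (ord_hi k).
  by rewrite (inj_eq perm_inj) -val_eqE /=; lia.
rewrite -val_eqE /=; lia.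
Qed.

End Inversions.

(** * Words exchanging blocks of a list *)

Section Swaps.
Variable A : Type.
Implicit Types (s X Y Z V : seq A) (ks : seq nat).

Definition swap s (k : nat) : seq A :=
  if drop k s is a :: b :: s' then take k s ++ b :: a :: s' else s.

Definition run s ks : seq A := foldl swap s ks.

Lemma swap_cat X V a b k : size X = k ->
  swap (X ++ a :: b :: V) k = X ++ b :: a :: V.
Proof. by move<-; rewrite /swap drop_size_cat // take_size_cat. Qed.

Lemma run_cat s ks ls : run s (ks ++ ls) = run (run s ks) ls.
Proof. exact: foldl_cat. Qed.

Lemma run_left X Y z V P a : size X = P -> size Y = a ->
  run (X ++ Y ++ z :: V) (rev (iota P a)) = X ++ z :: Y ++ V.
Proof.
move=> <- <- {P a}; elim: Y X => //= y Y IH X.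
rewrite rev_cons -cats1 run_cat -cat_rcons -(size_rcons X y) IH cat_rcons.
exact: swap_cat.
Qed.

Lemma run_right X y Z V P b : size X = P -> size Z = b ->
  run (X ++ y :: Z ++ V) (iota P b) = X ++ Z ++ y :: V.
Proof.
move=> <- <- {P b}; elim: Z X => //= z Z IH X.
by rewrite swap_cat // -cat_rcons -(size_rcons X z) IH cat_rcons.
Qed.

End Swaps.

Fixpoint reverse_word (P m : nat) : seq nat :=
  if m is m'.+1 then reverse_word P m' ++ rev (iota P m') else [::].

(** The next two words have the same effect, but blocks_left moves the elements of
    the second block one by one and blocks_right those of the first: the letters
    of one element are consecutive, as needed for the products along chains. *)
Fixpoint blocks_left (P a b : nat) : seq nat :=
  if b is b'.+1 then rev (iota P a) ++ blocks_left P.+1 a b' else [::].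

Fixpoint blocks_right (P a b : nat) : seq nat :=
  if a is a'.+1 then iota (P + a') b ++ blocks_right P a' b else [::].

(** Each run of descending letters moves one more element to position h; with
    h = 0 and a = 0 this is the usual normal form of the longest element. *)
Fixpoint insertion_word (h a m : nat) : seq nat :=
  if m is m'.+1 then rev (iota h a) ++ insertion_word h a.+1 m' else [::].

Lemma size_blocks_left P a b : size (blocks_left P a b) = (a * b)%N.
Proof.
elim: b P => [|b IH] P /=; first by rewrite muln0.
by rewrite size_cat size_rev size_iota IH mulnS.
Qed.

Lemma size_blocks_right P a b : size (blocks_right P a b) = (a * b)%N.
Proof. by elim: a => //= a IH; rewrite size_cat size_iota IH mulSn. Qed.

Lemma size_insertion_word h a m : size (insertion_word h a m) = (size (reverse_word h m) + a * m)%N.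
Proof.
elim: m h a => [|m IH] h a; first by rewrite /= muln0.
have e h' m' : size (reverse_word h' m') = (\sum_(i < m') i)%N.
  elim: m' => [|m' IHm]; first by rewrite big_ord0.
  by rewrite big_ord_recr /= size_cat size_rev size_iota IHm.
rewrite /= !size_cat IH !size_rev !size_iota !e; lia.
Qed.

Section Blocks.
Variable A : Type.
Implicit Types (X Y Z V : seq A).

Lemma run_reverse_word X Z V P m : size X = P -> size Z = m ->
  run (X ++ Z ++ V) (reverse_word P m) = X ++ rev Z ++ V.
Proof.
move=> <- <- {P m}; elim/last_ind: Z V => //= Z z IH V.
by rewrite size_rcons /= run_cat cat_rcons IH run_left ?size_rev // rev_rcons.
Qed.

Lemma run_blocks_left X Y Z V P a b : size X = P -> size Y = a -> size Z = b ->
  run (X ++ Y ++ Z ++ V) (blocks_left P a b) = X ++ Z ++ Y ++ V.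
Proof.
move=> <- <- <- {P a b}; elim: Z X => //= z Z IH X.
by rewrite run_cat run_left // -cat_rcons -(size_rcons X z) IH cat_rcons.
Qed.

Lemma run_blocks_right X Y Z V P a b : size X = P -> size Y = a -> size Z = b ->
  run (X ++ Y ++ Z ++ V) (blocks_right P a b) = X ++ Z ++ Y ++ V.
Proof.
move=> <- <- <- {P a b}; elim/last_ind: Y V => //= Y y IH V.
by rewrite size_rcons /= run_cat cat_rcons catA run_right ?size_cat // -catA IH cat_rcons.
Qed.

Lemma run_insertion_word X Y Z V h a m : size X = h -> size Y = a -> size Z = m ->
  run (X ++ Y ++ Z ++ V) (insertion_word h a m) = X ++ rev Z ++ Y ++ V.
Proof.
move=> <- <- <- {h a m}; elim: Z Y => //= z Z IH Y.
by rewrite run_cat run_left // -cat_cons IH rev_cons cat_rcons.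
Qed.

End Blocks.

(** * One-line notation *)

Section OneLine.
Local Open Scope group_scope.
Variable n : nat.
Implicit Types (w : 'S_n) (L X Y V : seq nat) (ks : seq nat).

Definition oneline w : seq nat := [seq val (w i) | i <- enum 'I_n].

Lemma size_oneline w : size (oneline w) = n.
Proof. by rewrite size_map size_enum_ord. Qed.

Lemma nth_oneline w (i : 'I_n) : nth 0%N (oneline w) i = w i.
Proof. by rewrite (nth_map i) ?size_enum_ord // nth_ord_enum. Qed.

Lemma oneline_inj : injective oneline.
Proof.
move=> w w' e; apply/permP=> i; apply: val_inj.
by rewrite /= -!nth_oneline e.
Qed.

Lemma oneline1 : oneline 1 = iota 0 n.
Proof. by rewrite -val_enum_ord; apply: eq_map => i; rewrite perm1. Qed.

Lemma oneline_perm w : perm_eq (oneline w) (iota 0 n).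
Proof.
have u v : uniq (oneline v).
  by rewrite map_inj_uniq ?enum_uniq // => i j /val_inj/perm_inj.
rewrite -oneline1; apply: uniq_perm => //.
move=> x; apply/mapP/mapP=> -[i _ ->].
  by exists (w i); rewrite ?mem_enum ?perm1.
by exists (w^-1 i); rewrite ?mem_enum ?permKV ?perm1.
Qed.

(** The default value is only taken on lists that are not permutations of
    0, ..., n-1. *)
Definition line_perm L : 'S_n := odflt 1 [pick w | oneline w == L].

Lemma oneline_line_perm L : perm_eq L (iota 0 n) -> oneline (line_perm L) = L.
Proof.
move=> Lp; rewrite /line_perm; case: pickP => [w /eqP //|no].
have sL : size L = n by rewrite (perm_size Lp) size_iota.
have uL : uniq L by rewrite (perm_uniq Lp) iota_uniq.
have lt (i : 'I_n) : (nth 0%N L i < n)%N.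
  by have := mem_nth 0%N (_ : i < size L)%N; rewrite sL (perm_mem Lp) mem_iota; apply.
have inj : injective (fun i : 'I_n => Ordinal (lt i)).
  move=> i j [] /eqP; rewrite nth_uniq ?sL // => /eqP; exact: val_inj.
case/eqP: (no (perm inj)); apply: (@eq_from_nth _ 0%N); first by rewrite size_oneline.
move=> i; rewrite size_oneline => iP.
by rewrite (nth_oneline _ (Ordinal iP)) permE.
Qed.

Lemma line_permK w : line_perm (oneline w) = w.
Proof. by apply: oneline_inj; rewrite oneline_line_perm ?oneline_perm. Qed.

Lemma line_perm_iota : line_perm (iota 0 n) = 1.
Proof. by rewrite -oneline1 line_permK. Qed.

Lemma line_perm_longest : line_perm (rev (iota 0 n)) = longest n.
Proof.
apply: oneline_inj; rewrite oneline_line_perm ?perm_rev //.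
apply: (@eq_from_nth _ 0%N); first by rewrite size_rev size_iota size_oneline.
move=> i; rewrite size_rev size_iota => iP.
rewrite nth_rev ?size_iota // nth_iota ?add0n; last by lia.
by rewrite (nth_oneline _ (Ordinal iP)) longestE.
Qed.

Lemma oneline_simple w (k : 'I_n.-1) : oneline (simple k * w) = swap (oneline w) k.
Proof.
have k1 := ord_hi_subproof k.
have k0 : (k < n)%N by apply: ltnW.
set a := nth 0%N (oneline w) k; set b := nth 0%N (oneline w) k.+1.
have e : oneline w = take k (oneline w) ++ a :: b :: drop k.+2 (oneline w).
  by rewrite -!drop_nth ?size_oneline // cat_take_drop.
rewrite [in RHS]e swap_cat; last by rewrite size_takel // size_oneline ltnW.
apply: (@eq_from_nth _ 0%N).
  by rewrite size_oneline -{1}(size_oneline w) {1}e !size_cat.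
move=> i; rewrite size_oneline => iP; rewrite (nth_oneline _ (Ordinal iP)) permM.
rewrite nth_cat size_takel ?size_oneline ?(ltnW k0) //.
have [ik|ki] := ltnP i k.
  rewrite nth_take // (nth_oneline _ (Ordinal iP)) /simple tpermD // -val_eqE /=; lia.
case: (eqVneq i k) => [ik|nik].
  have -> : Ordinal iP = ord_lo k by exact: val_inj.
  by rewrite simple_lo ik subnn /= /b -[k.+1]/(val (ord_hi k)) nth_oneline.
case: (eqVneq i k.+1) => [ik1|nik1].
  have -> : Ordinal iP = ord_hi k by exact: val_inj.
  by rewrite simple_hi ik1 subSnn /= /a -[val k]/(val (ord_lo k)) nth_oneline.
have -> : (i - k)%N = (i - k.+2).+2 by lia.
rewrite /= nth_drop (_ : (k.+2 + (i - k.+2))%N = i); last by lia.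
rewrite (nth_oneline _ (Ordinal iP)) /simple tpermD // -val_eqE /=; lia.
Qed.

Lemma line_perm_step X a b V : perm_eq (X ++ a :: b :: V) (iota 0 n) ->
  exists2 k : 'I_n.-1, size X = k &
    [/\ line_perm (X ++ a :: b :: V) (ord_lo k) = a :> nat,
        line_perm (X ++ a :: b :: V) (ord_hi k) = b :> nat &
        line_perm (X ++ b :: a :: V) = simple k * line_perm (X ++ a :: b :: V)].
Proof.
set L := _ ++ _ => Lp; have e := oneline_line_perm Lp.
have kP : (size X < n.-1)%N.
  have : size L = n by rewrite -e size_oneline.
  by rewrite size_cat /=; lia.
exists (Ordinal kP) => //; split.
- by rewrite -nth_oneline e nth_cat ltnn subnn.
- by rewrite -nth_oneline e nth_cat ltnNge leqnSn subSnn.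
apply: oneline_inj; rewrite oneline_simple e swap_cat // oneline_line_perm //.
by rewrite -(permPl (_ : perm_eq L _)) // perm_cat2l (perm_catCA [:: a] [:: b]).
Qed.

(** A letter k of such a word stands for the transposition of positions k and
    k+1; letters out of range are dropped, as they do not change a list either. *)
Definition ordw ks : seq 'I_n.-1 := pmap insub ks.
Definition permw ks : 'S_n := word_perm (ordw ks).

Lemma ordw_cat ks ls : ordw (ks ++ ls) = ordw ks ++ ordw ls.
Proof. exact: pmap_cat. Qed.

Lemma ordw_map (ks : seq 'I_n.-1) : ordw (map val ks) = ks.
Proof. by rewrite /ordw map_pK //; apply: valK. Qed.

Lemma size_ordw ks : (size (ordw ks) <= size ks)%N.
Proof. by rewrite size_pmap count_size. Qed.

Lemma ordw1 (k : 'I_n.-1) : ordw [:: val k] = [:: k].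
Proof. exact: (ordw_map [:: k]). Qed.

Lemma oneline_permw ks : oneline (permw ks) = run (iota 0 n) ks.
Proof.
elim/last_ind: ks => [|ks k IH]; first by rewrite /permw word_perm_nil oneline1.
rewrite -cats1 /permw ordw_cat word_perm_cat run_cat -IH /=.
rewrite /ordw /=; case: insubP => [k' _ <-|] /=.
  by rewrite -[[:: k']]/(rcons [::] k') word_perm_rcons word_perm_nil mulg1 oneline_simple.
move=> nk; rewrite word_perm_nil mul1g /swap.
have : (size (drop k (oneline (permw ks))) <= 1)%N.
  by rewrite size_drop size_oneline; lia.
by case: (drop _ _) => [|a [|b s]].
Qed.

Definition reducedw ks := reduced (permw ks) (ordw ks).

(** Every letter exchanges z with a smaller number on its left, which adds an
    inversion. *)
Lemma reducedw_left ks X Y z V : reducedw ks ->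
  run (iota 0 n) ks = X ++ Y ++ z :: V -> all (fun y => y < z)%N Y ->
  reducedw (ks ++ rev (iota (size X) (size Y))).
Proof.
elim: Y X => [|y Y IH] X; first by rewrite cats0.
move=> kr runk /= /andP[yz Yz]; rewrite rev_cons -cats1 catA.
have := IH (rcons X y) kr; rewrite size_rcons cat_rcons => /(_ runk Yz) r.
have := oneline_permw (ks ++ rev (iota (size X).+1 (size Y))).
rewrite run_cat runk cat_cons -cat_rcons run_left ?size_rcons // cat_rcons => e.
set ls := ks ++ _ in r e *; have := oneline_perm (permw ls).
rewrite e => /line_perm_step[k Xk [lo hi _]]; move: lo hi; rewrite -e line_permK => lo hi.
rewrite /reducedw /permw ordw_cat Xk ordw1 cats1 word_perm_rcons reduced_rcons.
by rewrite /ascent lo hi yz.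
Qed.

Lemma size_reducedw ks : reducedw ks -> all (fun k => k < n.-1)%N ks ->
  length (permw ks) = size ks.
Proof.
case/andP=> _ /eqP <- kn; rewrite /ordw size_pmap.
apply/eqP; rewrite -all_count; apply/allP => k /(allP kn) kP.
by rewrite insubT.
Qed.

End OneLine.

(** * The rows of a diagram *)

Section Rows.
Local Open Scope ring_scope.
Variable la : seq (int * int).
Hypothesis hla : cherednik la.
Notation r := (size la).

Definition row_offset (l : nat) : nat := (\sum_(1 <= i < l) row_len la i)%N.

Lemma row_len_gt0 l : (1 <= l <= r)%N -> (0 < row_len la l)%N.
Proof. by case: hla => diag _ /diag; rewrite /row_len; lia. Qed.

Lemma row_lenE l : (1 <= l <= r)%N -> row_b la l = row_a la l + (row_len la l)%:Z - 1.
Proof. by case: hla => diag _ /diag; rewrite /row_len; lia. Qed.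

Notation off := row_offset.

Lemma offS l : (1 <= l)%N -> off l.+1 = (off l + row_len la l)%N.
Proof. by move=> l1; rewrite /row_offset big_nat_recr. Qed.

Lemma off_degree : off r.+1 = degree la.
Proof. by []. Qed.

Lemma off_leq k l : (1 <= k <= l)%N -> (off k <= off l)%N.
Proof. by move=> kl; rewrite /row_offset (@big_cat_nat _ _ _ k 1 l) //=; lia. Qed.

Lemma size_boxes s : size [seq (i, row_a la i + j%:Z) | i <- s, j <- iota 0 (row_len la i)] =
  (\sum_(i <- s) row_len la i)%N.
Proof.
elim: s => [|i s IH]; first by rewrite big_nil.
by rewrite allpairs_cons size_cat size_map size_iota IH big_cons.
Qed.

Lemma boxE l t : (1 <= l <= r)%N -> (t < row_len la l)%N ->
  box la (off l + t) = (l, row_a la l + t%:Z).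
Proof.
move=> lr tl; rewrite /box /boxes.
have -> : iota 1 r = iota 1 l.-1 ++ l :: iota l.+1 (r - l).
  rewrite (_ : r = l.-1 + (1 + (r - l)))%N; last by lia.
  by rewrite !iotaD /= (_ : (1 + l.-1)%N = l) ?addn1 //; [congr (_ ++ _ :: iota _ _)|]; lia.
rewrite allpairs_cat allpairs_cons nth_cat size_boxes.
have -> : (\sum_(i <- iota 1 l.-1) row_len la i)%N = off l by rewrite /row_offset /index_iota subn1.
rewrite ltnNge leq_addr addKn nth_cat size_map size_iota tl.
by rewrite (nth_map 0%N) ?size_iota // nth_iota.
Qed.

Lemma row_ofE l t : (1 <= l <= r)%N -> (t < row_len la l)%N -> row_of la (off l + t) = l.
Proof. by move=> lr tl; rewrite /row_of boxE. Qed.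

Lemma contentE l t : (1 <= l <= r)%N -> (t < row_len la l)%N ->
  content la (off l + t) = row_a la l - l%:Z + t%:Z.
Proof. by move=> lr tl; rewrite /content row_ofE // boxE //=; lia. Qed.

Lemma leftmostE l t : (1 <= l <= r)%N -> (t < row_len la l)%N ->
  leftmost la (off l + t) = (t == 0%N).
Proof. by move=> lr tl; rewrite /leftmost row_ofE // boxE //=; lia. Qed.

Lemma row_splitP k : (k < degree la)%N ->
  exists l t, [/\ (1 <= l <= r)%N, (t < row_len la l)%N & k = (off l + t)%N].
Proof.
rewrite -off_degree; have : (r <= r)%N by [].
elim: {1 3}r => [|s IH] sr; first by rewrite /row_offset big_geq.
rewrite offS // => ks; have [kk|kk] := ltnP k (off s.+1); first by apply: IH => //; lia.
by exists s.+1, (k - off s.+1)%N; split; lia.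
Qed.

(** In terms of contents, the condition on consecutive rows says that the pair
    (end, start) of a row never increases lexicographically, which is transitive. *)
Lemma row_ends k l : (1 <= k < l)%N -> (l <= r)%N ->
  row_b la l - l%:Z < row_b la k - k%:Z \/
  (row_b la l - l%:Z = row_b la k - k%:Z /\ row_a la l - l%:Z <= row_a la k - k%:Z).
Proof.
case: hla => _ che /andP[k1]; elim: l => // l IH; rewrite ltnS leq_eqVlt => kl lr.
case/orP: kl => [/eqP kl|kl].
  by rewrite -kl in lr *; have [|h|[h1 h2]] := che k; [lia|left; lia|right; lia].
have [//|h|[h1 h2]] := IH kl; first exact: ltnW.
- by have [|h'|[h1' h2']] := che l; [lia|left; lia|left; lia].
- by have [|h'|[h1' h2']] := che l; [lia|left; lia|right; lia].
Qed.

Lemma parallel_len i j : (1 <= i <= r)%N -> (1 <= j <= r)%N -> parallel la i j ->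
  row_len la i = row_len la j.
Proof. by move=> /row_lenE bi /row_lenE bj /andP[/eqP a /eqP b]; lia. Qed.

(** By row_ends, the content interval of a row in between is squeezed between two
    equal ones. *)
Lemma parallel_between i k l : (1 <= i <= k)%N -> (k < l <= r)%N ->
  parallel la i l -> parallel la k l.
Proof.
move=> ik kl /andP[/eqP a /eqP b]; have [<-|ne] := eqVneq i k.
  by rewrite /parallel a b !eqxx.
have [|||] := @row_ends i k; [lia|lia| |].
  by move=> h; have [|||[]] := @row_ends k l; lia.
by case=> h1 h2; have [|||[]] := @row_ends k l; rewrite /parallel; lia.
Qed.

End Rows.

Section RowWords.
Local Open Scope ring_scope.
Variable la : seq (int * int).
Notation len := (row_len la).
Notation off := (row_offset la).

Definition same_end (k l : nat) : bool :=
  row_b la k - k%:Z == row_b la l - l%:Z.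

(** The word for row l crossing row k, all rows before row l being reversed.  Which
    of the two rows is moved number by number decides where poles could occur;
    parallel rows contribute a scalar only. *)
Definition cross_word (k l : nat) : seq nat :=
  if parallel la k l then [::]
  else if same_end k l then blocks_right (off l - off k.+1) (len k) (len l)
  else blocks_left (off l - off k.+1) (len k) (len l).

Definition row_word (l : nat) : seq nat :=
  reverse_word (off l) (len l) ++ flatten [seq cross_word k l | k <- iota 1 l.-1].

Definition diagram_word (l : nat) : seq nat := flatten [seq row_word j | j <- iota 1 l].

End RowWords.

(** * The permutation attached to a diagram *)

Section Sprod.
Local Open Scope group_scope.
Variable n : nat.
Implicit Types (us vs : seq 'S_n).

Lemma sprod_cons (u : 'S_n) us : sprod (u :: us) = sprod us * u.
Proof. by rewrite /sprod rev_cons big_rcons. Qed.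

Lemma sprod_nil : sprod ([::] : seq 'S_n) = 1.
Proof. by rewrite /sprod big_nil. Qed.

Lemma sprod_cat us vs : sprod (us ++ vs) = sprod vs * sprod us.
Proof. by rewrite /sprod rev_cat big_cat. Qed.

Lemma sprod_permw (wss : seq (seq nat)) :
  sprod [seq permw n ws | ws <- wss] = permw n (flatten wss).
Proof.
elim: wss => [|ws wss IH] /=; first by rewrite sprod_nil /permw word_perm_nil.
by rewrite sprod_cons IH /permw ordw_cat word_perm_cat.
Qed.

Lemma permw_comm (a b : nat) : (a.+1 < b)%N || (b.+1 < a)%N ->
  commute (permw n [:: a]) (permw n [:: b]).
Proof.
rewrite /permw /ordw /=; case: insubP => [a' _ <-|_]; last first.
  by rewrite word_perm_nil => _; apply/commute_sym/commute1.
case: insubP => [b' _ <-|_]; last first.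
  by rewrite word_perm_nil => _; exact: commute1.
have wp1 (k : 'I_n.-1) : word_perm [:: k] = simple k by rewrite /word_perm /sprod big_seq1.
by rewrite /= !wp1 => /orP[] /simple_comm h; rewrite /commute h.
Qed.

(** By induction: the first factor of s1 can be moved to the front of s2, since
    everything before it in s2 comes after it in s1. *)
Lemma sprod_reorder (I : eqType) (f : I -> 'S_n) (r1 r2 : rel I) (s1 s2 : seq I) :
  uniq s1 -> perm_eq s1 s2 -> pairwise r1 s1 -> pairwise r2 s2 ->
  (forall x y, x \in s1 -> y \in s1 -> x != y -> r1 x y -> r2 y x ->
     commute (f x) (f y)) ->
  sprod (map f s1) = sprod (map f s2).
Proof.
elim: s1 s2 => [|x s1 IH] s2; first by move=> _ /perm_size; case: s2.
move=> /= /andP[xs1 us1] s12 /andP[rx r1s1].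
have xs2 : x \in s2 by rewrite -(perm_mem s12) inE eqxx.
case/splitPr: s2 / xs2 s12 => a b s12.
move=> rab comm; have s12' : perm_eq s1 (a ++ b).
  by rewrite -(perm_cons x) (permPl s12) -cat1s perm_catCA.
have rab' : pairwise r2 (a ++ b).
  by move: rab; rewrite !pairwise_cat /= allrel_consr => /and3P[/andP[_ ->] -> /andP[_ ->]].
rewrite sprod_cons (IH (a ++ b)) //; last first.
  by move=> y z ys zs; apply: comm; rewrite inE ?ys ?zs orbT.
rewrite !map_cat !sprod_cat /= sprod_cons -!mulgA; congr (_ * _).
have {}rab : forall y, y \in a -> r2 y x.
  by move: rab; rewrite pairwise_cat allrel_consr => /and3P[/andP[/allP]].
have {comm} comm y : y \in a -> commute (f x) (f y).
  move=> ya; have ys1 : y \in s1 by rewrite (perm_mem s12') mem_cat ya.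
  apply: comm => //; rewrite ?inE ?eqxx ?ys1 ?orbT //.
  - by apply: contraNneq xs1 => ->.
  - exact: (allP rx).
  - exact: rab.
elim: a {s12 s12' rab rab'} comm => [|y a IHa] comm; first by rewrite sprod_nil mul1g mulg1.
rewrite /= sprod_cons mulgA -IHa => [|z za]; last by apply: comm; rewrite inE za orbT.
by rewrite -!mulgA (comm y) ?inE ?eqxx.
Qed.

End Sprod.

Lemma iota1S k : iota 1 k.+1 = iota 1 k ++ [:: k.+1].
Proof. by rewrite -[X in iota 1 X]addn1 iotaD add1n. Qed.

Section NormalForm.
Local Open Scope group_scope.
Variables (n : nat) (la : seq (int * int)).
Hypothesis hla : cherednik la.
Hypothesis hn : degree la = n.
Notation r := (size la).
Notation len := (row_len la).
Notation off := (row_offset la).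
Notation shift := (shift la).

Definition apart l : nat := (\sum_(1 <= i < l | ~~ parallel la i l) len i)%N.

Lemma off_split l : off l = (apart l + shift l)%N.
Proof.
rewrite /row_offset /apart /shift /row_offset (bigID (fun i => parallel la i l)) /= addnC.
by [].
Qed.

Lemma apart_before k l : (1 <= k < l)%N -> (l <= r)%N -> ~~ parallel la k l ->
  (\sum_(1 <= i < k.+1 | ~~ parallel la i l) len i)%N = off k.+1.
Proof.
move=> kl lr npar; rewrite /row_offset big_nat_cond [RHS]big_nat.
apply: eq_bigl => i; rewrite ltnS; case: (boolP (_ <= _ <= _)%N) => //= ik.
apply: contra npar; apply: parallel_between => //; lia.
Qed.

(** The reversed row l stays in one block while it crosses the other rows.  The
    rows parallel to it are the last ones, hence the block stops behind the first
    shift l elements, where the insertion word puts it directly. *)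
Lemma run_row_word (A : Type) (L : seq A) l : (1 <= l <= r)%N -> size L = n ->
  run L (row_word la l) = run L (insertion_word (shift l) (apart l) (len l)).
Proof.
move=> lr sL; have on : (off l.+1 <= n)%N by rewrite -hn -off_degree; apply: off_leq; lia.
have ol : off l.+1 = (off l + len l)%N by rewrite offS; lia.
have osplit := off_split l.
have [U [Z [V [-> sU sZ]]]] : exists U Z V, [/\ L = U ++ Z ++ V, size U = off l & size Z = len l].
  exists (take (off l) L), (take (len l) (drop (off l) L)), (drop (len l) (drop (off l) L)).
  by rewrite !cat_take_drop !size_takel ?size_drop ?sL //; lia.
rewrite /row_word run_cat run_reverse_word //.
pose e k := (\sum_(1 <= i < k.+1 | ~~ parallel la i l) len i)%N.
have main k : (k < l)%N -> run (U ++ rev Z ++ V) (flatten [seq cross_word la i l | i <- iota 1 k]) =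
    take (off l - e k) U ++ rev Z ++ drop (off l - e k) U ++ V.
  elim: k => [|k IH] kl.
    by rewrite /e big_geq // subn0 -sU take_size drop_size.
  rewrite iota1S map_cat flatten_cat run_cat IH ?(ltnW kl) //= cats0 /cross_word.
  have eS : e k.+1 = (e k + (if parallel la k.+1 l then 0 else len k.+1))%N.
    by rewrite /e big_mkcond big_nat_recr //= -big_mkcond /= if_neg.
  case: ifP => par; first by rewrite eS par addn0.
  have ek1 : e k.+1 = off k.+2 by apply: apart_before; rewrite ?par //; lia.
  have ok : off k.+2 = (off k.+1 + len k.+1)%N by rewrite offS.
  have okl : (off k.+2 <= off l)%N by apply: off_leq; lia.
  have ek : e k = off k.+1 by move: eS; rewrite par; lia.
  rewrite ek1 ek.
  have e1 : take (off l - off k.+1) U =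
      take (off l - off k.+2) U ++ take (len k.+1) (drop (off l - off k.+2) U).
    by rewrite (_ : off l - off k.+1 = off l - off k.+2 + len k.+1)%N ?takeD //; lia.
  have e2 : drop (off l - off k.+2) U =
      take (len k.+1) (drop (off l - off k.+2) U) ++ drop (off l - off k.+1) U.
    rewrite (_ : off l - off k.+1 = len k.+1 + (off l - off k.+2))%N; last by lia.
    by rewrite -drop_drop cat_take_drop.
  rewrite e1 -!catA.
  have s1 : size (take (off l - off k.+2) U) = (off l - off k.+2)%N.
    by rewrite size_takel // sU leq_subr.
  have s2 : size (take (len k.+1) (drop (off l - off k.+2) U)) = len k.+1.
    by rewrite size_takel // size_drop sU; lia.
  have s3 : size (rev Z) = len l by rewrite size_rev.
  rewrite [in RHS]e2 -catA; case: ifP => _.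
    by rewrite run_blocks_right.
  by rewrite run_blocks_left.
have := main l.-1; rewrite {main}/e prednK; last by lia.
rewrite -/(apart l) osplit addKn => -> //.
rewrite -{3}(cat_take_drop (shift l) U) -catA run_insertion_word //.
- by rewrite size_takel // sU osplit leq_addl.
- by rewrite size_drop sU osplit addnK.
Qed.

Lemma size_reverse_word P P' m : size (reverse_word P m) = size (reverse_word P' m).
Proof. by elim: m => //= m IH; rewrite !size_cat IH !size_rev !size_iota. Qed.

Lemma size_row_word l : (1 <= l)%N ->
  size (row_word la l) = size (insertion_word (shift l) (apart l) (len l)).
Proof.
move=> l1; rewrite size_cat size_insertion_word (size_reverse_word (off l) (shift l)); congr (_ + _)%N.
rewrite size_flatten /shape -map_comp sumnE big_map /apart big_distrl /= /index_iota.
rewrite subn1 [RHS]big_mkcond; apply: eq_bigr => k _.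
by rewrite /cross_word; case: ifP => //= _; case: ifP => _; rewrite ?size_blocks_right ?size_blocks_left.
Qed.

Definition normal_word l : seq nat :=
  flatten [seq insertion_word (shift j) (apart j) (len j) | j <- iota 1 l].

Lemma diagram_wordS l : diagram_word la l.+1 = diagram_word la l ++ row_word la l.+1.
Proof. by rewrite /diagram_word iota1S map_cat flatten_cat /= cats0. Qed.

Lemma normal_wordS l :
  normal_word l.+1 = normal_word l ++ insertion_word (shift l.+1) (apart l.+1) (len l.+1).
Proof. by rewrite /normal_word iota1S map_cat flatten_cat /= cats0. Qed.

Lemma run_diagram_word l : (l <= r)%N -> run (iota 0 n) (diagram_word la l) = run (iota 0 n) (normal_word l).
Proof.
elim: l => // l IH lr; rewrite diagram_wordS normal_wordS [LHS]run_cat [RHS]run_cat IH ?(ltnW lr) // run_row_word //.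
by rewrite -oneline_permw size_oneline.
Qed.

Lemma size_diagram_word l : size (diagram_word la l) = size (normal_word l).
Proof. by elim: l => // l IH; rewrite diagram_wordS normal_wordS [LHS]size_cat [RHS]size_cat IH size_row_word. Qed.

Lemma reducedw_insertion_word ks X Y z m V : reducedw n ks ->
  run (iota 0 n) ks = X ++ Y ++ iota z m ++ V -> all (fun y => y < z)%N Y ->
  reducedw n (ks ++ insertion_word (size X) (size Y) m).
Proof.
elim: m ks z Y => [|m IH] ks z Y; first by rewrite cats0.
move=> kr runk Yz /=; rewrite catA; apply: (IH _ z.+1 (z :: Y)).
- exact: reducedw_left runk Yz.
- by rewrite run_cat runk /= run_left.
- by rewrite /= ltnSn /=; apply: sub_all Yz => y; apply: ltnW.
Qed.

Lemma insertion_word_lt h a m : (0 < a + m)%N -> all (fun k => k < h + a + m.-1)%N (insertion_word h a m).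
Proof.
elim: m a => //= m IH a _; rewrite all_cat; apply/andP; split.
  by apply/allP => k; rewrite mem_rev mem_iota; lia.
case: m IH => // m IH; by apply: sub_all (IH a.+1 _) => // k /=; lia.
Qed.

Lemma reduced_normal_word l : (l <= r)%N ->
  [/\ reducedw n (normal_word l), all (fun k => k < n.-1)%N (normal_word l) &
    exists Q, [/\ run (iota 0 n) (normal_word l) = Q ++ iota (off l.+1) (n - off l.+1),
      size Q = off l.+1 & all (fun i => i < off l.+1)%N Q]].
Proof.
elim: l => [|l IH] lr.
  split=> //; first by rewrite /reducedw /permw word_perm_nil reduced_nil.
  by exists [::]; rewrite /row_offset big_geq // subn0.
have [kr kn [Q [runQ sQ Ql]]] := IH (ltnW lr).
have lr1 : (1 <= l.+1 <= r)%N by lia.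
have on : (off l.+2 <= n)%N by rewrite -hn -off_degree; apply: off_leq; lia.
have ol : off l.+2 = (off l.+1 + len l.+1)%N by rewrite offS.
have osplit := off_split l.+1; have len0 := row_len_gt0 hla lr1.
set X := take (shift l.+1) Q; set Y := drop (shift l.+1) Q.
have QE : Q = X ++ Y by rewrite cat_take_drop.
have sX : size X = shift l.+1 by rewrite size_takel // sQ osplit leq_addl.
have sY : size Y = apart l.+1 by rewrite size_drop sQ osplit addnK.
have iE : iota (off l.+1) (n - off l.+1) =
    iota (off l.+1) (len l.+1) ++ iota (off l.+2) (n - off l.+2).
  by rewrite (_ : n - off l.+1 = len l.+1 + (n - off l.+2))%N ?iotaD -?ol //; lia.
have runk : run (iota 0 n) (normal_word l) =
    X ++ Y ++ iota (off l.+1) (len l.+1) ++ iota (off l.+2) (n - off l.+2).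
  by rewrite runQ iE QE -catA.
rewrite normal_wordS; split.
- rewrite -sX -sY; apply: reducedw_insertion_word runk _ => //.
  by move: Ql; rewrite QE all_cat => /andP[].
- rewrite all_cat kn /=; apply: sub_all (insertion_word_lt _ _); last by lia.
  by move=> k; lia.
exists (X ++ rev (iota (off l.+1) (len l.+1)) ++ Y); split.
- by rewrite run_cat runk run_insertion_word ?size_iota // -!catA.
- by rewrite !size_cat size_rev size_iota sX sY; lia.
have : all (fun i => i < off l.+2)%N Q by apply: sub_all Ql => i; lia.
rewrite {1}QE !all_cat => /andP[-> ->]; rewrite andbT /=.
by apply/allP => i; rewrite mem_rev mem_iota; lia.
Qed.

Lemma length_normal_word : length (permw n (normal_word r)) = size (normal_word r).
Proof. by have [kr kn _] := reduced_normal_word (leqnn r); apply: size_reducedw. Qed.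

End NormalForm.

(** * The letters attached to pairs of numbers *)

Section SpecialOrder.
Local Open Scope group_scope.
Variables (n : nat) (la : seq (int * int)).
Hypothesis hla : cherednik la.
Hypothesis hn : degree la = n.
Notation r := (size la).
Notation len := (row_len la).
Notation off := (row_offset la).
Notation shift := (shift la).
Notation row := (row_of la).
Notation apart := (apart la).

Lemma row_mono a b : (a <= b < n)%N -> (row a <= row b)%N.
Proof.
rewrite -hn => /andP[ab bn]; have an := leq_ltn_trans ab bn.
have [i [s [ir si ai]]] := row_splitP an; have [j [t [jr tj bj]]] := row_splitP bn.
rewrite ai bj !row_ofE // leqNgt; apply/negP => ji.
have := @off_leq la j.+1 i; rewrite offS; lia.
Qed.

(** Since the rows parallel to row l and above it come right before it, the
    numbers in all other rows above it are the smallest ones. *)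
Lemma apart_row k l s : (1 <= k < l)%N -> (l <= r)%N -> (s < len k)%N ->
  parallel la k l = ~~ (off k + s < apart l)%N.
Proof.
move=> kl lr sk; have ok : off k.+1 = (off k + len k)%N by rewrite offS //; lia.
have split m (P : pred nat) : (1 <= m <= l)%N ->
    (\sum_(1 <= i < l | P i) len i =
     \sum_(1 <= i < m | P i) len i + \sum_(m <= i < l | P i) len i)%N.
  by move=> ml; rewrite (@big_cat_nat _ _ _ m 1 l) //; lia.
case: (boolP (parallel la k l)) => par; apply/esym.
  rewrite -leqNgt; apply: (@leq_trans (off k)); last exact: leq_addr.
  rewrite /apart (split k); last by lia.
  rewrite [X in (_ + X)%N]big_nat_cond [X in (_ + X)%N]big1 ?addn0 => [|i /andP[ik /negP[]]].
    by rewrite /row_offset [X in (_ <= X)%N](bigID (fun i => parallel la i l)) /= leq_addl.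
  by apply: (parallel_between hla _ _ par); lia.
apply/negbTE; rewrite negbK; apply: (@leq_trans (off k.+1)); first by lia.
rewrite /apart (split k.+1); last by lia.
by rewrite (apart_before hla hn kl lr par) leq_addr.
Qed.

(** Letters count from 0, whereas the index of a simple transposition in t_elt
    counts from 1. *)
Definition pair_word (i j : nat) : seq nat :=
  if row i == row j then [:: (j - i + shift (row i)).-1]
  else if parallel la (row i) (row j) then [::] else [:: (j - i).-1].

Lemma t_eltE (u : 'I_n * 'I_n) : t_elt la u = permw n (pair_word u.1 u.2).
Proof.
have sn m : simple_nat n m = permw n [:: m.-1].
  rewrite /simple_nat /permw /ordw /=; case: insubP => [k _ _|_] /=.
    by rewrite /word_perm /sprod big_seq1.
  by rewrite word_perm_nil.
case: u => i j; rewrite /t_elt /pair_word /=; case: ifP => _; first by rewrite sn.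
by case: ifP => _; rewrite ?sn // /permw word_perm_nil.
Qed.

(** The rows not parallel to row l give the first apart l letters, from
    off l + t - 1 downwards; the shift inside row l is what makes its own letters
    follow these without a gap. *)
Lemma pair_word_column l t : (1 <= l <= r)%N -> (t < len l)%N ->
  flatten [seq pair_word i (off l + t) | i <- iota 0 (off l + t)] =
  rev (iota (shift l) (apart l + t)).
Proof.
move=> lr tl; have osplit := off_split la l; set j := (off l + t)%N.
have letters a m b : (forall s, (s < m)%N -> pair_word (a + s) j = [:: (b + (m - s.+1))%N]) ->
    flatten [seq pair_word i j | i <- iota a m] = rev (iota b m).
  move=> lf; have -> : [seq pair_word i j | i <- iota a m] =
      [seq [:: nth 0%N (rev (iota b m)) (i - a)] | i <- iota a m].
    apply/eq_in_map => i; rewrite mem_iota => /andP[ai im].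
    have sm : (i - a < m)%N by lia.
    by rewrite -{1}(subnKC ai) lf // nth_rev ?size_iota // nth_iota //; lia.
  rewrite flatten_map1; apply: (@eq_from_nth _ 0%N); first by rewrite size_map size_rev !size_iota.
  move=> s; rewrite size_map size_iota => sm.
  by rewrite (nth_map 0%N) ?size_iota // nth_iota // addKn.
have rj : row j = l by apply: row_ofE.
have before i : (i < off l)%N -> exists k s, [/\ (1 <= k < l)%N, (s < len k)%N & i = (off k + s)%N].
  move=> il; have [k [s [kr sk ik]]] : exists k s, [/\ (1 <= k <= r)%N, (s < len k)%N & i = (off k + s)%N].
    apply: row_splitP; rewrite -off_degree.
    by apply: leq_trans il _; apply: off_leq; lia.
  exists k, s; split=> //; have := @off_leq la l k; lia.
have -> : iota 0 j = iota 0 (apart l) ++ iota (apart l) (shift l) ++ iota (off l) t.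
  by rewrite /j osplit !iotaD add0n catA.
have letterE i : (i < off l)%N ->
    pair_word i j = if (i < apart l)%N then [:: (j - i).-1] else [::].
  move=> /before[k [u [kl uk ->]]]; have lr' : (l <= r)%N by lia.
  rewrite /pair_word rj row_ofE //; last by lia.
  rewrite (apart_row kl lr' uk) if_neg; case: eqP => // kle; lia.
rewrite !map_cat !flatten_cat (letters 0%N (apart l) (shift l + t)%N); last first.
  by move=> s sa; rewrite add0n letterE ?sa /j ?osplit; [congr [:: _]|]; lia.
have -> : flatten [seq pair_word i j | i <- iota (apart l) (shift l)] = [::].
  have e i : i \in iota (apart l) (shift l) -> pair_word i j = [::].
    by rewrite mem_iota => /andP[ai il]; rewrite letterE ?ltnNge ?ai //= -ltnNge osplit.
  by elim: iota e => //= i s IH e; rewrite e ?inE ?eqxx // IH // => k ks; apply: e; rewrite inE ks orbT.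
rewrite (letters (off l) t (shift l)) => [|s st].
  by rewrite -rev_cat -iotaD addnC.
rewrite /pair_word row_ofE ?rj ?eqxx //; last by lia.
by congr [:: _]; rewrite /j; lia.
Qed.

Definition column_word (j : nat) : seq nat :=
  rev (iota (shift (row j)) (j - shift (row j))).

Lemma column_wordE j : (j < n)%N -> flatten [seq pair_word i j | i <- iota 0 j] = column_word j.
Proof.
rewrite -hn => /row_splitP[] // l [t [lr tl ->]]; rewrite pair_word_column // /column_word row_ofE //.
by rewrite (off_split la l); congr (rev (iota _ _)); lia.
Qed.

Lemma normal_word_columns l : (l <= r)%N ->
  flatten [seq column_word j | j <- iota 0 (off l.+1)] = normal_word la l.
Proof.
elim: l => [|l IH] lr; first by rewrite /row_offset big_geq.
rewrite normal_wordS offS // iotaD map_cat flatten_cat IH ?(ltnW lr) // add0n; congr (_ ++ _).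
have lr1 : (1 <= l.+1 <= r)%N by lia.
have main m t : (t + m <= len l.+1)%N ->
    flatten [seq column_word j | j <- iota (off l.+1 + t) m] =
    insertion_word (shift l.+1) (apart l.+1 + t) m.
  elim: m t => //= m IHm t tm; rewrite -!addnS IHm; last by lia.
  congr (_ ++ _); rewrite /column_word row_ofE //; last by lia.
  by rewrite off_split; congr (rev (iota _ _)); lia.
by have := main (len l.+1) 0%N; rewrite !addn0; apply.
Qed.

Lemma normal_word_all : flatten [seq column_word j | j <- iota 0 n] = normal_word la r.
Proof. by rewrite -normal_word_columns // off_degree hn. Qed.

(** * The special order *)

Definition columns : seq ('I_n * 'I_n) :=
  [seq (i, j) | j : 'I_n <- enum 'I_n, i : 'I_n <- [seq i : 'I_n <- enum 'I_n | (i < j)%N]].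

Lemma mem_columns u : (u \in columns) = (u.1 < u.2)%N.
Proof.
apply/allpairsPdep/idP => [[j [i [_ ij ->]]]|]; first by rewrite mem_filter in ij; case/andP: ij.
case: u => i j ij; exists j, i; split=> //; first by rewrite mem_enum. 
by rewrite mem_filter mem_enum andbT.
Qed.

Lemma uniq_columns : uniq columns.
Proof.
apply: allpairs_uniq_dep; first exact: enum_uniq.
  by move=> j _; apply/filter_uniq/enum_uniq.
by move=> [j i] [j' i'] _ _ /= [-> ->].
Qed.

Lemma perm_columns : perm_eq (pairs n) columns.
Proof.
apply: uniq_perm; [exact/filter_uniq/enum_uniq|exact: uniq_columns|].
by move=> u; rewrite mem_columns mem_filter mem_enum andbT.
Qed.

Lemma pairwise_enum_ord : pairwise (fun i j : 'I_n => (i < j)%N) (enum 'I_n).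
Proof.
have := iota_ltn_sorted 0 n; rewrite sorted_pairwise ?(@ltn_trans) //.
  by rewrite -val_enum_ord pairwise_map.
by move=> ? ? ?; apply: ltn_trans.
Qed.

Lemma pairwise_columns : pairwise (@lt2 n) columns.
Proof.
have main (js : seq 'I_n) : pairwise (fun i j : 'I_n => (i < j)%N) js ->
    pairwise (@lt2 n) [seq (i, j) | j : 'I_n <- js,
                                    i : 'I_n <- [seq i : 'I_n <- enum 'I_n | (i < j)%N]].
  elim: js => // j js IH /andP[/allP jjs /IH pjs].
  rewrite allpairs_cons pairwise_cat pjs andbT; apply/andP; split.
    apply/allrelP => u v /mapP[i _ ->] /allpairsPdep[j' [i' [j'js _ ->]]].
    by rewrite /lt2 /= jjs.
  rewrite pairwise_map; apply: sub_pairwise (pairwise_filter _ pairwise_enum_ord) => i i' ii'.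
  by rewrite /relpre /= /lt2 /= eqxx ii' orbT.
exact/main/pairwise_enum_ord.
Qed.

Lemma special_lt_trans : transitive (@special_lt n la).
Proof.
move=> [i' j'] [i j] [i'' j'']; rewrite /special_lt /lt1 /lt2 /= -!val_eqE /=.
move: (row i) (row j) (row i') (row j') (row i'') (row j'') => k l k' l' k'' l''.
case: (boolP ((k == k') && (l == l'))) => [/andP[/eqP <- /eqP <-]|n1].
  case: (boolP ((k == k'') && (l == l''))) => [_|n2] //.
  by case: ifP => _; lia.
case: (boolP ((k' == k'') && (l' == l''))) => [/andP[/eqP <- /eqP <-]|n2].
  by rewrite (negbTE n1) => ->.
case: (boolP ((k == k'') && (l == l''))) => [/andP[/eqP e1 /eqP e2]|n3]; last by lia.
by subst; lia.
Qed.

Lemma special_trans : transitive (@special_le n la).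
Proof.
move=> v u w; rewrite /special_le => /orP[/eqP->//|uv] /orP[/eqP<-|vw].
  by rewrite uv orbT.
by rewrite (special_lt_trans uv vw) orbT.
Qed.

Lemma special_total : total (@special_le n la).
Proof.
move=> [i j] [i' j']; rewrite /special_le /special_lt /lt1 /lt2 /= !xpair_eqE -!val_eqE /=.
move: (row i) (row j) (row i') (row j') => k l k' l'.
case: (boolP ((k == k') && (l == l'))) => [/andP[/eqP <- /eqP <-]|n1].
  by rewrite !eqxx /=; case: ifP => _; lia.
by rewrite [k' == k]eq_sym [l' == l]eq_sym (negbTE n1); lia.
Qed.

Lemma pairwise_special : pairwise (@special_le n la) (sort (@special_le n la) (pairs n)).
Proof.
rewrite -sorted_pairwise; first exact/sort_sorted/special_total.
exact: special_trans.
Qed.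

(** If the two orders disagree on pairs u = (k, l) and v = (i, j), then j and l
    belong to the same row and k < i, j < l, so that the letters differ by at least
    2.  The exceptional case is i in the row of l but k in another row: then the
    letter of v is raised by the shift, but k belongs to one of the rows
    that are not parallel, below all the numbers counted by the shift. *)
Lemma pair_word_comm (u v : 'I_n * 'I_n) : (u.1 < u.2)%N -> (v.1 < v.2)%N ->
  special_lt la u v -> lt2 v u ->
  commute (permw n (pair_word u.1 u.2)) (permw n (pair_word v.1 v.2)).
Proof.
case: u v => [k l] [i j] /= kl ij; rewrite /special_lt /lt2 /=.
have mono (a b : 'I_n) : (a <= b)%N -> (row a <= row b)%N.
  by move=> ab; apply: row_mono; rewrite ab ltn_ord.
have degn (a : 'I_n) : (a < degree la)%N by rewrite hn.
move=> sp lt.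
have jl : (j < l)%N.
  case/orP: lt => // /andP[/eqP jl ik]; have := mono _ _ (ltnW ik); move: sp.
  rewrite jl eqxx andbT /lt1 /lt2 /= -!val_eqE /=; case: eqP => [_|]; last by lia.
  by case: ifP => _; lia.
have rjl := mono _ _ (ltnW jl).
have e : row j = row l by move: sp; case: ifP => [/andP[_ /eqP->] //|_]; lia.
have ki : (k < i)%N.
  rewrite ltnNge; apply/negP => ik; have := mono _ _ ik; move: sp.
  rewrite e eqxx andbT /lt1 /lt2 /= -!val_eqE /=; case: eqP => [_|]; last by lia.
  by case: ifP => _; lia.
have com1 w : commute (permw n w) (permw n [::]).
  by rewrite /permw word_perm_nil; exact: commute1.
have far a b : (a.+1 < b)%N || (b.+1 < a)%N -> commute (permw n [:: a]) (permw n [:: b]).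
  exact: permw_comm.
have rki := mono _ _ (ltnW ki); have rij := mono _ _ (ltnW ij).
rewrite /pair_word e; case: (eqVneq (row i) (row l)) => [il|nil]; last first.
  have -> : row k == row l = false by apply/eqP; lia.
  case: ifP => _; first exact/commute_sym/com1.
  by case: ifP => _; [exact: com1|apply: far; lia].
case: (eqVneq (row k) (row l)) => [kl'|nkl]; first by rewrite il kl'; apply: far; lia.
case: ifP => par; first exact/commute_sym/com1.
apply: far; rewrite il.
have [L [tl [Lr tlL lE]]] := row_splitP (degn l).
have [J [tj [Jr tjL jE]]] := row_splitP (degn j).
have [I [ti [Ir tiL iE]]] := row_splitP (degn i).
have [M [tk [Mr tkM kE]]] := row_splitP (degn k).
have rl : row l = L by rewrite lE row_ofE.
have rj : row j = J by rewrite jE row_ofE.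
have ri : row i = I by rewrite iE row_ofE.
have rk : row k = M by rewrite kE row_ofE.
have osplit := off_split la L.
have kap : (k < apart L)%N.
  have ML : (1 <= M < L)%N by lia.
  have Lr' : (L <= r)%N by case/andP: Lr.
  by move: par; rewrite rk rl (apart_row ML Lr' tkM) -kE => /negbFE.
have JL : J = L by rewrite -rj e.
have IL : I = L by rewrite -ri il.
by rewrite rl; rewrite JL in jE; rewrite IL in iE; lia.
Qed.

Lemma letters_columns :
  flatten [seq pair_word (val u.1) (val u.2) | u : 'I_n * 'I_n <- columns] = normal_word la r.
Proof.
rewrite -normal_word_all -val_enum_ord -map_comp /columns.
have main (js : seq 'I_n) :
  flatten [seq pair_word (val u.1) (val u.2) | u : 'I_n * 'I_n <-
    [seq (i, j) | j : 'I_n <- js, i : 'I_n <- [seq i : 'I_n <- enum 'I_n | (i < j)%N]]] =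
  flatten [seq column_word (val j) | j <- js].
  elim: js => // j js IH; rewrite allpairs_cons map_cat flatten_cat IH -map_comp /=.
  congr (_ ++ _); rewrite -column_wordE // -[in RHS](@filter_iota_ltn 0 n) ?(ltnW (ltn_ord j)) //.
  rewrite -val_enum_ord filter_map -map_comp; congr (flatten (map _ _)).
exact: main.
Qed.

Lemma w_eltE : w_elt n la = permw n (normal_word la r).
Proof.
rewrite /w_elt (_ : [seq t_elt la u | u <- _] =
  [seq (fun u : 'I_n * 'I_n => permw n (pair_word u.1 u.2)) u | u <- sort (special_le la) (pairs n)]); last first.
  by apply: eq_map => u; rewrite t_eltE.
rewrite (sprod_reorder (s2 := columns) _ _ pairwise_special pairwise_columns).
- by rewrite -letters_columns -sprod_permw -map_comp.
- by rewrite sort_uniq; apply/filter_uniq/enum_uniq.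
- by rewrite perm_sort; exact: perm_columns.
move=> u v; rewrite !mem_sort !mem_filter => /andP[uu _] /andP[vv _] uv.
rewrite /special_le (negbTE uv) /= => sp lt; exact: pair_word_comm.
Qed.

End SpecialOrder.

Local Open Scope ring_scope.

(** * Words in Hecke generators *)

Section Angle.
Variables (K : fieldType) (q : K).

Lemma angle_YB (u v w : K) : u != 0 -> v != 0 -> u != v -> v != w -> u != w ->
  angle q (w / u) * (angle q (v / u) + angle q (w / v) + q - 1) =
  angle q (v / u) * angle q (w / v).
Proof.
move=> u0 v0 uv vw uw; rewrite /angle; field.
by rewrite ?subr_eq0 uv vw uw u0 v0.
Qed.

(** This relation between the coefficients of neighbouring factors of a chain
    removes the pole of the first of them. *)
Lemma angle_shift (r : K) : q != 0 -> r != 1 -> r != q ->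
  angle q r * (q + angle q (r / q)) = angle q (r / q).
Proof.
move=> q0 r1 rq; rewrite /angle; field.
by rewrite ?subr_eq0 q0 ![_ == r]eq_sym r1 rq.
Qed.

Lemma angle_q : q != 1 -> angle q q = 1.
Proof. by move=> q1; rewrite /angle divff // subr_eq0 eq_sym. Qed.

End Angle.

Section Hecke.
Variables (K : fieldType) (q : K) (n : nat) (H : algType K) (T : 'I_n.-1 -> H).

Definition hecke_gens : Prop :=
  [/\ forall k l : 'I_n.-1, l = k.+1 :> nat -> T k * T l * T k = T l * T k * T l,
      forall k l : 'I_n.-1, (k.+1 < l)%N -> T k * T l = T l * T k
    & forall k : 'I_n.-1, T k * T k = (q - 1) *: T k + q%:A].

Hypothesis TH : hecke_gens.
Notation point := ('I_n -> K).
Implicit Types (x : point) (ks ls g : seq nat) (Y h : H).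

Definition Tnat ks : H := Tword T (ordw n ks).

Lemma Tword_cat (ks ls : seq 'I_n.-1) : Tword T (ks ++ ls) = Tword T ks * Tword T ls.
Proof. exact: big_cat. Qed.

Lemma Tnat_cat ks ls : Tnat (ks ++ ls) = Tnat ks * Tnat ls.
Proof. by rewrite /Tnat ordw_cat Tword_cat. Qed.

Lemma Tnat_nil : Tnat [::] = 1.
Proof. exact: big_nil. Qed.

Lemma Tnat_ord (k : 'I_n.-1) : Tnat [:: val k] = T k.
Proof. by rewrite /Tnat ordw1 /Tword big_seq1. Qed.

Lemma Tnat_comm (k l : nat) : (k.+1 < l)%N || (l.+1 < k)%N ->
  Tnat [:: k] * Tnat [:: l] = Tnat [:: l] * Tnat [:: k].
Proof.
case: TH => _ comm _; rewrite /Tnat /ordw /Tword /=.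
case: insubP => [k' _ <-|_]; case: insubP => [l' _ <-|_] /=;
  rewrite ?big_nil ?big_seq1 ?mulr1 ?mul1r //.
by case/orP => /comm ->.
Qed.

Lemma Tnat_comm_word (k : nat) g : all (fun i => (i.+1 < k)%N || (k.+1 < i)%N) g ->
  Tnat g * Tnat [:: k] = Tnat [:: k] * Tnat g.
Proof.
elim: g => [|i g IH] /=; first by rewrite Tnat_nil mulr1 mul1r.
case/andP=> ik /IH gk; rewrite -cat1s Tnat_cat -mulrA gk mulrA.
by rewrite (Tnat_comm ik) mulrA.
Qed.

Lemma Tword_reduced (w : 'S_n) (ks : seq 'I_n.-1) : reduced w ks -> Tword T ks = Tw T w.
Proof.
case: TH => braid comm _ ksw.
have := reduced_word_ind (f := Tword T); apply; last exact: (xchooseP (reduced_exists w)).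
- move=> us k l vs lk; rewrite !Tword_cat; congr (_ * (_ * _)).
  by rewrite /Tword !big_cons big_nil !mulr1 !mulrA braid.
- move=> us k l vs kl; rewrite !Tword_cat; congr (_ * (_ * _)).
  by rewrite /Tword !big_cons big_nil !mulr1 comm.
- exact: ksw.
Qed.

Lemma Tw_ascent (w : 'S_n) k : ascent w k -> Tw T (simple k * w)%g = Tw T w * T k.
Proof.
move=> wk; have [ks ksw] := reduced_exists w.
rewrite -(Tword_reduced ksw).
rewrite -(@Tword_reduced _ (rcons ks k)); last by rewrite reduced_rcons wk.
by rewrite -cats1 Tword_cat /Tword big_seq1.
Qed.

(** * The length filtration *)

Definition below N h : Prop :=
  exists a : 'S_n -> K, h = \sum_(w | (length w < N)%N) a w *: Tw T w.

Lemma below0 N : below N 0.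
Proof. by exists (fun=> 0); rewrite big1 // => w _; rewrite scale0r. Qed.

Lemma belowD N h h' : below N h -> below N h' -> below N (h + h').
Proof.
case=> a -> [b ->]; exists (fun w => a w + b w).
by rewrite -big_split; apply: eq_bigr => w _; rewrite scalerDl.
Qed.

Lemma belowZ N c h : below N h -> below N (c *: h).
Proof.
case=> a ->; exists (fun w => c * a w); rewrite scaler_sumr.
by apply: eq_bigr => w _; rewrite scalerA.
Qed.

Lemma below_sum N (I : Type) (r : seq I) (P : pred I) (F : I -> H) :
  (forall i, P i -> below N (F i)) -> below N (\sum_(i <- r | P i) F i).
Proof.
by move=> FP; elim/big_ind: _ => // [|h h']; [exact: below0|exact: belowD].
Qed.

Lemma below_Tw N w : (length w < N)%N -> below N (Tw T w).
Proof.
move=> wN; exists (fun v => (v == w)%:R); rewrite (bigD1 w) //= eqxx scale1r big1 ?addr0 //.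
by move=> v /andP[_ /negbTE->]; rewrite scale0r.
Qed.

Lemma below_leq M N h : (M <= N)%N -> below M h -> below N h.
Proof.
move=> MN [a ->]; apply: below_sum => w wM; apply: belowZ; apply: below_Tw.
exact: leq_trans wM MN.
Qed.

(** Multiplication by T_k takes T_w to the element of length one more, or to a
    combination of T_w and a shorter one. *)
Lemma below_gen N h k : below N h -> below N.+1 (h * T k).
Proof.
case: TH => _ _ quad [a ->]; rewrite mulr_suml; apply: below_sum => w wN.
rewrite -scalerAl; apply: belowZ; case: (boolP (ascent w k)) => [wk|wk].
  by rewrite -Tw_ascent //; apply: below_Tw; rewrite length_ascent.
have wk' : ascent (simple k * w)%g k by rewrite ascent_simple.
have <- : Tw T (simple k * w)%g * T k = Tw T w.
  by rewrite -Tw_ascent // simple_mulK.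
rewrite -mulrA quad mulrDr -scalerAr mulr_algr -Tw_ascent // simple_mulK.
by apply: belowD; apply: belowZ; apply: below_Tw; move: (length_descent wk); lia.
Qed.

Lemma below_Tnat N h ks : below N h -> below (N + size ks) (h * Tnat ks).
Proof.
elim: ks N h => [|k ks IH] N h hN; first by rewrite Tnat_nil mulr1 addn0.
rewrite -cat1s Tnat_cat mulrA /= addnS -addSn; apply: IH.
rewrite /Tnat /Tword /ordw /=; case: insubP => [k' _ _|_] /=.
  by rewrite big_seq1; apply: below_gen.
by rewrite big_nil mulr1; apply: below_leq hN.
Qed.

Lemma below1 : below 1 1.
Proof.
have -> : (1 : H) = Tw T (1%g : 'S_n).
  by rewrite -(Tword_reduced (reduced_nil n)) /Tword big_nil.
by apply: below_Tw; rewrite length1.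
Qed.

Lemma below_word ks : below (size ks).+1 (Tnat ks).
Proof. by rewrite -[Tnat ks]mul1r -add1n; apply/below_Tnat/below1. Qed.

Definition lead c ks h : Prop := below (size ks) (h - c *: Tnat ks).

Lemma lead_below c ks h : lead c ks h -> below (size ks).+1 h.
Proof.
rewrite /lead => l; rewrite -[h](subrK (c *: Tnat ks)); apply: belowD.
  exact: below_leq l.
exact/belowZ/below_word.
Qed.

(** * Products along a chain of letters *)

(** What a product of factors T_k + <x>, k running over g, becomes next to an
    element on which all letters of g but the first act by q: by chain_rcons,
    only the last coefficient c survives. *)
Definition chain g c : H := Tnat g + c *: \sum_(t < size g) Tnat (take t g).

Lemma lead_chain c ks h g d : lead c ks h -> lead c (ks ++ g) (h * chain g d).
Proof.
move=> hl; rewrite /lead Tnat_cat size_cat /chain mulrDr.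
have -> : h * Tnat g + h * (d *: \sum_(t < size g) Tnat (take t g)) -
    c *: (Tnat ks * Tnat g) = (h - c *: Tnat ks) * Tnat g +
    d *: \sum_(t < size g) h * Tnat (take t g).
  by rewrite addrAC mulrBl -scalerAl -scalerAr mulr_sumr.
apply: belowD; first exact: below_Tnat.
apply/belowZ/below_sum => t _; apply: (@below_leq ((size ks).+1 + size (take t g))).
  by rewrite size_take ltn_ord addSnnS leq_add2l.
exact/below_Tnat/(lead_below hl).
Qed.

Lemma chain1 k c : chain [:: k] c = Tnat [:: k] + c%:A.
Proof. by rewrite /chain big_ord1 take0 Tnat_nil. Qed.

(** All proper prefixes of g commute with T_k, so that T_k acts on their sum by q;
    the condition on c and c', satisfied by neighbouring factors by angle_shift,
    then replaces the coefficient c by c'. *)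
Lemma chain_rcons Y g k c c' : Y * Tnat [:: k] = q *: Y ->
  all (fun i => (i.+1 < k)%N || (k.+1 < i)%N) (take (size g).-1 g) ->
  c * (q + c') = c' ->
  Y * chain g c * (Tnat [:: k] + c'%:A) = Y * chain (rcons g k) c'.
Proof.
move=> Yk gk cc'; rewrite /chain size_rcons big_ord_recr /=.
have -> : \sum_(t < size g) Tnat (take t (rcons g k)) =
          \sum_(t < size g) Tnat (take t g).
  by apply: eq_bigr => t _; rewrite -cats1 takel_cat // ltnW.
rewrite -cats1 take_size_cat // Tnat_cat.
set S := \sum_(t < size g) _; set W := Tnat g; set k' := Tnat [:: k].
have Sk : Y * S * k' = q *: (Y * S).
  rewrite /S mulr_sumr mulr_suml scaler_sumr; apply: eq_bigr => t _.
  rewrite -mulrA Tnat_comm_word; first by rewrite mulrA Yk -scalerAl.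
  apply/allP => i; rewrite -(@take_takel _ t (size g).-1) => [/mem_take|]; first exact: (allP gk).
  by have := ltn_ord t; lia.
rewrite !mulrDr !mulrDl -!scalerAr -!scalerAl Sk ?mulr1 !mulrA !scalerA.
rewrite -!addrA; congr (_ + _).
rewrite addrCA -scalerDl mulrDr scalerDr addrC.
by congr (_ *: _ + _); rewrite -[RHS]cc'; ring.
Qed.

(** * The Yang-Baxter equation *)

Fixpoint phi_rec (ks : seq 'I_n.-1) x : H :=
  if ks is k :: ks' then phi q T k x * phi_rec ks' (fun i => x (simple k i)) else 1.

Lemma word_perm_cons k (ks : seq 'I_n.-1) :
  word_perm (k :: ks) = (word_perm ks * simple k)%g.
Proof. by rewrite -cat1s word_perm_cat /word_perm /sprod big_seq1. Qed.

Lemma phi_wordE (ks : seq 'I_n.-1) x : phi_word q T ks x = phi_rec ks x.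
Proof.
rewrite /phi_word; elim: ks x => [|k ks IH] x; first by rewrite big_ord0.
rewrite big_ord_recl /= -IH; congr (_ * _).
  by rewrite /Defs.act /= word_perm_nil /phi /= !perm1.
apply: eq_bigr => j _; rewrite /Defs.act /= add0n word_perm_cons.
rewrite (tnth_nth k) /= -(tnth_nth k (in_tuple ks)) /phi.
by rewrite !permM.
Qed.

Lemma phi_rec_cat (ks ls : seq 'I_n.-1) x :
  phi_rec (ks ++ ls) x = phi_rec ks x * phi_rec ls (fun i => x (word_perm ks i)).
Proof.
elim: ks x => [|k ks IH] x /=.
  by rewrite mul1r word_perm_nil; congr phi_rec; apply: boolp.funext => i; rewrite perm1.
rewrite IH mulrA; congr (_ * phi_rec _ _); apply: boolp.funext => i.
by rewrite word_perm_cons permM.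
Qed.

Lemma factor3 (a b c : H) (A B C : K) :
  (a + A%:A) * ((b + B%:A) * (c + C%:A)) =
  a * b * c + C *: (a * b) + (B *: (a * c) + (B * C) *: a) +
  (A *: (b * c) + (A * C) *: b + ((A * B) *: c + (A * B * C)%:A)).
Proof.
rewrite !(mulrDl, mulrDr) -!(scalerAl, scalerAr) ?(mul1r, mulr1) !scalerA !mulrA.
by [].
Qed.

(** Up to the braid and quadratic relations the two sides differ by a multiple of
    a - b, whose coefficient vanishes by the condition on A, B and C; angle_YB
    provides this condition. *)
Lemma yang_baxter (a b : H) (A B C : K) : a * b * a = b * a * b ->
  a * a = (q - 1) *: a + q%:A -> b * b = (q - 1) *: b + q%:A ->
  B * (A + C + q - 1) = A * C ->
  (a + A%:A) * ((b + B%:A) * (a + C%:A)) = (b + C%:A) * ((a + B%:A) * (b + A%:A)).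
Proof.
move=> braid aa bb eABC; rewrite !factor3 braid aa bb.
have e1 : B * (q - 1) + B * C + A * B = A * C by rewrite -eABC; ring.
have e2 : B * (q - 1) + B * A + C * B = A * C by rewrite -eABC; ring.
rewrite !scalerDr !scalerA !addrA.
rewrite [LHS](ACl (1 * 2 * 6 * (3 * 5 * 8) * 7 * (4 * 9))) /= -!scalerDl e1.
rewrite [RHS](ACl (1 * 6 * 2 * 7 * (3 * 5 * 8) * (4 * 9))) /= -!scalerDl e2.
have -> : C * B * A = A * B * C by ring.
by rewrite [C * A]mulrC.
Qed.

Lemma phi_rec_reduced x (w : 'S_n) (ks ls : seq 'I_n.-1) : generic x ->
  reduced w ks -> reduced w ls -> phi_rec ks x = phi_rec ls x.
Proof.
case=> xinj x0; refine (@reduced_word_ind n H (phi_rec^~ x) _ _ w ks ls) => us k l vs kl.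
  have e : word_perm [:: k; l; k] = word_perm [:: l; k; l].
    by rewrite !word_perm_cons word_perm_nil !mul1g -!mulgA (simple_braid kl).
  rewrite !phi_rec_cat e; congr (_ * (_ * _)).
  pose y i := x (word_perm us i); rewrite -/y.
  have yinj : injective y by move=> i j /xinj/perm_inj.
  rewrite /= !mulr1 /phi.
  have hilo : ord_hi k = ord_lo l by apply: val_inj; rewrite /= kl.
  have k_hi : simple k (ord_hi l) = ord_hi l.
    by apply: simple_fix; rewrite -val_eqE /=; lia.
  have l_lo : simple l (ord_lo k) = ord_lo k.
    by apply: simple_fix; rewrite -val_eqE /=; lia.
  have k_lo : simple k (ord_lo k) = ord_lo l by rewrite simple_lo.
  have k_mid : simple k (ord_lo l) = ord_lo k by rewrite -hilo simple_hi.
  rewrite hilo !(k_lo, k_mid, k_hi, l_lo, simple_lo l, simple_hi l).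
  case: TH => braid _ quad.
  apply: yang_baxter (braid _ _ kl) (quad _) (quad _) _.
  by apply: angle_YB; rewrite ?x0 // (inj_eq yinj) -val_eqE /= kl; lia.
have e : word_perm [:: k; l] = word_perm [:: l; k].
  by rewrite !word_perm_cons word_perm_nil !mul1g (simple_comm kl).
rewrite !phi_rec_cat e; congr (_ * (_ * _)).
rewrite /= !mulr1 /phi.
have k_lo : simple k (ord_lo l) = ord_lo l by apply: simple_fix; rewrite -val_eqE /=; lia.
have k_hi : simple k (ord_hi l) = ord_hi l by apply: simple_fix; rewrite -val_eqE /=; lia.
have l_lo : simple l (ord_lo k) = ord_lo k by apply: simple_fix; rewrite -val_eqE /=; lia.
have l_hi : simple l (ord_hi k) = ord_hi k by apply: simple_fix; rewrite -val_eqE /=; lia.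
rewrite !(k_lo, k_hi, l_lo, l_hi).
case: TH => _ comm _; have kl' := comm _ _ kl.
set A := angle _ _; set B := angle _ _.
rewrite !(mulrDl, mulrDr) -!(scalerAl, scalerAr) ?(mul1r, mulr1) kl' !scalerA.
by rewrite !addrA [RHS](ACl (1 * 3 * 2 * 4)) /= [B * A]mulrC.
Qed.

(** * Intertwining products and one-line notation *)

Definition xcoord x (i : nat) : K := oapp x 0 (insub i).

Lemma xcoord_ord x (i : 'I_n) : xcoord x i = x i.
Proof. by rewrite /xcoord valK. Qed.

Definition phi_line (L : seq nat) x : H := phi_word q T (reduced_word (line_perm n L)) x.

Lemma phi_line_iota x : phi_line (iota 0 n) x = 1.
Proof.
rewrite /phi_line line_perm_iota phi_wordE.
have /andP[_] : reduced 1%g (reduced_word (1%g : 'S_n)) := xchooseP (reduced_exists _).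
by rewrite length1; case: reduced_word.
Qed.

Lemma phi_line_longest x : phi_line (rev (iota 0 n)) x = phi0 q T x.
Proof. by rewrite /phi_line line_perm_longest. Qed.

Lemma phi_line_step X a b V x : generic x -> perm_eq (X ++ a :: b :: V) (iota 0 n) ->
  (a < b)%N ->
  phi_line (X ++ b :: a :: V) x =
  phi_line (X ++ a :: b :: V) x *
    (Tnat [:: size X] + (angle q (xcoord x b / xcoord x a))%:A).
Proof.
move=> gx Lp ab; have [k Xk [lo hi e]] := line_perm_step Lp.
rewrite /phi_line e; set w := line_perm n _ in lo hi *.
have wk : ascent w k by rewrite /ascent lo hi.
have r w' : reduced w' (reduced_word w') := xchooseP (reduced_exists (w' : 'S_n)).
rewrite !phi_wordE (phi_rec_reduced (ls := rcons (reduced_word w) k) gx (r _)); last first.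
  by rewrite reduced_rcons wk r.
rewrite -cats1 phi_rec_cat /= mulr1 /phi Xk Tnat_ord.
have /andP[/eqP -> _] := r w.
by rewrite -lo -hi !xcoord_ord.
Qed.

(** As b and a are in reversed order, the product ends in a factor exchanging
    them, and this factor is T + <q> = T + 1, which absorbs T with eigenvalue q. *)
Lemma phi_line_absorb X a b V x : generic x -> perm_eq (X ++ b :: a :: V) (iota 0 n) ->
  (a < b)%N -> q != 1 -> xcoord x b = q * xcoord x a ->
  phi_line (X ++ b :: a :: V) x * Tnat [:: size X] = q *: phi_line (X ++ b :: a :: V) x.
Proof.
move=> gx Lp ab q1 xab.
have Lp' : perm_eq (X ++ a :: b :: V) (iota 0 n).
  by rewrite -(permPr Lp) perm_cat2l (perm_catCA [:: a] [:: b]).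
rewrite phi_line_step // xab; have [k -> [lo _ _]] := line_perm_step Lp'.
have xa : xcoord x a != 0 by case: gx => _ x0; rewrite -lo xcoord_ord.
rewrite mulfK // angle_q // scale1r Tnat_ord.
case: TH => _ _ quad; rewrite -mulrA scalerAr; congr (_ * _).
rewrite mulrDl mul1r quad scalerDr.
by rewrite -[X in _ + X = _]scale1r addrAC -scalerDl subrK.
Qed.

End Hecke.

(** * The factor contributed by two parallel rows *)

Section QNumbers.
Variables (K : fieldType) (q : K).

Definition qint k : K := \sum_(e < k) q ^+ e.
Definition qfact k : K := \prod_(e < k) qint e.+1.

Lemma qintE k : (q - 1) * qint k = q ^+ k - 1.
Proof. by rewrite subrX1. Qed.

Lemma qint_neq0 k : (forall k, (0 < k)%N -> q ^+ k != 1) -> (0 < k)%N -> qint k != 0.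
Proof.
move=> hq k0; have := hq _ k0; rewrite -subr_eq0 -qintE mulf_eq0 negb_or.
by case/andP.
Qed.

Lemma qfact_neq0 k : (forall k, (0 < k)%N -> q ^+ k != 1) -> qfact k != 0.
Proof. by move=> hq; apply/prodf_neq0 => e _; apply: qint_neq0. Qed.

Lemma qfactS k : qfact k.+1 = qfact k * qint k.+1.
Proof. exact: big_ord_recr. Qed.

End QNumbers.

Section Residue.
Variables (K : fieldType) (q : K) (n : nat) (H : algType K) (T : 'I_n.-1 -> H).
Hypothesis TH : hecke_gens q T.
Hypothesis q0 : q != 0.
Hypothesis qk : forall k, (0 < k)%N -> q ^+ k != 1.
Notation Tn := (Tnat T).
Implicit Types (Y : H) (a b c m : nat).

Lemma Tnat_braid b : (b.+1 < n.-1)%N ->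
  Tn [:: b.+1] * Tn [:: b] * Tn [:: b.+1] = Tn [:: b] * Tn [:: b.+1] * Tn [:: b].
Proof.
case: TH => braid _ _ bn; have b0 := ltnW bn.
by have := @braid (Ordinal b0) (Ordinal bn) erefl; rewrite -!Tnat_ord.
Qed.

Lemma far_iota (i a m : nat) : (i.+1 < a)%N || (a + m <= i.-1)%N ->
  all (fun j => (j.+1 < i)%N || (i.+1 < j)%N) (iota a m).
Proof. by move=> ia; apply/allP => j; rewrite mem_iota => jam; lia. Qed.

Lemma Tnat_far (i a m : nat) : (i.+1 < a)%N || (a + m <= i.-1)%N ->
  Tn (iota a m) * Tn [:: i] = Tn [:: i] * Tn (iota a m).
Proof. by move=> ia; apply: (Tnat_comm_word TH); apply: far_iota. Qed.

Lemma Tnat_iotaD a m m' : Tn (iota a (m + m')) = Tn (iota a m) * Tn (iota (a + m) m').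
Proof. by rewrite iotaD Tnat_cat. Qed.

Lemma Tnat_iotaS a m : Tn (iota a m.+1) = Tn [:: a] * Tn (iota a.+1 m).
Proof. by rewrite -Tnat_cat. Qed.

Lemma Tnat_iotaSr a m : Tn (iota a m.+1) = Tn (iota a m) * Tn [:: (a + m)%N].
Proof. by rewrite -addn1 Tnat_iotaD. Qed.

(** The word moves one strand across m others, which shifts the latter by one
    position. *)
Lemma cycle_shift a m b : (a + m < n.-1)%N -> (a <= b < a + m)%N ->
  Tn [:: b.+1] * Tn (iota a m.+1) = Tn (iota a m.+1) * Tn [:: b].
Proof.
move=> am /andP[ab bam].
have -> : m.+1 = ((b - a) + (2 + (a + m - b.+1)))%N by lia.
rewrite !Tnat_iotaD subnKC //=.
set A := Tn (iota a _); set B := Tn (iota (b + 2) _).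
have -> : Tn [:: b; b.+1] = Tn [:: b] * Tn [:: b.+1] by rewrite -Tnat_cat.
have hA : A * Tn [:: b.+1] = Tn [:: b.+1] * A by apply: Tnat_far; lia.
have hB : B * Tn [:: b] = Tn [:: b] * B by apply: Tnat_far; lia.
rewrite mulrA -hA -!mulrA hB; congr (_ * _); rewrite !mulrA; congr (_ * _).
by apply: Tnat_braid; lia.
Qed.

Definition absorbs Y b : Prop := Y * Tn [:: b] = q *: Y.

Lemma absorbs_iota Y a m : (forall b, (a <= b < a + m)%N -> absorbs Y b) ->
  Y * Tn (iota a m) = q ^+ m *: Y.
Proof.
elim: m => [|m IH] abs; first by rewrite Tnat_nil mulr1 scale1r.
rewrite Tnat_iotaSr mulrA IH => [|b bm]; last by apply: abs; lia.
by rewrite -scalerAl abs ?scalerA ?exprSr //; lia.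
Qed.

(** The sums of T_w over the minimal representatives of the right, respectively
    left, cosets of the subgroup of S_(m+1) fixing the first, respectively last,
    point, where the generators of S_(m+1) are those with numbers a, ..., a+m-1. *)
Definition cosetr a m : H := \sum_(t < m.+1) Tn (iota a t).
Definition cosetl a m : H := \sum_(t < m.+1) Tn (iota (a + m - t) t).

(** The sum of T_w over the symmetric group on the m+1 positions a, ..., a+m,
    factored over the cosets of smaller such groups, so that its properties follow
    by induction. *)
Fixpoint symmetrizer a m : H := if m is m'.+1 then symmetrizer a.+1 m' * cosetr a m else 1.

Lemma cosetr_rec a m : cosetr a m.+1 = cosetr a m + Tn (iota a m.+1).
Proof. exact: big_ord_recr. Qed.

Lemma cosetl_rec a m : cosetl a m.+1 = cosetl a.+1 m + Tn (iota a m.+1).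
Proof.
rewrite /cosetl big_ord_recr /= addnK; congr (_ + _).
by apply: eq_bigr => t _; rewrite addSnnS.
Qed.

Lemma absorbs_symmetrizer Y a m : (forall b, (a <= b < a + m)%N -> absorbs Y b) ->
  Y * symmetrizer a m = qfact q m.+1 *: Y.
Proof.
elim: m a => [|m IH] a abs /=.
  by rewrite mulr1 /qfact big_ord1 /qint big_ord1 expr0 scale1r.
rewrite mulrA IH => [|b bm]; last by apply: abs; lia.
rewrite -scalerAl /cosetr mulr_sumr [in RHS]qfactS -scalerA; congr (_ *: _).
rewrite /qint scaler_suml; apply: eq_bigr => t _.
by apply: absorbs_iota => b bt; apply: abs; have := ltn_ord t; lia.
Qed.

Lemma symmetrizer_shift a m c k : (a + m < n.-1)%N -> (a <= c)%N -> (c + k <= a + m)%N ->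
  symmetrizer c.+1 k * Tn (iota a m.+1) = Tn (iota a m.+1) * symmetrizer c k.
Proof.
move=> am; elim: k c => [|k IH] c ac ck /=; first by rewrite mul1r mulr1.
have word t b : (a <= b)%N -> (b + t <= a + m)%N ->
    Tn (iota b.+1 t) * Tn (iota a m.+1) = Tn (iota a m.+1) * Tn (iota b t).
  elim: t b => [|t IHt] b ab btm; first by rewrite !Tnat_nil mulr1 mul1r.
  rewrite !Tnat_iotaS -mulrA -Tnat_iotaS IHt; [|lia|lia].
  by rewrite mulrA cycle_shift ?mulrA //; lia.
rewrite -mulrA [X in _ * X](_ : _ = Tn (iota a m.+1) * cosetr c k.+1).
  by rewrite mulrA IH ?mulrA //; lia.
rewrite /cosetr mulr_sumr mulr_suml; apply: eq_bigr => t _; apply: word => //.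
by have := ltn_ord t; lia.
Qed.

(** The opposite factorization; the summand of cosetr by the full cycle moves to
    the left of the smaller symmetrizer by symmetrizer_shift. *)
Lemma symmetrizer_left a m : (a + m < n.-1)%N -> symmetrizer a m.+1 = cosetl a m.+1 * symmetrizer a m.
Proof.
elim: m a => [|m IH] a am.
  rewrite /= mul1r mulr1 /cosetr /cosetl !big_ord_recl !big_ord0 /=.
  by rewrite (_ : (a + 1 - bump 0 0)%N = a) // /bump addn0 addnK.
rewrite [LHS]/= -/(symmetrizer a.+1 m.+1) cosetr_rec mulrDr {1}IH; last by lia.
rewrite -mulrA -[symmetrizer _ _ * cosetr _ _]/(symmetrizer a m.+1) symmetrizer_shift //.
by rewrite -mulrDl -cosetl_rec.
Qed.

(** * Crossing two rows with equal contents *)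

Section Parallel.
Variables (Y : H) (P m : nat).
Hypothesis m0 : (0 < m)%N.
Hypothesis Pm : (P + 2 * m <= n)%N.
Let N := (P + m - 1)%N.
Hypothesis absY : forall b, (P <= b < P + 2 * m - 1)%N -> b != N -> absorbs Y b.

Lemma sum_take_iota c k : \sum_(t < k) Tn (take t (iota c k)) = \sum_(t < k) Tn (iota c t).
Proof.
by apply: eq_bigr => t _; rewrite take_iota (minn_idPl _) // ltnW.
Qed.

(** With E the symmetrizer at the new positions, Y E' C = Y (A Q + W) E, where E'
    is the old symmetrizer, C the chain, A its coefficient, Q a sum over left
    cosets and W the full cycle.  As Y absorbs all generators but the middle
    one, Y Q and Y W are combinations of Y and Y V, where V is the part of W from
    the middle letter on, and the value of A at the point of contents makes
    the coefficient of Y V vanish. *)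
Lemma parallel_step i : (0 < i < m)%N ->
  Y * symmetrizer (N - i).+1 m.-1 * chain T (iota (N - i) m) (- q ^+ i / qint q i) =
  (- q ^+ i * qint q (m - i) / qint q i) *: (Y * symmetrizer (N - i) m.-1).
Proof.
move=> im; set A := _ / _; pose c := (N - i)%N; rewrite -/c.
have mE : m = m.-2.+2 by lia.
have -> : Y * symmetrizer c.+1 m.-1 * chain T (iota c m) A =
          Y * (Tn (iota c m) + A *: cosetl c.+1 m.-1) * symmetrizer c m.-1.
  rewrite -!mulrA; congr (_ * _).
  rewrite /chain mulrDr size_iota sum_take_iota mulrDl -scalerAl -scalerAr.
  rewrite [in iota c m]mE symmetrizer_shift; [|rewrite /c /N; lia|lia|lia].
  rewrite (_ : m.-1 = m.-2.+1); last by lia.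
  rewrite [symmetrizer c.+1 _]symmetrizer_left; last by rewrite /c /N; lia.
  rewrite (_ : \sum_(t < m) Tn (iota c t) = cosetr c m.-2.+1); last by rewrite /cosetr -mE.
  by rewrite -mulrA -[_ * cosetr _ _]/(symmetrizer c m.-2.+1).
(* V starts at N, the only letter in question that Y does not absorb. *)
pose V := Tn (iota N (m - i)).
have YW : Y * Tn (iota c m) = q ^+ i *: (Y * V).
  rewrite (_ : m = i + (m - i))%N ?Tnat_iotaD; last by lia.
  rewrite mulrA (@absorbs_iota Y) => [|b bc]; last by apply: absY; move: bc; rewrite /c /N; lia.
  by rewrite -scalerAl (_ : (c + i)%N = N) // /c /N; lia.
have YQ : Y * cosetl c.+1 m.-1 = qint q (m - i) *: Y + qint q i *: (Y * V).
  rewrite /cosetl (_ : m.-1.+1 = (m - i) + i)%N; last by lia.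
  rewrite big_split_ord /= mulrDr !mulr_sumr !scaler_suml; congr (_ + _).
    apply: eq_bigr => t _; have tl := ltn_ord t; apply: absorbs_iota => b bt.
    by apply: absY; move: bt; rewrite /c /N; lia.
  apply: eq_bigr => e _; have el := ltn_ord e.
  rewrite (addnC (m - i)%N) Tnat_iotaD mulrA (@absorbs_iota Y) => [|b bt].
    by rewrite -scalerAl (_ : (_ - _ + _)%N = N) // /c /N; lia.
  by apply: absY; move: bt; rewrite /c /N; lia.
have i0 : qint q i != 0 by apply: qint_neq0 => //; case/andP: im.
rewrite mulrDr -scalerAr YW YQ scalerDr !scalerA /A divfK // addrCA -scalerDl.
by rewrite subrr scale0r addr0 -scalerAl mulrAC.
Qed.

Lemma angle_negpow i : (0 < i)%N -> angle q (q ^- i) = - q ^+ i / qint q i.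
Proof.
move=> i0; have h := qint_neq0 qk i0.
have hi : q ^+ i != 0 by rewrite expf_neq0.
have hk := qk i0; rewrite /angle.
have e := qintE q i; apply/eqP; rewrite eqr_div //; last first.
  by rewrite subr_eq0 eq_sym invr_eq1.
by apply/eqP; rewrite mulrBr mulr1 mulNr opprK mulfV // -opprB mulNr e opprB addrC.
Qed.

(** The i-th chain is taken at its value at the point of contents, the pole of the
    first one having been replaced by its residue 1 - q.  By parallel_step each
    chain moves the symmetrizer by one position towards the front, from positions
    N, ..., N+m-1 to P, ..., P+m-1, where Y absorbs it with eigenvalue [m]!. *)
Lemma parallel_residue :
  Y * ((1 - q) *: \sum_(t < m) Tn (iota N t)) *
    \prod_(1 <= i < m) chain T (iota (N - i) m) (angle q (q ^- i)) =
  f_const q m *: Y.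
Proof.
(* The accumulated factors of parallel_step; products of q-integers telescope. *)
pose kap i := (1 - q) * (-1) ^+ i * q ^+ 'C(i.+1, 2) / (qfact q (m - i.+1) * qfact q i).
have fact0 k : qfact q k != 0 by apply: qfact_neq0.
have main i : (i < m)%N ->
  Y * ((1 - q) *: \sum_(t < m) Tn (iota N t)) *
    \prod_(1 <= j < i.+1) chain T (iota (N - j) m) (angle q (q ^- j)) =
  kap i *: (Y * symmetrizer (N - i) m.-1).
  elim: i => [|i IH] im.
    rewrite big_geq // mulr1 subn0.
    have -> : \sum_(t < m) Tn (iota N t) = cosetr N m.-1 by rewrite /cosetr prednK.
    have -> : Y * symmetrizer N m.-1 = qfact q m.-1 *: (Y * cosetr N m.-1).
      case E : m.-1 => [|m'] /=.
        by rewrite /cosetr big_ord1 Tnat_nil /qfact big_ord0 scale1r.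
      rewrite mulrA absorbs_symmetrizer ?scalerAl // => b bm.
      by apply: absY; move: bm; rewrite /N; lia.
    rewrite -scalerAr scalerA; congr (_ *: _).
    rewrite /kap subn1 bin_small // /qfact big_ord0 !expr0 !mulr1 divfK //; exact: fact0.
  rewrite big_nat_recr //= mulrA IH; last by lia.
  rewrite -scalerAl angle_negpow // (_ : (N - i)%N = (N - i.+1).+1); last by rewrite /N; lia.
  rewrite parallel_step // scalerA; congr (_ *: _).
  rewrite /kap (_ : (m - i.+1)%N = (m - i.+2).+1); last by lia.
  rewrite [in RHS]qfactS [in LHS]qfactS (binS i.+1) bin1 exprD [(-1) ^+ i.+1]exprS.
  have h1 : qint q (m - i.+2).+1 != 0 by apply: qint_neq0.
  have h2 : qint q i.+1 != 0 by apply: qint_neq0.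
  by field; rewrite ?fact0 ?h1 ?h2.
rewrite -[m in \prod_(1 <= i < m) _](prednK m0) main; last by rewrite prednK.
rewrite absorbs_symmetrizer => [|b bm]; last by apply: absY; move: bm; rewrite /N; lia.
rewrite scalerA prednK //; congr (_ *: _).
have e : qfact q m = qfact q m.-1 * qint q m by have := qfactS q m.-1; rewrite prednK.
rewrite /kap prednK // subnn [qfact q 0]big_ord0 mul1r e /f_const -qintE bin2 -subn1.
have -> : (-1) ^+ m = - (-1) ^+ (m - 1) :> K.
  by rewrite -[in LHS](prednK m0) exprS mulN1r subn1.
by have h := fact0 (m - 1)%N; field.
Qed.

End Parallel.
End Residue.

(** * A number crossing a row *)

Section Chains.
Variables (K : fieldType) (q : K) (n : nat) (H : algType K) (T : 'I_n.-1 -> H).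
Hypothesis TH : hecke_gens q T.
Hypothesis q0 : q != 0.
Hypothesis q1 : q != 1.
Variable x : 'I_n -> K.
Hypothesis gx : generic x.
Notation Tn := (Tnat T).
Notation Phi L := (phi_line q T L x).
Notation xi := (xcoord x).

Lemma coord_neq0 i : (i < n)%N -> xi i != 0.
Proof. by case: gx => _ x0 ni; rewrite (xcoord_ord x (Ordinal ni)). Qed.

Lemma coord_inj i j : (i < n)%N -> (j < n)%N -> xi i = xi j -> i = j.
Proof.
case: gx => xinj _ ni nj; rewrite (xcoord_ord x (Ordinal ni)) (xcoord_ord x (Ordinal nj)).
by move/xinj/(congr1 val).
Qed.

Lemma perm_iota_lt L i : perm_eq L (iota 0 n) -> i \in L -> (i < n)%N.
Proof. by move/perm_mem=> ->; rewrite mem_iota. Qed.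

Definition q_progression i0 a : Prop :=
  forall i, (i0 <= i)%N -> (i.+1 < i0 + a)%N -> xi i.+1 = q * xi i.

Lemma shift_coord (i j : nat) : (i < n)%N -> (i.+1 < n)%N -> (j < n)%N -> i != j ->
  i.+1 != j -> xi i.+1 = q * xi i ->
  angle q (xi j / xi i) * (q + angle q (xi j / xi i.+1)) = angle q (xi j / xi i.+1).
Proof.
move=> ni ni1 nj ij i1j e.
have xi0 := coord_neq0 ni; have xj0 := coord_neq0 nj.
have -> : xi j / xi i.+1 = xi j / xi i / q by rewrite e invfM mulrA mulrAC.
apply: angle_shift => //.
  by rewrite (can2_eq (divfK xi0) (mulfK xi0)) mul1r; apply: contra_neq ij => /coord_inj ->.
rewrite (can2_eq (divfK xi0) (mulfK xi0)) -e.
by apply: contra_neq i1j => /coord_inj ->.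
Qed.

Lemma shift_coord_num (i j : nat) : (i < n)%N -> (j < n)%N -> (j.+1 < n)%N -> i != j ->
  i != j.+1 -> xi j.+1 = q * xi j ->
  angle q (xi j.+1 / xi i) * (q + angle q (xi j / xi i)) = angle q (xi j / xi i).
Proof.
move=> ni nj nj1 ij ij1 e.
have xi0 := coord_neq0 ni.
have -> : xi j / xi i = xi j.+1 / xi i / q by rewrite e [RHS]mulrC -mulrA mulKf.
apply: angle_shift => //.
  by rewrite (can2_eq (divfK xi0) (mulfK xi0)) mul1r; apply: contra_neq ij1 => /coord_inj ->.
rewrite (can2_eq (divfK xi0) (mulfK xi0)) e (inj_eq (mulfI q0)).
by apply: contra_neq ij => /coord_inj ->.
Qed.

(** By chain_rcons: when z has crossed a part of the row, the next letter exchanges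
    two positions which neighbours in the reversed row had before the crossing, so
    that the product absorbs it. *)
Lemma phi_line_left X i0 a z V : perm_eq (X ++ rev (iota i0 a.+1) ++ z :: V) (iota 0 n) ->
  q_progression i0 a.+1 -> (i0 + a < z)%N ->
  Phi (X ++ z :: rev (iota i0 a.+1) ++ V) =
  Phi (X ++ rev (iota i0 a.+1) ++ z :: V) *
    chain T (rev (iota (size X) a.+1)) (angle q (xi z / xi (i0 + a)%N)).
Proof.
elim: a X => [|a IH] X Lp row iz.
  by rewrite addn0 /= chain1 phi_line_step //; move: iz; rewrite addn0.
have e : rev (iota i0 a.+2) = (i0 + a.+1)%N :: rev (iota i0 a.+1).
  by rewrite -[a.+2]addn1 iotaD rev_cat.
have nz : (z < n)%N by apply: (perm_iota_lt Lp); rewrite !mem_cat inE eqxx !orbT.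
move: Lp; rewrite e cat_cons -cat_rcons => Lp.
rewrite phi_line_step //; last first.
  by rewrite -cat_rcons -(permPr Lp) perm_cat2l -cat1s perm_catCA.
rewrite -cat_rcons IH //; [|move=> i ii ia; apply: row; lia|lia].
rewrite size_rcons (_ : rev (iota (size X) a.+2) = rcons (rev (iota (size X).+1 a.+1)) (size X)).
  apply: (chain_rcons TH).
  - have e' : rcons X (i0 + a.+1)%N ++ rev (iota i0 a.+1) ++ z :: V =
        X ++ (i0 + a).+1 :: (i0 + a)%N :: rev (iota i0 a) ++ z :: V.
      by rewrite cat_rcons -[X in iota _ X]addn1 iotaD rev_cat addnS.
    rewrite e'; apply: phi_line_absorb => //; first by rewrite -e'.
    by apply: row; lia.
  - rewrite size_rev size_iota /= rev_cons -cats1 take_cat size_rev size_iota ltnn subnn cats0.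
    by apply/allP => j; rewrite mem_rev mem_iota => jj; lia.
  - by rewrite addnS; apply: shift_coord => //; try lia; apply: row; lia.
by rewrite -rev_cons.
Qed.

Lemma phi_line_right X j0 b i V : perm_eq (X ++ i :: rev (iota j0 b.+1) ++ V) (iota 0 n) ->
  q_progression j0 b.+1 -> (i < j0)%N ->
  Phi (X ++ rev (iota j0 b.+1) ++ i :: V) =
  Phi (X ++ i :: rev (iota j0 b.+1) ++ V) *
    chain T (iota (size X) b.+1) (angle q (xi j0 / xi i)).
Proof.
elim: b j0 V => [|b IH] j0 V Lp row ij.
  by rewrite /= chain1 phi_line_step.
have e : rev (iota j0 b.+2) = rcons (rev (iota j0.+1 b.+1)) j0 by rewrite -rev_cons.
have nj : (j0.+1 < n)%N.
  apply: (perm_iota_lt Lp); rewrite mem_cat inE mem_cat mem_rev mem_iota.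
  by apply/orP; right; apply/orP; right; apply/orP; left; lia.
move: Lp; rewrite e !cat_rcons => Lp.
have Lp' : perm_eq (X ++ rev (iota j0.+1 b.+1) ++ i :: j0 :: V) (iota 0 n).
  by rewrite -(permPr Lp) perm_cat2l (perm_catCA _ [:: i]).
rewrite catA phi_line_step //; last by rewrite -catA.
rewrite -catA IH //; [|move=> k kk kb; apply: row; lia|lia].
rewrite size_cat size_rev size_iota.
rewrite (_ : iota (size X) b.+2 = rcons (iota (size X) b.+1) (size X + b.+1)%N).
  apply: (chain_rcons TH).
  - have e' : rev (iota j0.+1 b.+1) = rcons (rev (iota j0.+2 b)) j0.+1 by rewrite -rev_cons.
    move: Lp; rewrite e' cat_rcons -cat_cons catA => Lp.
    have -> : (size X + b.+1)%N = size (X ++ i :: rev (iota j0.+2 b)).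
      by rewrite size_cat /= size_rev size_iota.
    by apply: phi_line_absorb => //; rewrite row //; lia.
  - rewrite size_iota take_iota (minn_idPl (leq_pred _)).
    by apply/allP => j; rewrite mem_iota /= => jj; lia.
  - apply: shift_coord_num => //; try lia.
    by apply: row; lia.
by rewrite -cats1 -[in LHS]addn1 iotaD.
Qed.

End Chains.

(** * Regular functions *)

Section Regular.
Variables (K : fieldType) (n : nat) (H : algType K).
Notation point := ('I_n -> K).
Variables (F dom : point -> Prop) (p : point).
Implicit Types (f g : point -> H) (s : point -> K) (P : seq (mpoly.mpoly n K * H)).
Notation regv := (@regular_with_value K n H F dom).

Lemma hpoly_cat P P' x : hpoly_eval (P ++ P') x = hpoly_eval P x + hpoly_eval P' x.
Proof. exact: big_cat. Qed.

Definition hpoly_scale (N : mpoly.mpoly n K) P := [seq (N * u.1, u.2) | u <- P].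

Lemma hpoly_scaleE N P x : hpoly_eval (hpoly_scale N P) x = N.@[x] *: hpoly_eval P x.
Proof.
rewrite /hpoly_eval big_map scaler_sumr; apply: eq_bigr => u _.
by rewrite mevalM scalerA.
Qed.

Definition hpoly_mul P P' := [seq (u.1 * v.1, u.2 * v.2) | u <- P, v <- P'].

Lemma hpoly_mulE P P' x :
  hpoly_eval (hpoly_mul P P') x = hpoly_eval P x * hpoly_eval P' x.
Proof.
rewrite /hpoly_eval big_allpairs_dep mulr_suml; apply: eq_bigr => u _.
rewrite mulr_sumr; apply: eq_bigr => v _.
by rewrite /= mevalM -scalerAl -scalerAr scalerA.
Qed.

Lemma regular_ext f g E : (forall x, F x -> dom x -> f x = g x) ->
  regv f p E -> regv g p E.
Proof.
by move=> fg [P [D [Dp Df DE]]]; exists P, D; split=> // x Fx dx; rewrite -fg // Df.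
Qed.

Lemma regular_const h : regv (fun=> h) p h.
Proof.
exists [:: (1, h)], 1; rewrite /hpoly_eval ?meval1; split=> [|x _ _|].
- exact: oner_neq0.
- by rewrite big_seq1 meval1.
- by rewrite big_seq1 meval1.
Qed.

Lemma regular_mul f g E E' : regv f p E -> regv g p E' ->
  regv (fun x => f x * g x) p (E * E').
Proof.
move=> [P [D [Dp Df DE]]] [P' [D' [Dp' Dg DE']]].
exists (hpoly_mul P P'), (D * D'); split=> [|x Fx dx|].
- by rewrite mevalM mulf_neq0.
- by rewrite mevalM hpoly_mulE -Df // -Dg // -scalerAl -scalerAr scalerA.
- by rewrite mevalM hpoly_mulE -DE -DE' -scalerAl -scalerAr scalerA.
Qed.

Lemma regular_add f g E E' : regv f p E -> regv g p E' ->
  regv (fun x => f x + g x) p (E + E').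
Proof.
move=> [P [D [Dp Df DE]]] [P' [D' [Dp' Dg DE']]].
exists (hpoly_scale D' P ++ hpoly_scale D P'), (D * D'); split=> [|x Fx dx|].
- by rewrite mevalM mulf_neq0.
- rewrite mevalM hpoly_cat !hpoly_scaleE -Df // -Dg // !scalerA scalerDr.
  by rewrite [D'.@[x] * _]mulrC.
- rewrite mevalM hpoly_cat !hpoly_scaleE -DE -DE' !scalerA scalerDr.
  by rewrite [D'.@[p] * _]mulrC.
Qed.

Definition regular_scalar s (c : K) : Prop := exists N D : mpoly.mpoly n K,
  [/\ D.@[p] != 0, forall x, F x -> dom x -> D.@[x] * s x = N.@[x]
    & D.@[p] * c = N.@[p]].

Lemma regular_scale s f c E : regular_scalar s c -> regv f p E ->
  regv (fun x => s x *: f x) p (c *: E).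
Proof.
move=> [N [D [Dp Ds Dc]]] [P [D' [Dp' Df DE]]].
exists (hpoly_scale N P), (D * D'); split=> [|x Fx dx|].
- by rewrite mevalM mulf_neq0.
- by rewrite mevalM hpoly_scaleE -Df // -Ds // !scalerA mulrAC.
- by rewrite mevalM hpoly_scaleE -DE -Dc // !scalerA mulrAC.
Qed.

Lemma regular_prod (I : eqType) (r : seq I) (f : I -> point -> H) (E : I -> H) :
  (forall i, i \in r -> regv (f i) p (E i)) ->
  regv (fun x => \prod_(i <- r) f i x) p (\prod_(i <- r) E i).
Proof.
elim: r => [|i r IH] fE.
  by rewrite big_nil; apply: regular_ext (regular_const 1) => x _ _; rewrite big_nil.
have fi : regv (f i) p (E i) by apply: fE; rewrite inE eqxx.
have fr : regv (fun x => \prod_(j <- r) f j x) p (\prod_(j <- r) E j).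
  by apply: IH => j jr; apply: fE; rewrite inE jr orbT.
rewrite big_cons; apply: regular_ext (regular_mul fi fr) => x _ _.
by rewrite big_cons.
Qed.

Definition dense : Prop := forall P,
  (forall x, F x -> dom x -> hpoly_eval P x = 0) -> hpoly_eval P p = 0.

Lemma regular_unique f E E' : dense -> regv f p E -> regv f p E' -> E = E'.
Proof.
move=> Fd [P [D [Dp Df DE]]] [P' [D' [Dp' Df' DE']]].
have := Fd (hpoly_scale D' P ++ hpoly_scale (- D) P').
rewrite hpoly_cat !hpoly_scaleE mevalN scaleNr -DE -DE' !scalerA [_ * D.@[p]]mulrC.
rewrite -scalerBr => e; apply/eqP; rewrite -subr_eq0.
have : (D.@[p] * D'.@[p]) *: (E - E') = 0.
  apply: e => x Fx dx; rewrite hpoly_cat !hpoly_scaleE mevalN scaleNr -Df // -Df' //.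
  by rewrite !scalerA [_ * D.@[x]]mulrC subrr.
by move/eqP; rewrite scaler_eq0 mulf_eq0 (negbTE Dp) (negbTE Dp').
Qed.

End Regular.

Section Scalars.
Variables (K : fieldType) (q : K) (n : nat) (F : ('I_n -> K) -> Prop) (p : 'I_n -> K).
Notation regular_scalar := (regular_scalar F (@generic K n) p).

Lemma regular_scalar_angle i j : (i < n)%N -> (j < n)%N -> xcoord p i != 0 ->
  xcoord p i != xcoord p j ->
  regular_scalar (fun x => angle q (xcoord x j / xcoord x i)) (angle q (xcoord p j / xcoord p i)).
Proof.
move=> ni nj; set i' := Ordinal ni; set j' := Ordinal nj.
have ei x : xcoord x i = x i' := xcoord_ord x i'.
have ej x : xcoord x j = x j' := xcoord_ord x j'.
rewrite !ei !ej => pi pij.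
have main x : x i' != 0 -> x i' != x j' ->
    (x i' - x j') * angle q (x j' / x i') = (1 - q) * x i'.
  by move=> xi xij; rewrite /angle; field; rewrite ?xi ?subr_eq0 ?xij // eq_sym.
exists ((1 - q) *: 'X_i'), ('X_i' - 'X_j'); split=> [|x _ [xinj x0]|].
- by rewrite mevalB !mevalXU subr_eq0.
- rewrite ei ej mevalB mevalZ !mevalXU main ?(inj_eq xinj) //.
  by apply: contra_neq pij => ->.
- by rewrite mevalB mevalZ !mevalXU main.
Qed.

Lemma regular_scalar_subr i j : (i < n)%N -> (j < n)%N -> xcoord p i != 0 ->
  regular_scalar (fun x => 1 - xcoord x j / xcoord x i) (1 - xcoord p j / xcoord p i).
Proof.
move=> ni nj; set i' := Ordinal ni; set j' := Ordinal nj.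
have ei x : xcoord x i = x i' := xcoord_ord x i'.
have ej x : xcoord x j = x j' := xcoord_ord x j'.
rewrite !ei !ej => pi; exists ('X_i' - 'X_j'), 'X_i'.
have main (a b : K) : a != 0 -> a * (1 - b / a) = a - b by move=> a0; field.
split=> [|x _ [_ x0]|]; rewrite ?ei ?ej ?mevalB ?mevalXU //; exact: main.
Qed.

End Scalars.

(** * Evaluation at the point of contents *)

Section State.
Variables (K : fieldType) (q : K) (n : nat) (H : algType K) (T : 'I_n.-1 -> H).
Hypothesis TH : hecke_gens q T.
Hypothesis q0 : q != 0.
Hypothesis qk : forall k, (0 < k)%N -> q ^+ k != 1.
Variables (F : ('I_n -> K) -> Prop) (p : 'I_n -> K).
Hypothesis Fdense : dense H F (@generic K n) p.
Hypothesis p0 : forall i, (i < n)%N -> xcoord p i != 0.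
Notation regv := (@regular_with_value K n H F (@generic K n)).
Implicit Types (L X V ks : seq nat) (d : ('I_n -> K) -> K).

Let q1 : q != 1. Proof. by have := @qk 1 isT; rewrite expr1. Qed.

(** The state after some crossings: L lists the numbers by position, d and c are
    the parts of delta and of the leading coefficient collected so far, and ks is
    the word of the leading term. *)
Definition evaluates L d (c : K) ks : Prop :=
  [/\ perm_eq L (iota 0 n) & exists E,
     [/\ regv (fun x => d x *: phi_line q T L x) p E & lead T c ks E]].

Lemma evaluates_start : evaluates (iota 0 n) (fun=> 1) 1 [::].
Proof.
split=> //; exists 1; split.
  by apply: regular_ext (regular_const _ _ _ _) => x _ _; rewrite phi_line_iota scale1r.
by rewrite /lead Tnat_nil scale1r subrr; apply: below0.
Qed.

Lemma regular_chain g i j : (i < n)%N -> (j < n)%N -> xcoord p i != xcoord p j ->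
  regv (fun x => chain T g (angle q (xcoord x j / xcoord x i))) p
       (chain T g (angle q (xcoord p j / xcoord p i))).
Proof.
move=> ni nj pij; apply: regular_add; first exact: regular_const.
by apply: regular_scale (regular_const _ _ _ _); apply: regular_scalar_angle => //; apply: p0.
Qed.

Lemma evaluates_chain L L' d c ks g i j : perm_eq L' L ->
  (i < n)%N -> (j < n)%N -> xcoord p i != xcoord p j ->
  (forall x, F x -> generic x -> phi_line q T L' x =
     phi_line q T L x * chain T g (angle q (xcoord x j / xcoord x i))) ->
  evaluates L d c ks -> evaluates L' d c (ks ++ g).
Proof.
move=> LL' ni nj pij e [Lp [E [LE leadE]]]; split; first by rewrite (permPl LL').
exists (E * chain T g (angle q (xcoord p j / xcoord p i))); split.
  apply: regular_ext (regular_mul LE (regular_chain g ni nj pij)) => x Fx gx.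
  by rewrite e // -scalerAl.
exact: (lead_chain TH).
Qed.

Lemma evaluates_left X i0 a z V d c ks :
  (forall x, F x -> generic x -> q_progression q x i0 a.+1) -> (i0 + a < z)%N ->
  xcoord p (i0 + a) != xcoord p z ->
  evaluates (X ++ rev (iota i0 a.+1) ++ z :: V) d c ks ->
  evaluates (X ++ z :: rev (iota i0 a.+1) ++ V) d c (ks ++ rev (iota (size X) a.+1)).
Proof.
move=> row iz piz ev; have [Lp _] := ev.
have nz : (z < n)%N by apply: (perm_iota_lt Lp); rewrite !mem_cat inE eqxx !orbT.
apply: (evaluates_chain _ _ nz piz) ev; last 1 first.
- by move=> x Fx gx; apply: phi_line_left => //; apply: row.
- by rewrite perm_cat2l (perm_catCA [:: z]).
- by apply: ltn_trans nz.
Qed.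

Lemma evaluates_right X j0 b i V d c ks :
  (forall x, F x -> generic x -> q_progression q x j0 b.+1) -> (i < j0)%N ->
  xcoord p i != xcoord p j0 ->
  evaluates (X ++ i :: rev (iota j0 b.+1) ++ V) d c ks ->
  evaluates (X ++ rev (iota j0 b.+1) ++ i :: V) d c (ks ++ iota (size X) b.+1).
Proof.
move=> row ij pij ev; have [Lp _] := ev.
have nj : (j0 < n)%N.
  by apply: (perm_iota_lt Lp); rewrite mem_cat inE mem_cat mem_rev mem_iota; lia.
apply: (evaluates_chain _ _ nj pij) ev; last 1 first.
- by move=> x Fx gx; apply: phi_line_right => //; apply: row.
- by rewrite perm_cat2l (perm_catCA _ [:: i]).
- by apply: ltn_trans nj.
Qed.

Lemma block_absorb x X i0 m V s : generic x ->
  perm_eq (X ++ rev (iota i0 m) ++ V) (iota 0 n) -> q_progression q x i0 m ->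
  (s.+1 < m)%N ->
  phi_line q T (X ++ rev (iota i0 m) ++ V) x * Tnat T [:: (size X + s)%N] =
  q *: phi_line q T (X ++ rev (iota i0 m) ++ V) x.
Proof.
move=> gx Lp row sm.
have e : X ++ rev (iota i0 m) ++ V =
  (X ++ rev (iota (i0 + (m - s)) s)) ++
  (i0 + (m - s.+2)).+1 :: (i0 + (m - s.+2))%N :: (rev (iota i0 (m - s.+2)) ++ V).
  rewrite (_ : m = (m - s.+2) + (2 + s))%N; last by lia.
  rewrite 2!iotaD !rev_cat -!catA /=; congr (_ ++ (rev (iota _ _) ++ _)); first by lia.
  rewrite /= !addnS ?addn0 ?addn1 -?catA /=; do 2! [congr (_ :: _); first by lia].
  by congr (rev (iota _ _) ++ _); lia.
rewrite e in Lp *; set X' := X ++ _ in Lp *.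
have -> : (size X + s)%N = size X' by rewrite size_cat size_rev size_iota.
by apply: (phi_line_absorb TH) => //; apply: row; lia.
Qed.

(** The relation holds at the generic points, hence at p by density. *)
Lemma regular_absorb d L E b : regv (fun x => d x *: phi_line q T L x) p E ->
  (forall x, F x -> generic x -> phi_line q T L x * Tnat T [:: b] = q *: phi_line q T L x) ->
  absorbs q T E b.
Proof.
move=> LE abs; apply: (regular_unique Fdense (regular_mul LE (regular_const _ _ _ _))).
have qE : regular_scalar F (@generic K n) p (fun=> q) q.
  by exists q%:MP, 1; rewrite !meval1 oner_neq0; split=> // *; rewrite ?meval1 mul1r mevalC.
apply: regular_ext (regular_scale qE LE) => x Fx gx.
by rewrite -scalerAl abs // !scalerA mulrC.
Qed.

(** The numbers of the first row cross the second row one by one.  The first chain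
    ends in the coefficient <r> with r = 1 at p, and (1 - r) <r> = 1 - q; the
    others have the coefficients <q^-s> there. *)
Lemma evaluates_parallel X i0 j0 m V d c ks : (0 < m)%N -> (i0 + m <= j0)%N ->
  (forall x, F x -> generic x -> q_progression q x i0 m) ->
  (forall x, F x -> generic x -> q_progression q x j0 m) ->
  (forall s, (s < m)%N -> xcoord p (i0 + s)%N = q ^+ s * xcoord p j0) ->
  evaluates (X ++ rev (iota i0 m) ++ rev (iota j0 m) ++ V) d c ks ->
  evaluates (X ++ rev (iota j0 m) ++ rev (iota i0 m) ++ V)
    (fun x => d x * (1 - xcoord x j0 / xcoord x i0)) (c * f_const q m) ks.
Proof.
move=> m0 ij rowi rowj cont [Lp [E [LE leadE]]].
pose N := (size X + m - 1)%N.
have Ln : (size X + 2 * m <= n)%N.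
  have := perm_size Lp; rewrite !size_cat !size_rev !size_iota. by move=> <-; rewrite leq_add2l mul2n -addnn leq_add2l leq_addr.
have ltn_j : (j0 < n)%N.
  by apply: (perm_iota_lt Lp); rewrite !mem_cat !mem_rev !mem_iota; lia.
have ltn_i s : (s < m)%N -> (i0 + s < n)%N by lia.
have absE b : (size X <= b < size X + 2 * m - 1)%N -> b != N -> absorbs q T E b.
  move=> bb bN; apply: (regular_absorb LE) => x Fx gx.
  have [bm|mb] := ltnP b N.
    have -> : b = (size X + (b - size X))%N by lia.
    by apply: block_absorb => //; [exact: rowi|rewrite /N in bm; lia].
  have -> : b = (size (X ++ rev (iota i0 m)) + (b - size X - m))%N.
    by rewrite size_cat size_rev size_iota; rewrite /N in mb bN *; lia.
  have e := catA X (rev (iota i0 m)) (rev (iota j0 m) ++ V).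
  by rewrite e in Lp *; apply: block_absorb => //; [exact: rowj|rewrite /N in mb bN *; lia].
pose ang (x : 'I_n -> K) s := angle q (xcoord x j0 / xcoord x (i0 + s)%N).
have cross x k : F x -> generic x -> (k <= m)%N ->
    phi_line q T (X ++ rev (iota (i0 + k) (m - k)) ++ rev (iota j0 m) ++ rev (iota i0 k) ++ V) x =
    phi_line q T (X ++ rev (iota i0 m) ++ rev (iota j0 m) ++ V) x *
      \prod_(0 <= s < k) chain T (iota (N - s) m) (ang x s).
  move=> Fx gx; elim: k => [|k IH] km; first by rewrite addn0 subn0 big_geq // mulr1.
  rewrite big_nat_recr //= mulrA -IH; last by lia.
  have e1 : rev (iota (i0 + k) (m - k)) =
            rcons (rev (iota (i0 + k.+1) (m - k.+1))) (i0 + k)%N.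
    by rewrite (_ : m - k = (m - k.+1).+1)%N ?rev_cons ?addnS ?rev_cons //; lia.
  have e2 : rev (iota i0 k.+1) = (i0 + k)%N :: rev (iota i0 k).
    by rewrite -[k.+1]addn1 iotaD rev_cat.
  rewrite e1 e2 cat_rcons !cat_cons !(catA X); set X' := X ++ _.
  have sX' : size X' = (N - k)%N by rewrite size_cat size_rev size_iota /N; lia.
  have pX : perm_eq (X' ++ (i0 + k)%N :: rev (iota j0 m) ++ rev (iota i0 k) ++ V) (iota 0 n).
    rewrite -(permPr Lp) -catA perm_cat2l -cat_rcons -e1.
    rewrite (perm_catCA _ (rev (iota j0 m))) perm_sym (perm_catCA _ (rev (iota j0 m))).
    rewrite perm_cat2l catA perm_cat2r -rev_cat -iotaD subnKC //; last by lia.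
  have := @phi_line_right _ q n _ T TH q0 q1 x gx X' j0 m.-1 (i0 + k)%N (rev (iota i0 k) ++ V).
  rewrite prednK // sX' => -> //; [exact: rowj|lia].
have eqL x : F x -> generic x ->
  phi_line q T (X ++ rev (iota j0 m) ++ rev (iota i0 m) ++ V) x =
  phi_line q T (X ++ rev (iota i0 m) ++ rev (iota j0 m) ++ V) x *
      \prod_(0 <= s < m) chain T (iota (N - s) m) (ang x s).
  by move=> Fx gx; rewrite -cross // subnn.
split.
  by rewrite -(permPr Lp) perm_cat2l perm_catCA.
have pi s : (s < m)%N -> xcoord p (i0 + s)%N != xcoord p j0 \/ s = 0%N.
  case: s => [|s] sm; [by right|left]; rewrite cont //.
  have := qk (ltn0Sn s); apply: contra_neq => e; apply: (mulIf (p0 ltn_j)).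
  by rewrite e mul1r.
have pi0 : xcoord p i0 = xcoord p j0 by have := cont 0%N m0; rewrite addn0 expr0 mul1r.
pose C0 (x : 'I_n -> K) := (1 - xcoord x j0 / xcoord x i0) *: Tnat T (iota N m) +
   (1 - q) *: \sum_(t < m) Tnat T (iota N t).
have C0E x : F x -> generic x ->
    (1 - xcoord x j0 / xcoord x i0) *: chain T (iota N m) (ang x 0%N) = C0 x.
  move=> Fx gx; rewrite /C0 /chain scalerDr size_iota sum_take_iota scalerA /ang addn0.
  congr (_ + _ *: _); rewrite /angle mulrCA divff ?mulr1 // subr_eq0 eq_sym.
  have xi := coord_neq0 gx (ltn_i _ m0); rewrite addn0 in xi.
  rewrite (can2_eq (divfK xi) (mulfK xi)) mul1r.
  apply/eqP => /(coord_inj gx ltn_j) e.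
  by have := e (ltn_trans (_ : i0 < j0)%N ltn_j); lia.
have regC0 : regv C0 p ((1 - q) *: \sum_(t < m) Tnat T (iota N t)).
  rewrite -[X in regv _ _ X]add0r; apply: regular_add; last exact: regular_const.
  rewrite -(scale0r (Tnat T (iota N m))); apply: regular_scale (regular_const _ _ _ _).
  rewrite -[X in regular_scalar _ _ _ _ X](_ : 1 - xcoord p j0 / xcoord p i0 = 0).
    by apply: regular_scalar_subr => //; [lia|apply: p0; lia].
  by rewrite pi0 divff ?subrr // p0.
have regC s : (0 < s < m)%N ->
    regv (fun x => chain T (iota (N - s) m) (ang x s)) p
         (chain T (iota (N - s) m) (angle q (q ^- s))).
  move=> /andP[s0 sm]; rewrite (_ : q ^- s = xcoord p j0 / xcoord p (i0 + s)%N).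
    by apply: regular_chain => //; [exact: ltn_i|case: (pi _ sm) => // e; rewrite e in s0].
  by rewrite cont // invfM mulrA mulrAC divff ?mul1r ?p0.
pose Rx (x : 'I_n -> K) := \prod_(1 <= s < m) chain T (iota (N - s) m) (ang x s).
have regR : regv Rx p (\prod_(1 <= s < m) chain T (iota (N - s) m) (angle q (q ^- s))).
  by apply: regular_prod => s; rewrite mem_index_iota; apply: regC.
exists (f_const q m *: E); split; last first.
  rewrite /lead (_ : _ - _ = f_const q m *: (E - c *: Tnat T ks)); first exact: belowZ.
  by rewrite scalerBr scalerA [c * _]mulrC.
rewrite -(parallel_residue TH q0 qk m0 Ln absE).
apply: regular_ext (regular_mul (regular_mul LE regC0) regR) => x Fx gx.
rewrite eqL // big_ltn // subn0 -C0E // /Rx.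
by rewrite -!scalerAl -!scalerAr -!scalerAl scalerA !mulrA.
Qed.

Lemma evaluates_blocks_left X i0 j0 a b V d c ks : (0 < a)%N -> (i0 + a <= j0)%N ->
  (forall x, F x -> generic x -> q_progression q x i0 a) ->
  (forall s, (s < b)%N -> xcoord p (i0 + a.-1) != xcoord p (j0 + s)) ->
  evaluates (X ++ rev (iota i0 a) ++ rev (iota j0 b) ++ V) d c ks ->
  evaluates (X ++ rev (iota j0 b) ++ rev (iota i0 a) ++ V) d c (ks ++ blocks_left (size X) a b).
Proof.
case: a => // a _ ij row; elim: b X ks => [|b IH] X ks piz ev; first by rewrite cats0.
have e : rev (iota j0 b.+1) = (j0 + b)%N :: rev (iota j0 b).
  by rewrite -[b.+1]addn1 iotaD rev_cat.
rewrite -[blocks_left _ _ b.+1]/(rev (iota (size X) a.+1) ++ blocks_left (size X).+1 a.+1 b).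
rewrite e cat_cons in ev *; rewrite cat_cons -cat_rcons [ks ++ _]catA -(size_rcons X (j0 + b)%N).
apply: IH; first by move=> s sb; apply: piz; lia.
by rewrite cat_rcons; apply: evaluates_left => //; [lia|apply: piz].
Qed.

Lemma evaluates_blocks_right X i0 j0 a b V d c ks : (0 < b)%N -> (i0 + a <= j0)%N ->
  (forall x, F x -> generic x -> q_progression q x j0 b) ->
  (forall s, (s < a)%N -> xcoord p (i0 + s) != xcoord p j0) ->
  evaluates (X ++ rev (iota i0 a) ++ rev (iota j0 b) ++ V) d c ks ->
  evaluates (X ++ rev (iota j0 b) ++ rev (iota i0 a) ++ V) d c (ks ++ blocks_right (size X) a b).
Proof.
case: b => // b _ ij row; elim: a i0 V ks ij => [|a IH] i0 V ks ij piz ev.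
  by rewrite cats0.
have e : rev (iota i0 a.+1) = rcons (rev (iota i0.+1 a)) i0 by rewrite -rev_cons.
rewrite -[blocks_right _ a.+1 _]/(iota (size X + a) b.+1 ++ blocks_right (size X) a b.+1).
rewrite e !cat_rcons in ev *; rewrite [ks ++ _]catA.
apply: IH; first by lia.
  by move=> s sb; rewrite addSnnS; apply: piz; lia.
have -> : (size X + a)%N = size (X ++ rev (iota i0.+1 a)) by rewrite size_cat size_rev size_iota.
rewrite catA; apply: evaluates_right => //; [lia| |by rewrite -catA].
by rewrite -[i0]addn0; apply: piz.
Qed.

Lemma evaluates_reverse_word X i0 m V d c ks :
  (forall x, F x -> generic x -> q_progression q x i0 m) ->
  (forall s, (s.+1 < m)%N -> xcoord p (i0 + s) != xcoord p (i0 + s.+1)) ->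
  evaluates (X ++ iota i0 m ++ V) d c ks ->
  evaluates (X ++ rev (iota i0 m) ++ V) d c (ks ++ reverse_word (size X) m).
Proof.
elim: m V => [|m IH] V row pp ev; first by rewrite cats0.
have e : iota i0 m.+1 = rcons (iota i0 m) (i0 + m)%N.
  by rewrite -[m.+1]addn1 iotaD cats1.
rewrite e cat_rcons in ev; rewrite e rev_rcons cat_cons.
rewrite -[reverse_word _ m.+1]/(reverse_word (size X) m ++ rev (iota (size X) m)) [ks ++ _]catA.
have {}ev : evaluates (X ++ rev (iota i0 m) ++ (i0 + m)%N :: V) d c (ks ++ reverse_word (size X) m).
  apply: IH ev => [x Fx gx i ii im|s sm]; last by apply: pp; lia.
  by apply: row => //; lia.
case: m {IH e} row pp ev => [|m] row pp ev; first by rewrite cats0.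
apply: evaluates_left => //; [|lia|by apply: pp].
by move=> x Fx gx i ii im; apply: row => //; lia.
Qed.

End State.

(** * Density of the generic points *)

Section AlgebraPoly.
Variables (K : fieldType) (H : algType K).

(** Scalars are central, so that roots can be split off one by one although H need
    not be commutative. *)
Lemma algebra_roots (P : {poly H}) (ts : seq K) : uniq ts ->
  (size P <= size ts)%N -> (forall t, t \in ts -> P.[t%:A] = 0) -> P = 0.
Proof.
elim: ts P => [|t ts IH] P /=; first by rewrite leqn0 size_poly_eq0 => _ /eqP.
case/andP=> tts uts sP Pts.
have /eqP/factor_theorem[Q PQ] : P.[t%:A] = 0 by apply: Pts; rewrite inE eqxx.
suff Q0 : Q = 0 by rewrite PQ Q0 mul0r.
apply: IH => // [|s sts].
  have [->|Q0] := eqVneq Q 0; first by rewrite size_poly0.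
  move: sP; rewrite PQ size_Mmonic ?monicXsubC // size_XsubC addn2 /= ltnS.
  by apply: leq_trans.
have := Pts s; rewrite inE sts orbT PQ hornerM_comm; last first.
  by rewrite /comm_poly hornerXsubC mulr_algl mulr_algr.
rewrite hornerXsubC -scalerBl => /(_ isT) /eqP.
rewrite mulr_algr scaler_eq0 subr_eq0 => /orP[/eqP st|/eqP //].
by rewrite -st sts in tts.
Qed.

Lemma algebra_polyE (us : seq ({poly K} * H)) : exists P : {poly H},
  forall t : K, P.[t%:A] = \sum_(u <- us) u.1.[t] *: u.2.
Proof.
elim: us => [|u us [P PE]]; first by exists 0 => t; rewrite horner0 big_nil.
exists (P + \poly_(i < size u.1) (u.1`_i *: u.2)) => t.
rewrite hornerD big_cons PE addrC horner_poly; congr (_ + _).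
rewrite horner_coef scaler_suml; apply: eq_bigr => i _.
by rewrite exprZn expr1n mulr_algr scalerA mulrC.
Qed.

End AlgebraPoly.

Lemma expz_inj (K : fieldType) (q : K) (a b : int) : q != 0 ->
  (forall k, (0 < k)%N -> q ^+ k != 1) -> q ^ a = q ^ b -> a = b.
Proof.
move=> q0 qk e; have : q ^ (a - b) = 1 by rewrite expfzDr // e -expfzDr // subrr.
case E : (a - b) => [[|m]|m]; first by lia.
- by rewrite -exprnP => /eqP; rewrite (negbTE (qk _ (ltn0Sn m))).
- by rewrite NegzE -exprnN => /eqP; rewrite invr_eq1 (negbTE (qk _ (ltn0Sn m))).
Qed.

Section FSpace.
Variables (K : fieldType) (q : K) (n : nat) (la : seq (int * int)) (H : algType K).
Hypothesis hla : cherednik la.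
Hypothesis hn : degree la = n.
Hypothesis q0 : q != 0.
Hypothesis qk : forall k, (0 < k)%N -> q ^+ k != 1.
Notation F := (@F_space K q n la).
Notation p := (@content_point K q n la).
Notation r := (size la).

Lemma off_lt l t : (1 <= l <= r)%N -> (t < row_len la l)%N -> (row_offset la l + t < n)%N.
Proof.
move=> lr tl; rewrite -hn -off_degree; apply: (@leq_trans (row_offset la l.+1)).
  by rewrite offS ?ltn_add2l //; lia.
by apply: off_leq; lia.
Qed.

Lemma content_point_coord l t : (1 <= l <= r)%N -> (t < row_len la l)%N ->
  xcoord p (row_offset la l + t) = q ^ (row_a la l - l%:Z + t%:Z).
Proof.
move=> lr tl; rewrite (xcoord_ord p (Ordinal (off_lt lr tl))) /content_point /=.
by rewrite contentE.
Qed.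

Lemma F_q_progression x l : F x -> (1 <= l <= r)%N -> q_progression q x (row_offset la l) (row_len la l).
Proof.
move=> Fx lr i li il; have [t it] : {t | i = (row_offset la l + t)%N} by exists (i - row_offset la l)%N; lia.
have tl : (t.+1 < row_len la l)%N by lia.
have := Fx (Ordinal (off_lt lr tl)) (Ordinal (off_lt lr (ltnW tl))).
rewrite /= !row_ofE ?(ltnW tl) // !contentE ?(ltnW tl) // => /(_ erefl).
set A := row_a la l - l%:Z => e.
have eA : q ^ (A + t.+1%:Z) = q * q ^ (A + t%:Z).
  by rewrite (_ : A + t.+1%:Z = 1 + (A + t%:Z)) ?(expfzDr 1) ?expr1z //; lia.
move: e; rewrite -!xcoord_ord /= it -addnS eA mulrAC mulrC => e.
have qA : q ^ (A + t%:Z) != 0 by rewrite expfz_neq0.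
by apply: (mulfI qA); rewrite e mulrC.
Qed.

(** A curve in the affine subspace through the point of contents, at t = 1; its
    points for t = q^s are generic when s exceeds all differences of contents. *)
Definition curve (t : K) : 'I_n -> K := fun k => t ^+ row_of la k * q ^ content la k.

Lemma curve_F t : F (curve t).
Proof. by move=> k l kl; rewrite /curve kl mulrAC mulrC mulrCA mulrA. Qed.

Lemma curve1 : curve 1 = p.
Proof. by apply: boolp.funext => k; rewrite /curve expr1n mul1r. Qed.

Lemma content_row_inj (k l : 'I_n) : row_of la k = row_of la l ->
  content la k = content la l -> k = l.
Proof.
have kn : (k < degree la)%N by rewrite hn. have ln : (l < degree la)%N by rewrite hn.
have [i [s [ir sl ks]]] := row_splitP kn; have [j [t [jr tl lt]]] := row_splitP ln.
rewrite ks lt !row_ofE // => ij; subst j; rewrite !contentE // => st.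
by apply: val_inj; rewrite /= ks lt; lia.
Qed.

Lemma curve_generic s : (\sum_(k < n) `|content la k|.*2 < s)%N -> generic (curve (q ^+ s)).
Proof.
move=> sP; have cE k : curve (q ^+ s) k = q ^ ((s * row_of la k)%N%:Z + content la k).
  by rewrite expfzDr // /curve -exprM -exprnP.
have bound (k : 'I_n) : (`|content la k|.*2 < s)%N.
  by apply: leq_ltn_trans sP; rewrite (bigD1 k) //= leq_addr.
split=> [k l|k]; rewrite !cE ?expfz_neq0 // => /(expz_inj q0 qk).
have bk := bound k; have bl := bound l => e.
have rkl : row_of la k = row_of la l by nia.
by apply: content_row_inj => //; rewrite rkl in e; lia.
Qed.

(** Along the curve an H-valued polynomial becomes a polynomial in t, with
    infinitely many roots q^s if it vanishes at the generic points. *)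
Lemma F_dense : dense H F (@generic K n) p.
Proof.
move=> P P0.
have [us usE] : exists us : seq ({poly K} * H), forall t : K,
    \sum_(u <- us) u.1.[t] *: u.2 = hpoly_eval P (curve t).
  exists [seq (\sum_(m <- msupp u.1)
      u.1@_m *: \prod_(i < n) (q ^ content la i *: 'X^(row_of la i)) ^+ m i, u.2) | u <- P].
  move=> t; rewrite big_map; apply: eq_bigr => u _ /=; congr (_ *: _).
  rewrite horner_sum mevalE; apply: eq_bigr => m _.
  rewrite hornerZ horner_prod; congr (_ * _); apply: eq_bigr => i _.
  by rewrite horner_exp hornerZ hornerXn mulrC.
have [Q QE] := algebra_polyE us.
set N := (\sum_(k < n) `|content la k|.*2)%N.
have Q0 : Q = 0.
  apply: (@algebra_roots _ _ _ [seq q ^+ s | s <- iota N.+1 (size Q)]).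
  - rewrite map_inj_uniq ?iota_uniq // => a b; rewrite !exprnP => /(expz_inj q0 qk); lia.
  - by rewrite size_map size_iota.
  move=> t /mapP[s]; rewrite mem_iota => /andP[Ns _] ->.
  by rewrite QE usE P0 //; [exact: curve_F|exact: curve_generic].
by rewrite -curve1 -usE -QE Q0 horner0.
Qed.

End FSpace.

(** * Crossing the rows *)

Section RowInduction.
Variables (K : fieldType) (q : K) (n : nat) (la : seq (int * int)).
Variables (H : algType K) (T : 'I_n.-1 -> H).
Hypothesis TH : hecke_gens q T.
Hypothesis hla : cherednik la.
Hypothesis hn : degree la = n.
Hypothesis q0 : q != 0.
Hypothesis qk : forall k, (0 < k)%N -> q ^+ k != 1.
Notation p := (@content_point K q n la).
Notation r := (size la).
Notation len := (row_len la).
Notation off := (row_offset la).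
Notation ev := (evaluates q T (@F_space K q n la) p).

Definition base (l : nat) : seq nat :=
  rev (iota 0 (off l.+1)) ++ iota (off l.+1) (n - off l.+1).

Definition crossed (l k : nat) : seq nat :=
  rev (iota (off k.+1) (off l - off k.+1)) ++ rev (iota (off l) (len l)) ++
  rev (iota 0 (off k.+1)) ++ iota (off l.+1) (n - off l.+1).

Definition pair_delta (x : 'I_n -> K) (i j : nat) : K :=
  1 - xcoord x (off j) / xcoord x (off i).

Definition part_delta (l k : nat) (x : 'I_n -> K) : K :=
  \prod_(1 <= j < l) \prod_(1 <= i < j | parallel la i j) pair_delta x i j *
  \prod_(1 <= i < k.+1 | parallel la i l) pair_delta x i l.

Definition part_const (l k : nat) : K :=
  \prod_(1 <= j < l) \prod_(1 <= i < j | parallel la i j) f_const q (len i) *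
  \prod_(1 <= i < k.+1 | parallel la i l) f_const q (len i).

Lemma off1 : off 1 = 0%N. Proof. exact: big_geq. Qed.

Lemma off_max l : (l <= r)%N -> (off l.+1 <= n)%N.
Proof. by move=> lr; rewrite -hn -off_degree; apply: off_leq. Qed.

Lemma content_point_neq0 i : (i < n)%N -> xcoord p i != 0.
Proof. by move=> ni; rewrite (xcoord_ord p (Ordinal ni)) expfz_neq0. Qed.

Lemma prod_nat_recr_cond (P : pred nat) (G : nat -> K) k : (0 < k)%N ->
  \prod_(1 <= i < k.+1 | P i) G i =
  (\prod_(1 <= i < k | P i) G i) * (if P k then G k else 1).
Proof. by move=> k0; rewrite big_mkcond big_nat_recr //= -big_mkcond. Qed.

Lemma ev_ext L d d' c c' ks : d = d' -> c = c' -> ev L d c ks -> ev L d' c' ks.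
Proof. by move=> -> ->. Qed.

(** The last coefficient of a chain involves the last number of row k when the
    numbers of row l move, and the first number of row l when those of row k
    move.  In the first case the content of row k is the greater one, as its end
    exceeds that of row l; in the second case row l starts with a smaller content than
    row k, unless the rows are parallel. *)
Lemma cross_block l k ks : (k.+1 < l <= r)%N ->
  ev (crossed l k) (part_delta l k) (part_const l k) ks ->
  ev (crossed l k.+1) (part_delta l k.+1) (part_const l k.+1) (ks ++ cross_word la k.+1 l).
Proof.
move=> /andP[kl lr].
have kr : (1 <= k.+1 <= r)%N by lia.
have lr' : (1 <= l <= r)%N by lia.
have ok : off k.+2 = (off k.+1 + len k.+1)%N by rewrite offS.
have okl : (off k.+2 <= off l)%N by apply: off_leq; lia.
have lenk := row_len_gt0 hla kr; have lenl := row_len_gt0 hla lr'.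
pose X := rev (iota (off k.+2) (off l - off k.+2)).
pose V := rev (iota 0 (off k.+1)) ++ iota (off l.+1) (n - off l.+1).
have sX : (off l - off k.+2)%N = size X by rewrite size_rev size_iota.
have e1 : crossed l k = X ++ rev (iota (off k.+1) (len k.+1)) ++ rev (iota (off l) (len l)) ++ V.
  rewrite /crossed (_ : (off l - off k.+1 = len k.+1 + (off l - off k.+2))%N); last by lia.
  by rewrite iotaD rev_cat -ok -catA.
have e2 : crossed l k.+1 = X ++ rev (iota (off l) (len l)) ++ rev (iota (off k.+1) (len k.+1)) ++ V.
  by rewrite /crossed [in iota 0 _]ok iotaD rev_cat add0n -catA.
have rowk (x : 'I_n -> K) : F_space q la x -> generic x -> q_progression q x (off k.+1) (len k.+1).
  by move=> Fx _; apply: (F_q_progression hn q0).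
have rowl (x : 'I_n -> K) : F_space q la x -> generic x -> q_progression q x (off l) (len l).
  by move=> Fx _; apply: (F_q_progression hn q0).
have le_kl : (off k.+1 + len k.+1 <= off l)%N by rewrite -ok.
have bl : row_b la l = row_a la l + (len l)%:Z - 1 by apply: row_lenE.
have bk : row_b la k.+1 = row_a la k.+1 + (len k.+1)%:Z - 1 by apply: row_lenE.
have ends := row_ends hla (_ : 1 <= k.+1 < l)%N lr.
rewrite e1 e2 => evk.
have eqd : part_delta l k.+1 = fun x => part_delta l k x *
    (if parallel la k.+1 l then pair_delta x k.+1 l else 1).
  by apply: boolp.funext => x; rewrite /part_delta prod_nat_recr_cond // mulrA.
have eqc : part_const l k.+1 = part_const l k *
    (if parallel la k.+1 l then f_const q (len k.+1) else 1).
  by rewrite /part_const prod_nat_recr_cond // mulrA.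
rewrite eqd eqc /cross_word; case: ifP => par.
  have elen := parallel_len hla kr lr' par.
  rewrite cats0; move: evk rowl; rewrite -elen => evk rowl.
  apply: (evaluates_parallel TH q0 qk _ _ lenk _ rowk rowl) => //.
  - by apply: F_dense.
  - exact: content_point_neq0.
  move=> s sl; rewrite -[off l]addn0 !content_point_coord // addr0.
  by case/andP: par => /eqP -> _; rewrite expfzDr // mulrC -exprnP.
apply: (@ev_ext _ (part_delta l k) _ (part_const l k)).
- by apply: boolp.funext => x; rewrite mulr1.
- by rewrite mulr1.
rewrite sX; case: ifP => se.
  apply: (evaluates_blocks_right TH q0 qk _ lenl le_kl rowl) => //; first exact: content_point_neq0.
  move=> s sl; rewrite -[off l]addn0 !content_point_coord // addr0.
  apply/eqP => /(expz_inj q0 qk); move: se par; rewrite /same_end /parallel.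
  by case: ends => [|h|[h1 h2]]; lia.
apply: (evaluates_blocks_left TH q0 qk _ lenk le_kl rowk) => //; first exact: content_point_neq0.
move=> s sl; rewrite !content_point_coord //; last by lia.
apply/eqP => /(expz_inj q0 qk); move: se; rewrite /same_end.
by case: ends => [|h|[h1 h2]]; lia.
Qed.

(** Reversing row l and then crossing rows 1, ..., l-1 in this order sorts the
    numbers of the first l rows decreasingly. *)
Lemma cross_row l ks : (1 <= l <= r)%N ->
  ev (base l.-1) (part_delta l 0) (part_const l 0) ks ->
  ev (base l) (part_delta l.+1 0) (part_const l.+1 0) (ks ++ row_word la l).
Proof.
move=> lr evl; have [l1 lr'] := andP lr.
have ol : off l.+1 = (off l + len l)%N by rewrite offS.
have on := off_max lr'.
have rev_row : ev (crossed l 0) (part_delta l 0) (part_const l 0) (ks ++ reverse_word (off l) (len l)).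
  rewrite /crossed off1 subn0 /=.
  have {3}-> : off l = size (rev (iota 0 (off l))) by rewrite size_rev size_iota.
  apply: (evaluates_reverse_word TH q0 qk).
  - exact: content_point_neq0.
  - by move=> x Fx _; apply: (F_q_progression hn q0).
  - move=> s sl; rewrite !content_point_coord //; last by lia.
    by apply/eqP => /(expz_inj q0 qk); lia.
  move: evl; rewrite /base prednK // ol.
  rewrite (_ : n - off l = len l + (n - (off l + len l)))%N; last by lia.
  by rewrite iotaD.
have crosses k : (k < l)%N -> ev (crossed l k) (part_delta l k) (part_const l k)
    (ks ++ reverse_word (off l) (len l) ++ flatten [seq cross_word la i l | i <- iota 1 k]).
  elim: k => [|k IH] kl; first by rewrite cats0.
  have -> : iota 1 k.+1 = iota 1 k ++ [:: k.+1] by rewrite -[X in iota 1 X]addn1 iotaD add1n.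
  rewrite map_cat flatten_cat /= cats0 !catA.
  by apply: cross_block; [lia|rewrite -!catA; apply: IH; lia].
have := crosses l.-1; rewrite prednK // => /(_ (leqnn _)).
rewrite /crossed prednK // subnn /= catA -rev_cat -iotaD -ol.
have e : part_delta l l.-1 = part_delta l.+1 0.
  apply: boolp.funext => x; rewrite /part_delta big_nat_recr //= prednK //.
  by rewrite [X in _ = _ * X]big_geq // mulr1.
by rewrite e /part_const prednK // big_nat_recr //= [X in _ -> ev _ _ (_ * X) _]big_geq // mulr1.
Qed.

Lemma cross_rows l : (l <= r)%N ->
  ev (base l) (part_delta l.+1 0) (part_const l.+1 0) (diagram_word la l).
Proof.
elim: l => [|l IH] lr.
  rewrite /base off1 /= subn0 /part_const !big_geq // mulr1.
  apply: ev_ext (evaluates_start _ _ _ _) => //.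
  by apply: boolp.funext => x; rewrite /part_delta !big_geq // mulr1.
have e : iota 1 l.+1 = iota 1 l ++ [:: l.+1] by rewrite -[X in iota 1 X]addn1 iotaD add1n.
rewrite /diagram_word e map_cat flatten_cat /= cats0.
by apply: cross_row; [lia|apply: IH; lia].
Qed.

Lemma evaluates_all :
  ev (rev (iota 0 n)) (part_delta r.+1 0) (part_const r.+1 0) (diagram_word la r).
Proof.
by have := cross_rows (leqnn r); rewrite /base off_degree hn subnn cats0.
Qed.

End RowInduction.

(** * The factor delta and the leading coefficient *)

Section Delta.
Variables (K : fieldType) (q : K) (n : nat) (la : seq (int * int)).
Hypothesis hla : cherednik la.
Hypothesis hn : degree la = n.
Notation r := (size la).
Notation len := (row_len la).
Notation off := (row_offset la).

(** Only the leftmost boxes of the rows enter delta, so products over numbers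
    reduce to products over rows. *)
Lemma prod_leftmost (g : nat -> K) :
  (forall l t, (1 <= l <= r)%N -> (0 < t < len l)%N -> g (off l + t)%N = 1) ->
  \prod_(0 <= a < n) g a = \prod_(1 <= i < r.+1) g (off i).
Proof.
move=> g1; rewrite -hn -off_degree; have : (r <= r)%N by [].
elim: {1 3 4}r => [|l IH] lr; first by rewrite off1 !big_geq.
have lr1 : (1 <= l.+1 <= r)%N by lia.
have l0 := row_len_gt0 hla lr1; have ol : off l.+2 = (off l.+1 + len l.+1)%N by rewrite offS.
rewrite (@big_cat_nat _ _ _ (off l.+1)) //=; last by rewrite ol leq_addr.
rewrite IH ?(ltnW lr) // [RHS]big_nat_recr //=; congr (_ * _).
rewrite big_ltn; last by lia.
rewrite big_nat big1 ?mulr1 // => a al.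
by have := g1 l.+1 (a - off l.+1)%N lr1; rewrite subnKC; [apply; lia|lia].
Qed.

Lemma off_ltn i j : (1 <= i <= r)%N -> (1 <= j <= r)%N -> (off i < off j)%N = (i < j)%N.
Proof.
move=> ir jr; have h k l : (1 <= k <= r)%N -> (k < l)%N -> (off k < off l)%N.
  move=> kr kl; apply: (@leq_trans (off k.+1)); last by apply: off_leq; lia.
  by rewrite offS ?(andP kr).1 // -addn1 leq_add2l row_len_gt0.
case: (ltngtP i j) => [ij|ji|->]; [exact: h| |exact: ltnn].
by apply/negbTE; rewrite -leqNgt ltnW // h.
Qed.

Lemma deltaE (x : 'I_n -> K) : delta la x = part_delta la r.+1 0 x.
Proof.
rewrite /part_delta [X in _ = _ * X]big_geq // mulr1.
pose P (a b : nat) := [&& (a < b)%N, leftmost la a, leftmost la b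
  & parallel la (row_of la a) (row_of la b)].
pose G (a b : nat) : K := if P a b then 1 - xcoord x b / xcoord x a else 1.
have -> : delta la x = \prod_(0 <= a < n) \prod_(0 <= b < n) G a b.
  rewrite big_mkord; apply: eq_bigr => a _; rewrite big_mkord big_mkcond.
  by apply: eq_bigr => b _; rewrite /G !xcoord_ord.
have Pa a b l t : (1 <= l <= r)%N -> (0 < t < len l)%N ->
    (a = off l + t)%N \/ (b = off l + t)%N -> G a b = 1.
  move=> lr /andP[t0 tl] ab; rewrite /G; case: ifP => // /and4P[_ la1 lb1 _].
  by case: ab => e; [move: la1|move: lb1]; rewrite e leftmostE // => /eqP; lia.
rewrite prod_leftmost => [|l t lr tl]; last first.
  by rewrite big1 // => b _; apply: (Pa _ _ l t) => //; left.
transitivity (\prod_(1 <= i < r.+1) \prod_(1 <= j < r.+1) G (off i) (off j)).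
  apply: eq_bigr => i _; apply: prod_leftmost => l t lr tl.
  by apply: (Pa _ _ l t) => //; right.
rewrite exchange_big_nat /=; rewrite [LHS]big_nat [RHS]big_nat; apply: eq_bigr => j jr.
rewrite (@big_cat_nat _ _ _ j 1) //=; [|lia|lia].
rewrite [X in _ * X]big_nat [X in _ * X]big1 ?mulr1 => [|i ij].
  rewrite [RHS]big_mkcond [LHS]big_nat [RHS]big_nat; apply: eq_bigr => i ij.
  have [lenj leni] : (0 < len j)%N /\ (0 < len i)%N by split; apply: row_len_gt0 => //; lia.
  have ir : (1 <= i <= r)%N by lia.
  have [ej ei] := (@row_ofE la j 0 jr lenj, @row_ofE la i 0 ir leni).
  have [fj fi] := (@leftmostE la j 0 jr lenj, @leftmostE la i 0 ir leni).
  rewrite !addn0 in ej ei fj fi.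
  by rewrite /G /P off_ltn // ej ei fj fi /pair_delta (_ : (i < j)%N) //; lia.
by rewrite /G /P off_ltn; [case: ltnP => //; lia|lia|lia].
Qed.

Lemma a_constE : a_const q n la = part_const q la r.+1 0.
Proof.
rewrite /part_const [X in _ = _ * X]big_geq // mulr1 /a_const /parallel_pairs.
under eq_bigr => m _ do rewrite -prodrXr.
rewrite exchange_big_nat /=; rewrite [LHS]big_nat [RHS]big_nat; apply: eq_bigr => j jr.
under eq_bigr => m _ do rewrite -prodrXr.
rewrite exchange_big_nat /= [RHS]big_mkcond [LHS]big_nat [RHS]big_nat.
apply: eq_bigr => i ij; case: (parallel la i j); last by rewrite big1 // => m _; rewrite expr0.
have ir : (1 <= i <= r)%N by lia.
have leni := row_len_gt0 hla ir.
have lenn : (len i <= n)%N.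
  rewrite -hn -off_degree; apply: (@leq_trans (off i.+1)); last by apply: off_leq; lia.
  by rewrite offS ?leq_addl; lia.
transitivity (\prod_(1 <= m < n.+1 | m == len i) f_const q m).
  rewrite [RHS]big_mkcond; apply: eq_bigr => m _.
  by rewrite /= eq_sym; case: eqP => _; rewrite ?expr0 ?expr1.
by rewrite big_nat1_eq leni ltnS lenn.
Qed.

End Delta.

(** * The generators of the Hecke algebra *)

Lemma quadratic_relation (K : fieldType) (A : algType K) (q : K) (t : A) :
  (t - q%:A) * (t + 1) = 0 -> t * t = (q - 1) *: t + q%:A.
Proof.
rewrite mulrBl mulrDr mulr1 mulr_algl scalerDr => /eqP; rewrite subr_eq0 => /eqP e.
by rewrite -[LHS](addrK t) e scalerBl scale1r addrAC.
Qed.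

Lemma hecke_gens_image (K : fieldType) (q : K) (n : nat) (A B : algType K)
    (f : A -> B) (g : 'I_n.-1 -> A) :
  (forall x y, f (x * y) = f x * f y) -> (forall x y, f (x - y) = f x - f y) ->
  (forall x y, f (x + y) = f x + f y) -> (forall c, f c%:A = c%:A) ->
  (forall x, hecke_rel q g x -> f x = 0) -> hecke_gens q (f \o g).
Proof.
move=> fM fB fD fA f0; have f1 : f 1 = 1 by have := fA 1; rewrite !scale1r.
split=> [k l kl|k l kl|k] /=.
- by apply: subr0_eq; rewrite -!fM -fB f0 //; apply: hecke_braid.
- by apply: subr0_eq; rewrite -!fM -fB f0 //; apply: hecke_comm; rewrite kl.
- apply: quadratic_relation; have := f0 _ (hecke_quad q g k).
  by rewrite fM fB fD fA f1.
Qed.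

Section HeckeGens.
Variables (K : fieldType) (q : K) (n : nat).
Local Notation I := (hecke_ideal_gen q (n := n)).

Lemma rel_to_quot (f : free_alg K 'I_n.-1) : I f -> to_quot I f = 0.
Proof.
move=> If; rewrite -(raddf0 (to_quot I)); apply/to_quotP/boolp.asboolP.
rewrite subr0 -[f]mulr1 -[f]mul1r -[X in two_sided_ideal _ X]add0r.
by apply: tsi_add => //; apply: tsi_zero.
Qed.

Lemma hecke_gensP : hecke_gens q (Tgen q (n := n)).
Proof.
apply: (@hecke_gens_image K q n _ (hecke q n) (to_quot I)).
- exact: to_quotM.
- exact: to_quotB.
- exact: raddfD.
- by move=> c; apply: to_quotZ.
- exact: rel_to_quot.
Qed.

End HeckeGens.

(** * The leading term *)

Section LeadingTerm.
Variables (K : fieldType) (q : K) (n : nat) (la : seq (int * int)).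
Variables (H : algType K) (T : 'I_n.-1 -> H).
Hypothesis TH : hecke_gens q T.
Hypothesis hla : cherednik la.
Hypothesis hn : degree la = n.
Hypothesis q0 : q != 0.
Hypothesis qk : forall k, (0 < k)%N -> q ^+ k != 1.

(** Density makes the value unique, so it is the one that was computed. *)
Lemma E_eltP : exists E, E_elt q la T = E /\
  lead T (part_const q la (size la).+1 0) (diagram_word la (size la)) E.
Proof.
have [_ [E [regE leadE]]] := evaluates_all TH hla hn q0 qk.
exists E; split=> //.
have regE' : regular_with_value (@F_space K q n la) (@generic K n)
    (fun x => delta la x *: phi0 q T x) (content_point q la) E.
  apply: regular_ext regE => x _ _; rewrite (deltaE hla hn) phi_line_longest //.
rewrite /E_elt; case: classical_sets.xgetP => [e _ eE|/(_ E)]; last by case.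
exact: (regular_unique (F_dense hn q0 qk) eE regE').
Qed.

Lemma reduced_diagram_word : reduced (w_elt n la) (ordw n (diagram_word la (size la))).
Proof.
have wE : permw n (diagram_word la (size la)) = w_elt n la.
  by rewrite w_eltE //; apply: oneline_inj; rewrite !oneline_permw run_diagram_word.
have sz : size (diagram_word la (size la)) = length (w_elt n la).
  by rewrite size_diagram_word w_eltE // length_normal_word.
rewrite /reduced -{1}wE eqxx /= eqn_leq -{1}sz size_ordw /= -wE.
exact: length_word.
Qed.

Lemma leading_term : exists a_ : 'S_n -> K,
  E_elt q la T = a_const q n la *: Tw T (w_elt n la)
    + \sum_(w : 'S_n | (length w < length (w_elt n la))%N) a_ w *: Tw T w.
Proof.
have [E [-> ]] := E_eltP; have red := reduced_diagram_word.
rewrite /lead; have -> : size (diagram_word la (size la)) = length (w_elt n la).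
  by rewrite size_diagram_word w_eltE // length_normal_word.
case=> a aE; exists a; rewrite -aE.
by rewrite -(a_constE q hla hn) /Tnat (Tword_reduced TH red) addrC subrK.
Qed.

End LeadingTerm.

Theorem proposition4 (R : realType) (n : nat) (la : seq (int * int))
    (hla : cherednik la) (hn : degree la = n) :
  let q : Cq R := qvar R in
  let T : 'I_n.-1 -> hecke q n := Tgen q (n := n) in
  let wla : 'S_n := w_elt n la in
  exists a_ : 'S_n -> Cq R,
    E_elt q la T = a_const q n la *: Tw T wla
      + \sum_(w : 'S_n | (length w < length wla)%N) a_ w *: Tw T w.
Proof.
move=> q T wla.
have TH : hecke_gens q T := hecke_gensP q n.
have q0 : q != 0 by rewrite /q /qvar tofrac_eq0 polyX_eq0.
have qk k : (0 < k)%N -> q ^+ k != 1.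
  move=> k0; rewrite /q /qvar -tofracXn -tofrac1 tofrac_eq.
  by apply/eqP => /(congr1 (fun p : {poly _} => size p)); rewrite size_polyXn size_poly1; lia.
exact: leading_term.
Qed.
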